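(* Let $d\ge3$, $h>0$, $q\in[1,\infty]$, $L>0$, and let $f:\mathbb{R}^d\to\mathbb{R}$ be $L$-Lipschitz with respect to the $\ell_q$-norm. Let $U$ be uniformly distributed on $B_1^d$ and $\zeta$ uniformly distributed on $\partial B_1^d$. For $x\in\mathbb{R}^d$ let $\mathsf{f}_h(x)=\mathbb{E}[f(x+hU)]$. Then: (i) $\mathsf{f}_h$ is differentiable and, for all $x\in\mathbb{R}^d$, $$\mathbb{E}\left[\frac{d}{2h}\big(f(x+h\zeta)-f(x-h\zeta)\big)\,\mathrm{sign}(\zeta)\right]=\nabla\mathsf{f}_h(x).$$ (ii) For all $x\in\mathbb{R}^d$, $|\mathsf{f}_h(x)-f(x)|\le \mathrm{b}_q(d)\,L\,h$. (iii) If $\Theta\subset\mathbb{R}^d$ is convex and $f$ is convex in $\Theta+hB_1^d$, then $\mathsf{f}_h$ is convex in $\Theta$ and $\mathsf{f}_h(x)\ge f(x)$ for all $x\in\Theta$.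
   Context: $B_1^d=\{x\in\mathbb{R}^d:\|x\|_1<1\}$ and $\partial B_1^d=\{x\in\mathbb{R}^d:\|x\|_1=1\}$; uniform distributions are with respect to Lebesgue measure and surface measure respectively. $\mathrm{sign}$ is applied componentwise, with value $1$ at $0$. $\log$ is the natural logarithm, $e$ is Euler's number. $\mathrm{b}_q(d)=\frac{1}{d+1}\,q\,d^{1/q}$ if $q\in[1,\log d)$ and $\mathrm{b}_q(d)=\frac{1}{d+1}\,e\log d$ if $q\ge\log d$. *)

(* Defs.v *)
(* R^d is the type 'rV[R]_d of row vectors, whose library norm (the sup norm)
   induces the usual topology, hence the usual notion of differentiability. *)
From HB Require Import structures.
From mathcomp Require Import all_boot all_order all_algebra.
From mathcomp Require Import all_classical all_reals all_analysis.

Set Implicit Arguments.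
Unset Strict Implicit.
Unset Printing Implicit Defensive.

Import Order.TTheory GRing.Theory Num.Theory.
Import numFieldNormedType.Exports.

Local Open Scope classical_set_scope.
Local Open Scope ring_scope.

(* Row vectors carry the product sigma-algebra, generated by the coordinates;
   over R it is the Borel sigma-algebra of R^n. The library has the same
   construction for tuples only. *)
Definition measure_rV_display : measure_display -> measure_display.
Proof. exact. Qed.

Section measurable_rV.
Context {disp : measure_display} {T : sigmaRingType disp}.
Variable n : nat.

Let coors : 'I_n -> 'rV[T]_n -> T := fun i x => x ord0 i.

Let rV_set0 : g_sigma_preimage coors set0.
Proof. exact: sigma_algebra0. Qed.

Let rV_setC A : g_sigma_preimage coors A -> g_sigma_preimage coors (~` A).
Proof. exact: sigma_algebraC. Qed.

Let rV_bigcup (F : (set 'rV[T]_n)^nat) :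
  (forall i, g_sigma_preimage coors (F i)) ->
  g_sigma_preimage coors (\bigcup_i (F i)).
Proof. exact: sigma_algebra_bigcup. Qed.

HB.instance Definition _ := @isMeasurable.Build (measure_rV_display disp)
  'rV[T]_n (g_sigma_preimage coors) rV_set0 rV_setC rV_bigcup.

End measurable_rV.

Section defs.
Context {R : realType}.

(* The value at q = -oo is irrelevant: only 1 <= q is used. *)
Definition lqnorm (d : nat) (q : \bar R) (x : 'rV[R]_d) : R :=
  match q with
  | r%:E => (\sum_(i < d) `|x ord0 i| `^ r) `^ r^-1
  | +oo%E => \big[Num.max/0]_(i < d) `|x ord0 i|
  | -oo%E => 0
  end.

Definition l1ball (d : nat) : set 'rV[R]_d := [set x | lqnorm 1%:E x < 1].

Definition l1sphere (d : nat) : set 'rV[R]_d := [set x | lqnorm 1%:E x = 1].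

(* n-fold product of the Lebesgue measure, through R^n.+1 = R x R^n. *)
Fixpoint lebesgue_rV (n : nat) : set 'rV[R]_n -> \bar R :=
  match n with
  | 0 => \d_(0 : 'rV[R]_0)
  | m.+1 => pushforward (@lebesgue_measure R \x lebesgue_rV (n := m))%E
      (fun p : measurableTypeR R * 'rV[R]_m =>
         row_mx (const_mx p.1 : 'rV[R]_1) p.2 : 'rV[R]_m.+1)
  end.

(* ereal_sup set0 = -oo, whence the max with 0 for the empty set. *)
Definition diam (d : nat) (E : set 'rV[R]_d) : \bar R :=
  maxe 0%E (ereal_sup [set (lqnorm 2%:E (x - y))%:E | x in E & y in E]).

Definition hausdorff_content (d s : nat) (delta : R) (A : set 'rV[R]_d) :
    \bar R :=
  ereal_inf [set (\sum_(0 <= k <oo) diam (E k) ^+ s)%E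
    | E in [set E : (set 'rV[R]_d)^nat |
        A `<=` \bigcup_k E k /\ forall k, (diam (E k) <= delta%:E)%E]].

(* s-dimensional Hausdorff measure with Euclidean diameters, up to the usual
   dimensional constant, which cancels in uniform_law. Meant for s >= 1: for
   s = 0 the empty set would contribute diam set0 ^+ 0 = 1. *)
Definition hausdorff (d s : nat) (A : set 'rV[R]_d) : \bar R :=
  ereal_sup [set hausdorff_content s delta A | delta in [set e : R | 0 < e]].

(* Surface measure on a hypersurface of R^d: (d-1)-dimensional Hausdorff
   measure. *)
Definition surface_measure (d : nat) : set 'rV[R]_d -> \bar R :=
  hausdorff d.-1.

Definition uniform_law (d : nat) (mu : set 'rV[R]_d -> \bar R)
    (S : set 'rV[R]_d) (A : set 'rV[R]_d) : \bar R :=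
  (mu (A `&` S) / mu S)%E.

Definition sign1 (t : R) : R := if 0 <= t then 1 else -1.

Definition grad (d : nat) (f : 'rV[R]_d -> R) (x : 'rV[R]_d) : 'rV[R]_d :=
  \row_(i < d) 'D_(delta_mx ord0 i) f x.

Definition bq (q : \bar R) (d : nat) : R :=
  if (q < (ln d%:R)%:E)%E
  then d.+1%:R^-1 * fine q * d%:R `^ (fine q)^-1
  else d.+1%:R^-1 * expR 1 * ln d%:R.

Definition smoothing (d : nat) {disp : measure_display}
    {T : measurableType disp} (P : probability T R) (U : T -> 'rV[R]_d)
    (h : R) (f : 'rV[R]_d -> R) (x : 'rV[R]_d) : R :=
  fine ('E_P[(fun w => f (x + h *: U w))%R])%E.

Definition dilated_sum (d : nat) (Theta : set 'rV[R]_d) (h : R)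
    (B : set 'rV[R]_d) : set 'rV[R]_d :=
  [set t + h *: u | t in Theta & u in B].

End defs.

(* Main.v *)
Require Import Defs.
From HB Require Import structures.
From mathcomp Require Import all_boot all_order all_algebra.
From mathcomp Require Import all_classical all_reals all_analysis.
From mathcomp Require Import perm measurable_realfun.
From mathcomp Require Import ring lra.

Set Implicit Arguments.
Unset Strict Implicit.
Unset Printing Implicit Defensive.

Import Order.TTheory GRing.Theory Num.Theory.
Import numFieldNormedType.Exports.

Local Open Scope classical_set_scope.
Local Open Scope ring_scope.

(** The usual proof differentiates under the integral sign and uses the
    divergence theorem on the l1 ball. Here both are replaced by one-dimensional
    facts, once the two given laws are known in coordinates. Write [d = n.+1],
    [B] for the unit ball, [V_k] for the volume of the ball in dimension [k], and
    [u] for the last [n] coordinates of a point.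

    The law of [U] has density [1 / V_d] on the ball. The law of [zeta] is only
    known as a normalised Hausdorff measure on the sphere, and no area formula is
    used to compute it. It is a probability measure, hence both finite and nonzero,
    and it is invariant under every isometry of R^d as long as the isometry moves
    points inside the sphere ([sphere_law_isometry]). On a facet of the sphere the
    translations along the facet are such isometries, so the projection of the law
    that forgets coordinate 0 is locally translation invariant, and Fubini's theorem
    makes it a multiple of Lebesgue measure ([local_haar], [upper_corner]).
    Reflections carry this from one facet to all of them, the coordinate
    hyperplanes are null because infinitely many disjoint isometric copies of their
    pieces fit into the sphere ([sphere_hyperplane_null]), and normalisation fixes
    the factor. The outcome is [sphere_integral]: [zeta] is a uniform point [u] of
    the ball in dimension [n], lifted with a fair sign to (+-(1 - |u|), u).

    (i) Slice the ball in direction 0: above [u] lies the interval of radius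
    [1 - |u|], so the difference quotient of the mean of [f] in this direction is,
    up to O(t), [V_n / (h * V_d)] times the mean over [u] of the difference of [f]
    between the two lifts of [u] ([lipschitz_shift_integral], [directional_step0]).
    This is the stated expectation since [V_n / V_d = d / 2], which holds because the
    coordinates of [zeta] have absolute values of equal expectation and of sum 1
    ([ball_volume_rec]). Exchanging coordinates gives the other directions. The
    estimates are quadratic in [t] and uniform in the base point, and the candidate
    gradient is Lipschitz, so steps along the axes add up to differentiability
    ([coordinate_steps], [differentiable_quadratic]).

    (ii) For finite [r >= 1], slicing shows that |U_i| has density proportional to
    (1 - s)^n on [0, 1], and its r-th moment is at most (r / (r + d))^r
    ([coord_moment]). Young's inequality, tangent at the right point, turns this
    into E |U|_r <= d^(1/r) r / (r + d) ([ball_mean_deviation]). One takes [r = q]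
    when [q < log d], and [r = log d] otherwise, since the norms decrease in the
    exponent ([bq_exponent]).

    (iii) The mean of [f] over x + h B inherits convexity pointwise, and it
    dominates [f x] because [U] and [-U] have the same law. *)

(** * The l1 norm and measurability on row vectors *)

Definition l1norm (R : realType) (n : nat) (x : 'rV[R]_n) : R :=
  \sum_(i < n) `|x ord0 i|.

Section l1norm.
Context {R : realType} {n : nat}.
Implicit Types (x y : 'rV[R]_n).

Lemma lqnorm1 x : lqnorm 1%:E x = l1norm x.
Proof.
rewrite /lqnorm invr1 powRr1.
  by apply: eq_bigr => i _; rewrite powRr1.
by apply: sumr_ge0 => i _; rewrite powR_ge0.
Qed.

Lemma l1norm_ge0 x : 0 <= l1norm x.
Proof. exact: sumr_ge0. Qed.

Lemma l1normD x y : l1norm (x + y) <= l1norm x + l1norm y.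
Proof. by rewrite -big_split ler_sum// => i _; rewrite mxE ler_normD. Qed.

Lemma l1normZ a x : l1norm (a *: x) = `|a| * l1norm x.
Proof. by rewrite mulr_sumr; apply: eq_bigr => i _; rewrite mxE normrM. Qed.

Lemma l1normN x : l1norm (- x) = l1norm x.
Proof. by rewrite -scaleN1r l1normZ normrN1 mul1r. Qed.

Lemma ler_coord_l1norm x i : `|x ord0 i| <= l1norm x.
Proof. by rewrite /l1norm (bigD1 i)//= lerDl sumr_ge0. Qed.

End l1norm.

Lemma measurable_preim d1 d2 (T1 : measurableType d1) (T2 : measurableType d2)
    (f : T1 -> T2) (A : set T2) :
  measurable_fun setT f -> measurable A -> measurable (f @^-1` A).
Proof. by move=> mf mA; rewrite -[X in measurable X]setTI; exact: mf. Qed.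

Section measurable_rV.
Context {R : realType} {n : nat}.

Lemma measurable_coord (i : 'I_n) :
  measurable_fun [set: 'rV[R]_n] (fun x => x ord0 i).
Proof.
move=> _ Y mY; rewrite setTI; apply: sub_sigma_algebra => /=.
rewrite -bigcup_seq/=; exists i => /=; first by rewrite mem_index_enum.
by exists Y => //; rewrite setTI.
Qed.

(** The sigma-algebra on row vectors is the initial one for the coordinates. *)
Lemma measurable_rVP d (T : measurableType d) (f : T -> 'rV[R]_n) :
  (forall i, measurable_fun setT (fun t => f t ord0 i)) ->
  measurable_fun setT f.
Proof.
pose c := fun (i : 'I_n) (x : 'rV[R]_n) => x ord0 i.
move=> mf; suff fS : g_sigma_preimage (fun i => c i \o f) `<=` measurable.
  move=> _ A mA; apply: fS; rewrite g_sigma_preimage_comp.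
  by exists A.
apply: smallest_sub; first exact: sigma_algebra_measurable.
case: n => [|m] in c f mf *; first by rewrite big_ord0.
rewrite -bigcup_mkord_ord; apply: bigcup_sub => i Ii.
by move=> A [B mB <-]; exact: mf.
Qed.

Lemma measurable_l1norm : measurable_fun [set: 'rV[R]_n] (@l1norm R n).
Proof.
apply: measurable_sum => i; apply: measurableT_comp => //.
exact: measurable_coord.
Qed.

Lemma l1ballE : @l1ball R n = [set x | l1norm x < 1].
Proof. by apply/funext => x; rewrite /l1ball /mkset lqnorm1. Qed.

Lemma l1sphereE : @l1sphere R n = [set x | l1norm x = 1].
Proof. by apply/funext => x; rewrite /l1sphere /mkset lqnorm1. Qed.

#[global] Opaque l1ball l1sphere.

Lemma measurable_l1ball : measurable (@l1ball R n).
Proof.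
have -> : @l1ball R n = (@l1norm R n) @^-1` `]-oo, 1[.
  by rewrite l1ballE; apply/seteqP; split=> x; rewrite /= in_itv.
by rewrite -[X in measurable X]setTI; exact: measurable_l1norm.
Qed.

Lemma measurable_l1sphere : measurable (@l1sphere R n).
Proof.
have -> : @l1sphere R n = (@l1norm R n) @^-1` [set 1] by rewrite l1sphereE.
by rewrite -[X in measurable X]setTI; exact: measurable_l1norm.
Qed.

Lemma measurable_rVD (a : 'rV[R]_n) :
  measurable_fun setT (fun x : 'rV[R]_n => x + a).
Proof.
apply: measurable_rVP => i; under eq_fun do rewrite mxE.
by apply: measurable_funD => //; exact: measurable_coord.
Qed.

(** Rational points make the supremum in [measurable_lipschitz] a countable one. *)
Lemma rV_rat_dense (x : 'rV[R]_n) (e : R) : 0 < e ->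
  exists q : 'rV[rat]_n, l1norm (x - map_mx ratr q) < e.
Proof.
move=> e0; have [k k0 ke] : exists2 k : R, 0 < k & k * n%:R < e.
  (* [n.+1] and not [n], to cover dimension 0. *)
  exists (e / n.+1%:R); first by rewrite divr_gt0.
  by rewrite -mulrA gtr_pMr// mulrC ltr_pdivrMr// mul1r ltr_nat.
have /choice[q qx] : forall i : 'I_n, exists r : rat,
    `|x ord0 i - ratr r| < k.
  move=> i; have /rat_in_itvoo[r] : x ord0 i - k < x ord0 i + k by lra.
  by rewrite in_itv/= -ltr_distlC => ?; exists r.
exists (\row_i q i); apply: (@le_lt_trans _ _ (\sum_(i < n) k)).
  by apply: ler_sum => i _; rewrite !mxE ltW.
by rewrite sumr_const card_ord -mulr_natr.
Qed.

(** A Lipschitz function is the supremum of the cones [f q - L * |x - q|] with vertices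
    above the rational points [q], so its upper level sets are countable unions. This
    is how every integrand below is seen to be measurable for the product
    sigma-algebra. *)
Lemma measurable_lipschitz (L : R) (f : 'rV[R]_n -> R) :
  (forall x y, `|f x - f y| <= L * l1norm (x - y)) -> measurable_fun setT f.
Proof.
move=> fL; apply: (measurability _ (RGenOInfty.measurableE R)) => //.
move=> _ [_ [a ->] <-].
pose g (q : 'rV[rat]_n) (x : 'rV[R]_n) : R :=
  f (map_mx ratr q) - L * l1norm (x - map_mx ratr q).
have gf q x : g q x <= f x.
  rewrite lerBlDr -lerBlDl (le_trans (ler_norm _))//.
  by rewrite distrC fL.
have -> : setT `&` f @^-1` `]a, +oo[ = \bigcup_q (g q @^-1` `]a, +oo[).
  rewrite setTI; apply/seteqP; split => [x|x [q _]] /=; last first.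
    by rewrite !in_itv/= !andbT => /lt_le_trans; apply.
  rewrite in_itv/= andbT => afx.
  (* Within this distance of [x] the cone at [q] loses less than [f x - a] at [x]: once |L| times
     the distance because of [f q], and once more by its own slope. *)
  have e0 : 0 < (f x - a) / (2 * `|L| + 1) by rewrite divr_gt0 ?subr_gt0// ltr_wpDl// mulr_ge0.
  have [q qx] := rV_rat_dense x e0; exists q => //=.
  rewrite in_itv/= andbT /g.
  set y := map_mx ratr q in qx *; set N := l1norm (x - y) in qx *.
  have N0 : 0 <= N by exact: l1norm_ge0.
  have := fL x y; rewrite -/N => /(le_trans (ler_norm _)) fxy.
  have LN : L * N <= `|L| * N by apply: ler_wpM2r => //; exact: ler_norm.
  have L1 : 0 < 2 * `|L| + 1 by rewrite ltr_wpDl// mulr_ge0.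
  move: qx; rewrite ltr_pdivlMr// => qx.
  have : N * (2 * `|L| + 1) = 2 * (`|L| * N) + N by ring.
  lra.
apply: countable_bigcupT_measurable; first exact: countableP.
move=> q; rewrite -[X in measurable X]setTI.
suff mg : measurable_fun setT (g q) by exact: mg.
apply: measurable_funB => //; apply: measurable_funM => //.
by apply: (measurableT_comp measurable_l1norm); exact: (measurable_rVD (- _)).
Qed.

End measurable_rV.

(** * Lebesgue measure on row vectors *)

Definition rV_cons (R : realType) (n : nat) (s : R) (u : 'rV[R]_n) : 'rV[R]_n.+1 :=
  row_mx (const_mx s : 'rV_1) u.

Definition rV_tail (R : realType) (n : nat) (x : 'rV[R]_n.+1) : 'rV[R]_n :=
  \row_j x ord0 (lift ord0 j).

Section rV_cons.
Context {R : realType} {n : nat}.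
Implicit Types (s t : R) (u v : 'rV[R]_n) (x : 'rV[R]_n.+1).

Lemma rV_cons0 s u : rV_cons s u ord0 ord0 = s.
Proof.
rewrite /rV_cons mxE; by case: splitP => j /= j0; first by rewrite mxE.
Qed.

Lemma rV_consS s u i : rV_cons s u ord0 (lift ord0 i) = u ord0 i.
Proof.
rewrite /rV_cons mxE; case: splitP => j /=; last first.
  by rewrite /bump/= !add1n => -[ij]; congr (u _ _); apply: val_inj.
by rewrite ord1.
Qed.

Lemma rV_consK s u : rV_tail (rV_cons s u) = u.
Proof. by apply/rowP => i; rewrite mxE rV_consS. Qed.

Lemma rV_eta x : rV_cons (x ord0 ord0) (rV_tail x) = x.
Proof.
apply/rowP => i; case: (unliftP ord0 i) => [j|] ->; last by rewrite rV_cons0.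
by rewrite rV_consS mxE.
Qed.

Lemma l1norm_cons s u : l1norm (rV_cons s u) = `|s| + l1norm u.
Proof.
rewrite /l1norm big_ord_recl rV_cons0; congr (_ + _).
by apply: eq_bigr => i _; rewrite rV_consS.
Qed.

Lemma l1norm_recl x : l1norm x = `|x ord0 ord0| + l1norm (rV_tail x).
Proof. by rewrite -{1}(rV_eta x) l1norm_cons. Qed.

Lemma rV_consD s t u v : rV_cons s u + rV_cons t v = rV_cons (s + t) (u + v).
Proof.
apply/rowP => i; case: (unliftP ord0 i) => [j|] ->.
  by rewrite mxE !rV_consS mxE.
by rewrite mxE !rV_cons0.
Qed.

Lemma rV_consZ a s u : a *: rV_cons s u = rV_cons (a * s) (a *: u).
Proof.
apply/rowP => i; case: (unliftP ord0 i) => [j|] ->.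
  by rewrite mxE !rV_consS mxE.
by rewrite mxE !rV_cons0.
Qed.

Lemma rV_consN s u : - rV_cons s u = rV_cons (- s) (- u).
Proof. by rewrite -scaleN1r rV_consZ mulN1r scaleN1r. Qed.

Lemma measurable_rV_cons d (T : measurableType d) (a : T -> R) (b : T -> 'rV[R]_n) :
  measurable_fun setT a -> measurable_fun setT b ->
  measurable_fun setT (fun w => rV_cons (a w) (b w)).
Proof.
move=> ma mb; apply: measurable_rVP => i.
case: (unliftP ord0 i) => [j|] ->.
  under eq_fun do rewrite rV_consS.
  exact: (measurableT_comp (measurable_coord j)).
by under eq_fun do rewrite rV_cons0.
Qed.

Lemma measurable_rV_tail : measurable_fun setT (@rV_tail R n).
Proof.
apply: measurable_rVP => i; under eq_fun do rewrite mxE.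
exact: measurable_coord.
Qed.

End rV_cons.

Section pushforward.
Context d1 d2 (X : measurableType d1) (Y : measurableType d2) {R : realType}.
Local Open Scope ereal_scope.

(** [pushforward] with its measure structure, which is found through the measurability
    proof. *)
Definition push_measure (mu : {measure set X -> \bar R}) (phi : X -> Y)
    (mphi : measurable_fun setT phi) : {measure set Y -> \bar R}.
Proof. by refine (pushforward mu phi : {measure set Y -> \bar R}). Defined.

End pushforward.

(** Cubes are the only sets whose volume is computed directly from the definition. *)
Definition rV_box (R : realType) (n : nat) (a b : R) : set 'rV[R]_n :=
  [set u | forall i, a < u ord0 i < b].
Arguments rV_box {R} n a b.

Section lebesgue_rV.
Context {R : realType}.
Local Open Scope ereal_scope.

Lemma measurable_rV_box n (a b : R) : measurable (@rV_box R n a b).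
Proof.
have -> : @rV_box R n a b =
    \bigcap_(i : 'I_n) ((fun x : 'rV[R]_n => x ord0 i) @^-1` `]a, b[).
  apply/seteqP; split => x /=.
    by move=> xab i _ /=; rewrite in_itv/=; exact: xab.
  by move=> xab i; have := xab i I; rewrite /= in_itv.
apply: fin_bigcap_measurable => // i _; rewrite -[X in measurable X]setTI.
exact: measurable_coord.
Qed.

Lemma rV_box_cons n (a b : R) :
  (fun p : R * 'rV[R]_n => rV_cons p.1 p.2) @^-1` rV_box n.+1 a b =
  `]a, b[ `*` rV_box n a b.
Proof.
apply/seteqP; split => -[s u] /= => [uab|[sab uab] i].
  split; first by have := uab ord0; rewrite rV_cons0 in_itv.
  by move=> i; have := uab (lift ord0 i); rewrite rV_consS.
case: (unliftP ord0 i) => [j|] ->; first by rewrite rV_consS.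
by rewrite rV_cons0; move: sab; rewrite in_itv.
Qed.

(** The recursive definition pushes a product measure forward; that the product is a
    measure requires sigma-finiteness in the lower dimension, so the measure
    structure, sigma-finiteness and the volume of boxes (whose growing sequence
    exhausts the space) are proved in one induction. *)
Lemma lebesgue_rV_measure n :
  exists2 mu : {sigma_finite_measure set 'rV[R]_n -> \bar R},
    @lebesgue_rV R n = mu &
    forall a b : R, (a <= b)%R -> mu (rV_box n a b) = ((b - a) ^+ n)%:E.
Proof.
elim: n => [|n [mu muE mubox]] /=.
  exists (\d_(0%R : 'rV[R]_0)) => // a b _; rewrite expr0 [LHS]diracE mem_set//.
  by case.
rewrite muE.
have mcons : measurable_fun setT
    (fun p : (measurableTypeR R * 'rV[R]_n)%type => rV_cons p.1 p.2).
  exact: measurable_rV_cons.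
pose nu := push_measure (@lebesgue_measure R \x mu) mcons.
have nubox (a b : R) : (a <= b)%R -> nu (rV_box n.+1 a b) = ((b - a) ^+ n.+1)%:E.
  move=> ab; rewrite /nu/= /pushforward rV_box_cons product_measure1E//.
    rewrite mubox// [X in X * _](lebesgue_measure_itv `]a, b[)/= lte_fin exprS EFinM.
    case: ltP => // ba; have -> : a = b by apply/eqP; rewrite eq_le ab.
    by rewrite subrr.
  exact: measurable_rV_box.
have snu : sigma_finite setT nu.
  exists (fun k => rV_box n.+1 (- k%:R) k%:R); last first.
    by move=> k; split; [exact: measurable_rV_box|rewrite nubox ?ltry// -subr_ge0 opprK addr_ge0].
  apply/esym/seteqP; split=> // x _; exists (Num.truncn (l1norm x)).+1 => // i /=.
  rewrite -ltr_norml; apply: le_lt_trans (ler_coord_l1norm x i) _.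
  exact: truncnS_gt.
pose nu' : {sigma_finite_measure set 'rV[R]_n.+1 -> \bar R} :=
  HB.pack (nu : set _ -> \bar R) (Measure.class nu)
   (Measure_isSigmaFinite.Build _ _ _ (nu : set _ -> \bar R) snu).
by exists nu'.
Qed.

(** [lebesgue_rV] as a bundled measure, so that the integration theory applies to it. *)
Definition leb n : {sigma_finite_measure set 'rV[R]_n -> \bar R} :=
  s2val (cid2 (lebesgue_rV_measure n)).

Lemma lebE n : @lebesgue_rV R n = leb n.
Proof. by rewrite /leb; case: cid2 => mu muE mubox /=. Qed.

Lemma leb_box n (a b : R) : (a <= b)%R -> leb n (rV_box n a b) = ((b - a) ^+ n)%:E.
Proof. by rewrite /leb; case: cid2 => mu muE mubox /=; exact: mubox. Qed.

#[global] Opaque leb.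

Lemma leb_cons n (A : set 'rV[R]_n.+1) : measurable A ->
  leb n.+1 A = \int[lebesgue_measure]_s leb n (rV_cons s @^-1` A).
Proof.
move=> mA; rewrite -lebE /= /pushforward lebE; apply: eq_integral => s _ /=.
by congr (leb n _); apply/seteqP; split=> u; rewrite /xsection/= inE.
Qed.

End lebesgue_rV.

#[global] Opaque rV_cons.

(** Diagonal affine maps contain the translations, the reflections in coordinate
    hyperplanes and the dilations, and they act coordinate by coordinate. *)
Definition rV_diag (R : realType) (n : nat) (a v x : 'rV[R]_n) : 'rV[R]_n :=
  \row_i (a ord0 i * x ord0 i + v ord0 i).

Section lebesgue_affine.
Context {R : realType}.
Local Open Scope ereal_scope.

(** Rescaling the pushforward gives back the length of intervals, which determines
    Lebesgue measure. *)
Lemma lebesgue_measure_affine (a b : R) (A : set (measurableTypeR R)) :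
  a != 0%R -> measurable A ->
  lebesgue_measure ((fun s => a * s + b)%R @^-1` A) =
  (`|a|^-1)%:E * lebesgue_measure A.
Proof.
move=> a0 mA.
have ma : measurable_fun setT
    ((fun s => a * s + b)%R : measurableTypeR R -> measurableTypeR R).
  by apply: measurable_funD => //; exact: measurable_funM.
have na0 : (0 <= `|a|)%R by [].
pose mu := mscale (NngNum na0) (push_measure (@lebesgue_measure R) ma).
have -> : lebesgue_measure A = mu A.
  apply: lebesgue_measure_unique => // _ [[x y]] /= _ <-.
  rewrite /mu /= /mscale/= /pushforward.
  have [xy|yx] := ltP x y; last first.
    have -> : `]x, y]%classic = set0 :> set R.
      by apply/seteqP; split => z //=; rewrite in_itv/=; lra.
    by rewrite preimage_set0 !measure0 mule0.
  rewrite lebesgue_measure_itv/= lte_fin xy.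
  have [a_gt0|a_lt0|a_eq0] := ltgtP 0%R a; last by rewrite -a_eq0 eqxx in a0.
  - have -> : (fun s => a * s + b)%R @^-1` `]x, y] =
      `]((x - b) / a)%R, ((y - b) / a)%R]%classic.
      apply/seteqP; split => s /=;
        by rewrite !in_itv/= ltr_pdivrMr// ler_pdivlMr//; lra.
    rewrite lebesgue_measure_itv/= lte_fin ltr_pM2r ?invr_gt0// ltrD2r xy.
    rewrite -EFinB -EFinM gtr0_norm//; congr (_%:E); by field.
  - have -> : (fun s => a * s + b)%R @^-1` `]x, y] =
      `[((y - b) / a)%R, ((x - b) / a)%R[%classic.
      apply/seteqP; split => s /=;
        by rewrite !in_itv/= ltr_ndivlMr// ler_ndivrMr//; lra.
    rewrite lebesgue_measure_itv/= lte_fin ltr_nM2r ?invr_lt0// ltrD2r xy.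
    rewrite -EFinB -EFinM ltr0_norm//; congr (_%:E); by field.
rewrite /mu/= /mscale/= /pushforward muleA -EFinM mulVf ?mul1e//.
by rewrite normr_eq0.
Qed.

Lemma ge0_integral_affine (a b : R) (g : R -> \bar R) :
  a != 0%R -> measurable_fun setT g -> (forall s, 0 <= g s) ->
  \int[lebesgue_measure]_s g (a * s + b)%R =
  (`|a|^-1)%:E * \int[lebesgue_measure]_s g s.
Proof.
move=> a0 mg g0.
have ma : measurable_fun setT
    ((fun s => a * s + b)%R : measurableTypeR R -> measurableTypeR R).
  by apply: measurable_funD => //; exact: measurable_funM.
have na0 : (0 <= `|a|^-1)%R by rewrite invr_ge0.
transitivity (\int[push_measure (@lebesgue_measure R) ma]_s g s).
  by rewrite ge0_integral_pushforward.
rewrite -(ge0_integral_mscale _ _ (NngNum na0))//.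
apply: eq_measure_integral => A mA _ /=.
by rewrite /pushforward /mscale/= lebesgue_measure_affine.
Qed.

Lemma measurable_rV_diag n (a v : 'rV[R]_n) : measurable_fun setT (rV_diag a v).
Proof.
apply: measurable_rVP => i; under eq_fun do rewrite mxE.
apply: measurable_funD => //; apply: measurable_funM => //.
exact: measurable_coord.
Qed.

Lemma rV_diag_cons n (a v : 'rV[R]_n.+1) s u :
  rV_diag a v (rV_cons s u) =
  rV_cons (a ord0 ord0 * s + v ord0 ord0)%R (rV_diag (rV_tail a) (rV_tail v) u).
Proof.
apply/rowP => i; case: (unliftP ord0 i) => [j|] ->.
  by rewrite mxE !rV_consS !mxE.
by rewrite mxE !rV_cons0.
Qed.

Lemma measurable_fun_leb_cons n (A : set 'rV[R]_n.+1) : measurable A ->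
  measurable_fun setT (fun s : measurableTypeR R => leb n (rV_cons s @^-1` A)).
Proof.
move=> mA.
have mB : measurable ((fun p : (measurableTypeR R * 'rV[R]_n)%type =>
    rV_cons p.1 p.2) @^-1` A).
  rewrite -[X in measurable X]setTI.
  by have : measurable_fun setT (fun p : (measurableTypeR R * 'rV[R]_n)%type =>
    rV_cons p.1 p.2) by [exact: measurable_rV_cons]; apply.
have := @measurable_fun_xsection _ _ _ _ _ (leb n) _ mB.
congr measurable_fun; apply/funext => s /=; congr (leb n _).
by apply/seteqP; split => u; rewrite /xsection/= inE.
Qed.

(** Induction on the dimension: slices of the preimage are preimages of slices, so the
    one-dimensional change of variables applies to the outer integral. *)
Lemma leb_diag n (a v : 'rV[R]_n) (A : set 'rV[R]_n) :
  (forall i, a ord0 i != 0%R) -> measurable A ->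
  leb n (rV_diag a v @^-1` A) = (\prod_i `|a ord0 i|^-1)%:E * leb n A.
Proof.
elim: n a v A => [|n IH] a v A a0 mA.
  rewrite big_ord0 mul1e; congr (leb 0 _); apply/seteqP; split => x /=;
    by rewrite (_ : rV_diag a v x = x)//; apply/rowP; case.
have mA' : measurable (rV_diag a v @^-1` A).
  by rewrite -[X in measurable X]setTI; exact: measurable_rV_diag.
rewrite leb_cons// leb_cons// big_ord_recl EFinM.
pose c := (\prod_(i < n) `|a ord0 (lift ord0 i)|^-1)%R.
have c0 : (0 <= c)%R by apply: prodr_ge0 => i _; rewrite invr_ge0.
transitivity (\int[lebesgue_measure]_s
    (c%:E * leb n (rV_cons (a ord0 ord0 * s + v ord0 ord0)%R @^-1` A))).
  apply: eq_integral => s _.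
  have mcA : measurable (rV_cons (a ord0 ord0 * s + v ord0 ord0)%R @^-1` A).
    rewrite -[X in measurable X]setTI.
    suff : measurable_fun setT (@rV_cons R n (a ord0 ord0 * s + v ord0 ord0)%R).
      by apply.
    exact: measurable_rV_cons.
  have -> : c%:E = (\prod_i `|rV_tail a ord0 i|^-1)%:E.
    by congr (_%:E); apply: eq_bigr => i _; rewrite mxE.
  rewrite -(IH _ (rV_tail v))// => [|i]; last by rewrite mxE.
  congr (leb n _); apply/seteqP; split=> u /=; rewrite rV_diag_cons//.
rewrite ge0_integralZl//; last first.
  apply: (measurableT_comp (measurable_fun_leb_cons mA)).
  by apply: measurable_funD => //; exact: measurable_funM.
rewrite (@ge0_integral_affine _ _ (fun s => leb n (rV_cons s @^-1` A)))//.
  by rewrite muleA (muleC c%:E).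
exact: measurable_fun_leb_cons.
Qed.

End lebesgue_affine.

(** * Locally translation-invariant measures *)

Section haar.
Context {R : realType}.
Local Open Scope ereal_scope.

(** Fubini's theorem for an indicator function, in terms of sections. *)
Lemma product_measure_swap d1 d2 (T1 : measurableType d1) (T2 : measurableType d2)
    (m1 : {sigma_finite_measure set T1 -> \bar R})
    (m2 : {sigma_finite_measure set T2 -> \bar R}) (E : set (T1 * T2)) :
  measurable E ->
  \int[m1]_x m2 [set y | E (x, y)] = \int[m2]_y m1 [set x | E (x, y)].
Proof.
move=> mE.
have xs x : xsection E x = [set y | E (x, y)].
  by apply/seteqP; split=> y; rewrite /xsection/= inE.
have ys y : ysection E y = [set x | E (x, y)].
  by apply/seteqP; split=> x; rewrite /ysection/= inE.
under eq_integral do rewrite -xs; under [RHS]eq_integral do rewrite -ys.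
have := @indic_fubini_tonelli _ _ _ _ _ m1 m2 E mE.
by rewrite indic_fubini_tonelli_FE// indic_fubini_tonelli_GE.
Qed.

Lemma measurable_rV_add d (T : measurableType d) n (f g : T -> 'rV[R]_n) :
  measurable_fun setT f -> measurable_fun setT g ->
  measurable_fun setT (fun w => f w + g w)%R.
Proof.
move=> mf mg; apply: measurable_rVP => i; under eq_fun do rewrite mxE.
apply: measurable_funD; exact: (measurableT_comp (measurable_coord i)).
Qed.

Lemma leb_translate n (v : 'rV[R]_n) (A : set 'rV[R]_n) : measurable A ->
  leb n ((fun x => v + x)%R @^-1` A) = leb n A.
Proof.
move=> mA; have := @leb_diag R n (const_mx 1%R) v A.
rewrite big1 ?mul1e => [<-//|i _]; last by rewrite mxE normr1 invr1.
  congr (leb n _); apply/seteqP; split=> x /=.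
    by congr A; apply/rowP => i; rewrite !mxE mul1r addrC.
  by congr A; apply/rowP => i; rewrite !mxE mul1r addrC.
by move=> i; rewrite mxE oner_neq0.
Qed.

(** The usual uniqueness argument for Haar measure, carried out on a piece of space.
    Count the pairs of [v] in [K] and [x] in [A - v] for [leb \x mu]: integrating
    first in [x] gives [leb K * mu A]. With [w = x + v] in place of [v], they become
    the pairs of [w] in [A] and [x] in [w - K], and integrating first in [x] gives
    [kappa * leb A]. Invariance of [mu] is only used for translates that stay inside
    the region where it is known. *)
Lemma local_haar n (mu : {sigma_finite_measure set 'rV[R]_n -> \bar R})
    (D K : set 'rV[R]_n) (kappa : \bar R) (A : set 'rV[R]_n) :
  measurable K -> measurable A -> A `<=` D ->
  (forall v, K v -> mu ((fun x => x + v)%R @^-1` A) = mu A) ->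
  (forall a, D a -> mu ((fun x => a - x)%R @^-1` K) = kappa) ->
  leb n K * mu A = kappa * leb n A.
Proof.
move=> mK mA AD muA muK.
have m1 : measurable_fun setT (@fst 'rV[R]_n 'rV[R]_n) by [].
have m2 : measurable_fun setT (@snd 'rV[R]_n 'rV[R]_n) by [].
have m1D2 : measurable_fun setT (fun p : 'rV[R]_n * 'rV[R]_n => p.2 + p.1)%R.
  exact: measurable_rV_add.
have m1B2 : measurable_fun setT (fun p : 'rV[R]_n * 'rV[R]_n => p.1 - p.2)%R.
  apply: measurable_rVP => i; under eq_fun do rewrite !mxE.
  by apply: measurable_funB; apply: (measurableT_comp (measurable_coord i)).
pose E1 := (@fst 'rV[R]_n 'rV[R]_n) @^-1` K `&`
  (fun p : 'rV[R]_n * 'rV[R]_n => p.2 + p.1)%R @^-1` A.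
pose E2 := (@fst 'rV[R]_n 'rV[R]_n) @^-1` A `&`
  (fun p : 'rV[R]_n * 'rV[R]_n => p.1 - p.2)%R @^-1` K.
have mE1 : measurable E1 by apply: measurableI; exact: measurable_preim.
have mE2 : measurable E2 by apply: measurableI; exact: measurable_preim.
transitivity (\int[leb n]_v mu [set x | E1 (v, x)]).
  rewrite muleC -(integral_cst (leb n) mK) integral_mkcond; apply: eq_integral => v _.
  rewrite patchE; case: ifPn => [/set_mem|/negP] Kv.
    rewrite -(muA v)//; congr (mu _); apply/seteqP; split=> x //=.
    by rewrite /E1/=; case.
  rewrite (_ : [set x | _] = set0) ?measure0//.
  by apply/seteqP; split => x //; rewrite /E1/= => -[Kv' _]; apply/Kv/mem_set.
rewrite product_measure_swap//.
transitivity (\int[mu]_x leb n [set w | E2 (w, x)]).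
  apply: eq_integral => x _.
  have mEx : measurable [set w | E2 (w, x)].
    have := @measurable_ysection _ _ _ _ E2 x mE2; congr measurable.
    by apply/seteqP; split=> y; rewrite /ysection/= inE.
  rewrite -(leb_translate x)//; congr (leb n _).
  apply/seteqP; split=> v /=; rewrite /E1 /E2/= addrAC subrr add0r; tauto.
rewrite -product_measure_swap// -(integral_cst (leb n) mA) [RHS]integral_mkcond.
apply: eq_integral => w _; rewrite patchE; case: ifPn => [/set_mem|/negP] Aw.
  rewrite -(muK w); last exact: AD.
  congr (mu _); apply/seteqP; split=> x //=.
  by rewrite /E2/=; case.
rewrite (_ : [set x | _] = set0) ?measure0//.
by apply/seteqP; split => x //; rewrite /E2/= => -[Aw' _]; apply/Aw/mem_set.
Qed.

End haar.

(** Exchanging coordinate 0 with coordinate [i] reduces statements on coordinate [i] to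
    coordinate 0, the one that is split off by [rV_cons]. *)
Definition rV_swap (R : realType) (n : nat) (i : 'I_n.+1) (x : 'rV[R]_n.+1) :
  'rV[R]_n.+1 := \row_j x ord0 (tperm ord0 i j).

Section swap.
Context {R : realType} {n : nat} (i : 'I_n.+1).
Local Notation T := (@rV_swap R n i).

Lemma rV_swapK : involutive T.
Proof. by move=> x; apply/rowP => j; rewrite !mxE tpermK. Qed.

Lemma rV_swapD x y : T (x + y) = T x + T y.
Proof. by apply/rowP => j; rewrite !mxE. Qed.

Lemma rV_swapZ a x : T (a *: x) = a *: T x.
Proof. by apply/rowP => j; rewrite !mxE. Qed.

Lemma rV_swapN x : T (- x) = - T x.
Proof. by rewrite -scaleN1r rV_swapZ scaleN1r. Qed.

Lemma l1norm_swap x : l1norm (T x) = l1norm x.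
Proof.
rewrite [RHS](reindex_inj (@perm_inj _ (tperm ord0 i))).
by apply: eq_bigr => j _; rewrite mxE.
Qed.

Lemma measurable_rV_swap : measurable_fun setT T.
Proof.
apply: measurable_rVP => j; under eq_fun do rewrite mxE.
exact: measurable_coord.
Qed.

End swap.

Section leb_swap.
Context {R : realType}.
Local Open Scope ereal_scope.

(** The ball contains a box. *)
Lemma leb_l1ball_gt0 n : 0 < leb n (@l1ball R n).
Proof.
have k0 : (0 <= n.+1%:R^-1 :> R)%R by rewrite invr_ge0.
apply: (@lt_le_trans _ _ (leb n (rV_box n 0%R (n.+1%:R^-1)%R))).
  by rewrite leb_box// subr0 lte_fin exprn_gt0// invr_gt0.
apply: le_measure; rewrite ?inE; [exact: measurable_rV_box|exact: measurable_l1ball|].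
rewrite l1ballE => x xb /=; apply: (@le_lt_trans _ _ (\sum_(i < n) n.+1%:R^-1)%R).
  by apply: ler_sum => i _; have /andP[x0 x1] := xb i; rewrite gtr0_norm// ltW.
by rewrite sumr_const card_ord -[ltLHS]mulr_natl ltr_pdivrMr// mul1r ltr_nat.
Qed.

(** The ball is contained in a box. *)
Lemma leb_l1ball_lty n : leb n (@l1ball R n) < +oo.
Proof.
apply: (@le_lt_trans _ _ (leb n (rV_box n (-1)%R 1%R))).
  apply: le_measure; rewrite ?inE; [exact: measurable_l1ball|exact: measurable_rV_box|].
  rewrite l1ballE => x /= xb i; rewrite -ltr_norml.
  exact: le_lt_trans (ler_coord_l1norm x i) xb.
by rewrite leb_box ?ltry//; lra.
Qed.

Lemma sigma_finite_push d1 d2 (X : measurableType d1) (Y : measurableType d2)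
    (mu : {sigma_finite_measure set X -> \bar R}) (phi : X -> Y) (psi : Y -> X) :
  measurable_fun setT phi -> measurable_fun setT psi -> cancel phi psi ->
  exists nu : {sigma_finite_measure set Y -> \bar R},
    forall A, nu A = mu (phi @^-1` A).
Proof.
move=> mphi mpsi phiK; pose nu := push_measure mu mphi.
have snu : sigma_finite setT nu.
  have [F FT Foo] := sigma_finiteT mu.
  exists (fun k => psi @^-1` F k).
    by rewrite -preimage_bigcup -FT preimage_setT.
  move=> k; have [mF Fk] := Foo k; split; first exact: measurable_preim.
  change (mu (phi @^-1` (psi @^-1` F k)) < +oo); rewrite -comp_preimage.
  by have -> : psi \o phi = id by apply/funext => x /=; rewrite phiK.
pose nu' : {sigma_finite_measure set Y -> \bar R} :=
  HB.pack (nu : set Y -> \bar R) (Measure.class nu)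
   (Measure_isSigmaFinite.Build _ _ _ (nu : set Y -> \bar R) snu).
by exists nu'.
Qed.

Lemma mule_pcancel (a x y : \bar R) : 0 < a -> a < +oo -> a * x = a * y -> x = y.
Proof.
case: a => [r||]//; rewrite lte_fin => r0 _ /(congr1 (mule (r^-1)%:E)).
by rewrite !muleA -EFinM mulVf ?gt_eqF// !mul1e.
Qed.

Lemma leb_opp n (v : 'rV[R]_n) (A : set 'rV[R]_n) : measurable A ->
  leb n ((fun x => v - x)%R @^-1` A) = leb n A.
Proof.
move=> mA; have := @leb_diag R n (const_mx (-1)%R) v A.
rewrite big1 ?mul1e => [<-//|i _]; last by rewrite mxE normrN1 invr1.
  congr (leb n _); apply/seteqP; split=> x /=;
    by congr A; apply/rowP => i; rewrite !mxE mulN1r addrC.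
by move=> i; rewrite mxE oppr_eq0 oner_neq0.
Qed.

(** Lebesgue measure is defined by splitting off coordinate 0 first, so this symmetry is
    not visible in the definition. The pushforward is translation invariant, hence a
    multiple of Lebesgue measure by [local_haar], and the factor is 1 because the l1
    ball is symmetric in the coordinates. *)
Lemma leb_swap n (i : 'I_n.+1) (A : set 'rV[R]_n.+1) : measurable A ->
  leb n.+1 (rV_swap i @^-1` A) = leb n.+1 A.
Proof.
move=> mA.
have mT := @measurable_rV_swap R n i.
have [mu muE] := sigma_finite_push (leb n.+1) mT mT (@rV_swapK R n i).
have BT x : @l1ball R n.+1 (rV_swap i x) = @l1ball R n.+1 x.
  by rewrite l1ballE /= l1norm_swap.
have := leb_l1ball_gt0 n.+1; have := leb_l1ball_lty n.+1.
have := @measurable_l1ball R n.+1.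
move: (@l1ball R n.+1) BT => B BT mB Boo B0.
apply: (mule_pcancel B0 Boo).
rewrite -(muE A); apply: (local_haar (D := setT) mB mA (@subsetT _ A)).
- move=> v _.
  rewrite (muE (_ @^-1` A)) (muE A) -[RHS](leb_translate (rV_swap i v)); last exact: measurable_preim mA.
  congr (leb _ _); apply/seteqP; split=> x /=; by rewrite rV_swapD rV_swapK addrC.
- move=> a _; rewrite (muE (_ @^-1` B)) -[RHS](leb_opp (rV_swap i a) mB).
  congr (leb _ _); apply/seteqP; split=> x /=;
    by rewrite -BT rV_swapD rV_swapN rV_swapK.
Qed.

End leb_swap.

(** * Isometry invariance of the law on the sphere *)

Section hausdorff.
Context {R : realType} {d : nat}.
Local Open Scope ereal_scope.
Implicit Types (A E : set 'rV[R]_d) (T : 'rV[R]_d -> 'rV[R]_d).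

(** Isometries for the Euclidean norm, the one that measures diameters in
    [hausdorff]. *)
Definition isometry T :=
  forall x y, lqnorm 2%:E (T x - T y) = lqnorm 2%:E (x - y).

Lemma diam_image T E : isometry T -> diam (T @` E) = diam E.
Proof.
move=> Tiso; rewrite /diam; congr (maxe 0 (ereal_sup _)).
apply/seteqP; split=> z.
  by move=> [_ [x Ex <-] [_ [y Ey <-] <-]]; exists x; [exact: Ex|exists y; [exact: Ey|rewrite Tiso]].
move=> [x Ex [y Ey <-]]; exists (T x); first by exists x.
by exists (T y); [exists y; [exact: Ey|]|rewrite Tiso].
Qed.

(** The image of a cover is a cover of the image, with the same diameters. *)
Lemma hausdorff_image_le T s A : isometry T -> hausdorff s (T @` A) <= hausdorff s A.
Proof.
move=> Tiso; apply: ge_ereal_sup => _ [delta delta0 <-].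
apply: (@le_trans _ _ (hausdorff_content s delta A)); last first.
  by apply: ereal_sup_ubound; exists delta.
apply: le_ereal_inf_tmp => _ [E [AE Edelta] <-].
apply: ereal_inf_lbound; exists (fun k => T @` E k) => /=.
  split; first by rewrite -image_bigcup; exact: image_subset.
  by move=> k; rewrite diam_image.
by apply: eq_eseriesr => k _; rewrite diam_image.
Qed.

Lemma hausdorff_preimage T T' s A : isometry T -> cancel T T' -> cancel T' T ->
  hausdorff s (T @^-1` A) = hausdorff s A.
Proof.
move=> Tiso TK T'K; have T'iso : isometry T' by move=> x y; rewrite -Tiso !T'K.
apply/eqP; rewrite eq_le; apply/andP; split.
  have -> : T @^-1` A = T' @` A.
    apply/seteqP; split=> x /=; first by exists (T x).
    by move=> [y Ay <-]; rewrite T'K.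
  exact: hausdorff_image_le.
have {1}-> : A = T @` (T @^-1` A).
  apply/seteqP; split=> x /=; first by exists (T' x); rewrite ?T'K.
  by move=> [y Ay <-].
exact: hausdorff_image_le.
Qed.

Lemma isometry_diag (a v : 'rV[R]_d) :
  (forall i, `|a ord0 i| = 1)%R -> isometry (rV_diag a v).
Proof.
move=> a1 x y; rewrite /lqnorm; congr (_ `^ _)%R; apply: eq_bigr => i _.
by rewrite !mxE opprD addrACA subrr addr0 -mulrBr normrM a1 mul1r.
Qed.

Lemma rV_diagK (a v : 'rV[R]_d) : (forall i, `|a ord0 i| = 1)%R ->
  cancel (rV_diag a v) (rV_diag a (- rV_diag a 0 v)).
Proof.
move=> a1 x; apply/rowP => i; rewrite !mxE addr0 mulrDr addrK mulrA.
by rewrite -expr2 -real_normK ?num_real// a1 expr1n mul1r.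
Qed.

Lemma rV_diagVK (a v : 'rV[R]_d) : (forall i, `|a ord0 i| = 1)%R ->
  cancel (rV_diag a (- rV_diag a 0 v)) (rV_diag a v).
Proof.
move=> a1 x; apply/rowP => i; rewrite !mxE addr0 mulrBr !mulrA.
by rewrite -expr2 -real_normK ?num_real// a1 expr1n !mul1r subrK.
Qed.

End hausdorff.

#[global] Opaque hausdorff.

Lemma isometry_swap (R : realType) n (i : 'I_n.+1) : isometry (@rV_swap R n i).
Proof.
move=> x y; rewrite -rV_swapN -rV_swapD /lqnorm; congr (_ `^ _)%R.
rewrite [RHS](reindex_inj (@perm_inj _ (tperm ord0 i))).
by apply: eq_bigr => j _; rewrite mxE.
Qed.

Lemma uniform_law_congr (R : realType) d (mu : set 'rV[R]_d -> \bar R)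
    (S A B : set 'rV[R]_d) :
  mu (A `&` S) = mu (B `&` S) -> uniform_law mu S A = uniform_law mu S B.
Proof. by rewrite /uniform_law => ->. Qed.

Section uniform_sphere.
Context {R : realType} {n : nat} {disp : measure_display}
  {Omega : measurableType disp} {P : probability Omega R}
  {zeta : {RV P >-> 'rV[R]_n.+1}}.
Hypothesis zeta_unif : forall A : set 'rV[R]_n.+1, measurable A ->
  distribution P zeta A = uniform_law (@surface_measure R n.+1) (@l1sphere R n.+1) A.
Local Notation nu := (distribution P zeta).
Local Notation S := (@l1sphere R n.+1).
Local Open Scope ereal_scope.

(** Only the part of the sphere that carries [A] and [B] has to be preserved by [T]. The
    normalising denominator, whatever its value, is the same on both sides. *)
Lemma sphere_law_isometry T T' (A B : set 'rV[R]_n.+1) :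
  isometry T -> cancel T T' -> cancel T' T -> measurable A -> measurable B ->
  A `&` S = T @^-1` (B `&` S) -> nu A = nu B.
Proof.
move=> Tiso TK T'K mA mB AB; rewrite (zeta_unif mA) (zeta_unif mB).
apply: uniform_law_congr; rewrite AB.
exact: (hausdorff_preimage n (B `&` S) Tiso TK T'K).
Qed.

Lemma sphere_law_diag (a v : 'rV[R]_n.+1) (A B : set 'rV[R]_n.+1) :
  (forall i, `|a ord0 i| = 1)%R -> measurable A -> measurable B ->
  A `&` S = rV_diag a v @^-1` (B `&` S) -> nu A = nu B.
Proof.
move=> a1; apply: sphere_law_isometry; first exact: isometry_diag.
- exact: rV_diagK.
- exact: rV_diagVK.
Qed.

Lemma sphere_law_setIS (A : set 'rV[R]_n.+1) : measurable A -> nu (A `&` S) = nu A.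
Proof.
move=> mA; have mS := @measurable_l1sphere R n.+1.
rewrite (zeta_unif mA) zeta_unif; last exact: measurableI.
by rewrite /uniform_law -setIA setIid.
Qed.

(** Where coordinate [j] vanishes and |x_k| is at least [t], moving [t] units of mass from
    coordinate [k] to coordinate [j] does not change the l1 norm: a translation that
    keeps this piece of the sphere inside the sphere. *)
Lemma sphere_coord_translate (j k : 'I_n.+1) (a t : R) (x : 'rV[R]_n.+1) :
  j != k -> (0 <= t)%R -> x ord0 j = 0%R -> (`|a| = 1)%R -> (t <= a * x ord0 k)%R ->
  l1norm (rV_diag (const_mx 1%R)
    (\row_i (if i == j then t else if i == k then - (a * t) else 0))%R x) = l1norm x.
Proof.
move=> jk t0 xj a1 tx; rewrite /l1norm (bigD1 j)//= (bigD1 k) 1?eq_sym//=.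
rewrite [RHS](bigD1 j)//= [in RHS](bigD1 k) 1?eq_sym//= !mxE !eqxx xj.
rewrite [k == j]eq_sym (negbTE jk) mulr0 add0r normr0 add0r !mul1r.
rewrite addrA; congr (_ + _)%R; last first.
  apply: eq_bigr => i /andP[ij ik].
  by rewrite !mxE (negbTE ij) (negbTE ik) mul1r addr0.
rewrite (ger0_norm t0).
have aa : (a * a = 1)%R by rewrite -expr2 -real_normK ?num_real// a1 expr1n.
have -> : (x ord0 k - a * t = a * (a * x ord0 k - t))%R by rewrite mulrBr mulrA aa mul1r.
have -> : (`|x ord0 k| = `|a * x ord0 k|)%R by rewrite normrM a1 mul1r.
by rewrite normrM a1 mul1r !ger0_norm; lra.
Qed.

End uniform_sphere.

(** * Coordinate hyperplanes *)

Section sphere_null.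
Context {R : realType} {n : nat} {disp : measure_display}
  {Omega : measurableType disp} {P : probability Omega R}
  {zeta : {RV P >-> 'rV[R]_n.+1}}.
Hypothesis zeta_unif : forall A : set 'rV[R]_n.+1, measurable A ->
  distribution P zeta A = uniform_law (@surface_measure R n.+1) (@l1sphere R n.+1) A.
Local Notation nu := (distribution P zeta).
Local Notation S := (@l1sphere R n.+1).
Local Open Scope ereal_scope.

(** Otherwise finitely many of these events would have total probability above 1. *)
Lemma probability_disjoint_copies d (T : measurableType d) (Q : probability T R)
    (F : nat -> set T) (a : \bar R) :
  (forall r, measurable (F r)) -> trivIset setT F -> (forall r, Q (F r) = a) -> a = 0.
Proof.
move=> mF tF Fa.
have a0 : 0 <= a by rewrite -(Fa 0%N).
have afin : a \is a fin_num by rewrite -(Fa 0%N) fin_num_measure.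
case: a a0 afin Fa => // r; rewrite lee_fin => r0 _ Fa.
have na k : (k%:R * r <= 1)%R.
  rewrite -lee_fin; have <- : Q (\big[setU/set0]_(i < k) F i) = (k%:R * r)%:E.
    rewrite measure_bigsetU// (eq_bigr (fun=> r%:E)) => [|i _]; last exact: Fa.
    by rewrite sumEFin sumr_const card_ord mulr_natl.
  by apply: probability_le1; exact: bigsetU_measurable.
congr (_%:E); apply/eqP; rewrite eq_le r0 andbT leNgt; apply/negP => r_gt0.
have := na (Num.truncn (r^-1)).+1; rewrite leNgt => /negP; apply.
by rewrite -ltr_pdivrMr// mul1r truncnS_gt.
Qed.

Lemma measurable_coord_eq (j : 'I_n.+1) (c : R) : measurable [set x : 'rV[R]_n.+1 | x ord0 j = c].
Proof.
exact: (@measurable_preim _ _ _ _ (fun x : 'rV[R]_n.+1 => x ord0 j) [set c] (measurable_coord j)).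
Qed.

Lemma measurable_coord_gt (k : 'I_n.+1) (a e : R) : measurable [set x : 'rV[R]_n.+1 | e < a * x ord0 k]%R.
Proof.
have -> : [set x : 'rV[R]_n.+1 | e < a * x ord0 k]%R =
   (fun x => a * x ord0 k)%R @^-1` `]e, +oo[%classic.
  by apply/seteqP; split => x; rewrite /= in_itv/= andbT.
apply: measurable_preim => //; apply: measurable_funM => //; exact: measurable_coord.
Qed.

(** Translating this piece by [e / r.+1], from coordinate [k] to coordinate [j], gives for
    each [r] an isometric copy in the slice where coordinate [j] equals [e / r.+1];
    these slices are disjoint. *)
Lemma sphere_hyperplane_piece (j k : 'I_n.+1) (a e : R) :
  j != k -> (`|a| = 1)%R -> (0 < e)%R ->
  nu ([set x | x ord0 j = 0%R] `&` [set x | (e < a * x ord0 k)%R]) = 0.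
Proof.
move=> jk a1 e0.
have aa : (a * a = 1)%R by rewrite -expr2 -real_normK ?num_real// a1 expr1n.
pose t (r : nat) : R := (e / r.+1%:R)%R.
have t0 r : (0 <= t r)%R by rewrite divr_ge0// ltW.
have te r : (t r <= e)%R by rewrite ler_pdivrMr// ler_peMr ?ler1n// ltW.
pose F r := [set x : 'rV[R]_n.+1 | x ord0 j = t r] `&`
  [set x : 'rV[R]_n.+1 | (e - t r < a * x ord0 k)%R].
have mF r : measurable (F r).
  by apply: measurableI; [exact: measurable_coord_eq|exact: measurable_coord_gt].
apply: (@probability_disjoint_copies _ _ nu F) => //.
  apply/trivIsetP => r s _ _ rs; apply/seteqP; split => // x [[/= xr _] [/= xs _]].
  move: rs; apply/negP; rewrite negbK; move: xs; rewrite xr /t => /(mulfI _).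
  rewrite gt_eqF// => /(_ isT) /invr_inj /eqP; rewrite eqr_nat => /eqP[->].
  by rewrite eqxx.
move=> r; symmetry.
pose v : 'rV[R]_n.+1 := (\row_i (if i == j then t r else if i == k then - (a * t r) else 0))%R.
apply: (sphere_law_diag zeta_unif (a := const_mx 1%R) (v := v)).
- by move=> i; rewrite mxE normr1.
- by apply: measurableI; [exact: measurable_coord_eq|exact: measurable_coord_gt].
- exact: mF.
rewrite l1sphereE; apply/seteqP; split => x /=.
  move=> [[xj xk] xS]; have := @sphere_coord_translate R n j k a (t r) x jk (t0 r) xj a1.
  move=> ->; last by apply: le_trans (te r) _; exact: ltW.
  split=> //; split => /=; rewrite !mxE mul1r eqxx.
    by rewrite xj add0r.
  by rewrite [k == j]eq_sym (negbTE jk) mulrDr mulrN mulrA aa mul1r; lra.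
rewrite /F /= !mxE !mul1r eqxx [k == j]eq_sym (negbTE jk) eqxx mulrDr mulrN mulrA aa mul1r.
move=> [[xj xk] xS]; have xj0 : x ord0 j = 0%R by lra.
split; first by split => //; lra.
rewrite -xS; symmetry; apply: sphere_coord_translate => //; have := te r; lra.
Qed.

(** A point of the sphere has a nonzero coordinate, so the hyperplane is covered on the
    sphere by countably many sets of [sphere_hyperplane_piece], indexed by that
    coordinate, its sign and a lower bound [1 / p.+1] of its absolute value. *)
Lemma sphere_hyperplane_null (j : 'I_n.+1) : (0 < n)%N -> nu [set x | x ord0 j = 0%R] = 0.
Proof.
move=> n0; have mj := @measurable_coord_eq j 0%R.
pose N (m : nat) := if unpickle m is Some (k, b, p) then
   if j != k then [set x : 'rV[R]_n.+1 | x ord0 j = 0%R] `&`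
     [set x : 'rV[R]_n.+1 | (p.+1%:R^-1 < (-1) ^+ (b : bool) * x ord0 k)%R] else set0
   else set0.
have N0 m : nu.-negligible (N m).
  rewrite /N; case: unpickle => [[[k b] p]|]; last exact: negligible_set0.
  case: ifPn => jk; last exact: negligible_set0.
  apply/negligibleP; first by apply: measurableI => //; exact: measurable_coord_gt.
  apply: sphere_hyperplane_piece => //.
  by rewrite normrX normrN1 expr1n.
rewrite -(sphere_law_setIS zeta_unif mj); apply/negligibleP.
  by apply: measurableI => //; exact: measurable_l1sphere.
apply: negligibleS (negligible_bigcup N0).
rewrite l1sphereE => x /= [xj x1].
have /existsP[k xk] : [exists k, x ord0 k != 0%R].
  apply/negbNE/negP => /existsPn xk0; move: x1; rewrite /l1norm big1 => [/esym/eqP|i _].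
    by rewrite oner_eq0.
  by have /negPn/eqP-> := xk0 i; rewrite normr0.
have jk : j != k by apply: contraNneq xk => <-; rewrite xj.
pose b := (x ord0 k < 0)%R.
have xk0 : (0 < (-1) ^+ b * x ord0 k)%R.
  by rewrite -normr_gt0 in xk; rewrite -normrEsign.
have [p px] := ltr_add_invr xk0; rewrite add0r in px.
exists (pickle (k, b, p)) => //; rewrite /N pickleK jk; split => //.
Qed.

End sphere_null.

(** * Projection of an open half of the sphere *)

Section sphere_tail.
Context {R : realType} {n : nat} {disp : measure_display}
  {Omega : measurableType disp} {P : probability Omega R}
  {zeta : {RV P >-> 'rV[R]_n.+1}}.
Hypothesis zeta_unif : forall A : set 'rV[R]_n.+1, measurable A ->
  distribution P zeta A = uniform_law (@surface_measure R n.+1) (@l1sphere R n.+1) A.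
Local Notation nu := (distribution P zeta).
Local Notation S := (@l1sphere R n.+1).
Local Open Scope ereal_scope.

(** For [A] inside the ball, [upper A] meets the sphere in the graph of [1 - |u|] over
    [A], so the law of the sphere on these events is a measure on the ball in dimension
    [n]. *)
Definition upper (A : set 'rV[R]_n) : set 'rV[R]_n.+1 :=
  [set x : 'rV[R]_n.+1 | (0 < x ord0 ord0)%R /\ A (rV_tail x)].

Lemma measurable_halfspace : measurable [set x : 'rV[R]_n.+1 | (0 < x ord0 ord0)%R].
Proof.
have := @measurable_coord_gt R n ord0 1%R 0%R; congr measurable.
by apply/seteqP; split=> x /=; rewrite mul1r.
Qed.

Lemma measurable_upper A : measurable A -> measurable (upper A).
Proof.
move=> mA; apply: measurableI; first exact: measurable_halfspace.
exact: (measurable_preim measurable_rV_tail mA).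
Qed.

Lemma upper_measure : exists m : {sigma_finite_measure set 'rV[R]_n -> \bar R},
  forall A, m A = nu (upper A).
Proof.
pose m := push_measure (mrestr nu measurable_halfspace) (@measurable_rV_tail R n).
have mE A : m A = nu (upper A).
  rewrite /m/= /pushforward/= /mrestr; congr (nu _).
  by apply/seteqP; split=> x [].
have sm : sigma_finite setT m.
  exists (fun=> setT); first by apply/seteqP; split=> // x _; exists 0%N.
  move=> _; split=> //; rewrite mE; apply: (@le_lt_trans _ _ 1); last exact: ltry.
  by apply: probability_le1; exact: measurable_upper.
pose m' : {sigma_finite_measure set 'rV[R]_n -> \bar R} :=
  HB.pack (m : set _ -> \bar R) (Measure.class m)
   (Measure_isSigmaFinite.Build _ _ _ (m : set _ -> \bar R) sm).
by exists m'.
Qed.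

(** The points of the positive orthant that stay in the ball after adding [e]
    to every coordinate: [corner 0] is the projection of one facet of the sphere, and
    the other ones leave room for translations. *)
Definition corner (e : R) : set 'rV[R]_n :=
  [set u | (forall j, 0 <= u ord0 j)%R /\ (\sum_j u ord0 j < 1 - n%:R * e)%R].

Lemma measurable_corner e : measurable (corner e).
Proof.
have ms : measurable_fun setT (fun u : 'rV[R]_n => \sum_j u ord0 j)%R.
  by apply: measurable_sum => i; exact: measurable_coord.
have -> : corner e = (\bigcap_(j : 'I_n) ((fun x : 'rV[R]_n => x ord0 j) @^-1` `[0%R, +oo[))
   `&` (fun u : 'rV[R]_n => \sum_j u ord0 j)%R @^-1` `]-oo, (1 - n%:R * e)%R[.
  apply/seteqP; split => u /=.
    by move=> [u0 u1]; split; [move=> j _/=; rewrite in_itv/= u0|rewrite in_itv].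
  move=> [u0 u1]; split; last by move: u1; rewrite in_itv.
  by move=> j; have := u0 j I; rewrite /= in_itv/= andbT.
apply: measurableI; last exact: (measurable_preim ms).
apply: fin_bigcap_measurable => // j _; apply: measurable_preim => //.
exact: measurable_coord.
Qed.

Lemma l1norm_corner e u : corner e u -> l1norm u = (\sum_j u ord0 j)%R.
Proof. by move=> [u0 _]; apply: eq_bigr => j _; rewrite ger0_norm. Qed.

(** On the facet the l1 norm is the sum of the coordinates, so shifting [u] by [v] is
    compensated by shifting coordinate 0 by minus the sum of [v]: a translation along
    the facet. *)
Lemma upper_translate (A : set 'rV[R]_n) (v : 'rV[R]_n) : measurable A ->
  A `<=` corner 0 -> (fun x => x + v)%R @^-1` A `<=` corner 0 ->
  nu (upper ((fun x => x + v)%R @^-1` A)) = nu (upper A).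
Proof.
move=> mA AD AvD.
apply: (sphere_law_diag zeta_unif (a := const_mx 1%R)
  (v := rV_cons (- \sum_j v ord0 j)%R v)).
- by move=> i; rewrite mxE normr1.
- apply: measurable_upper; apply: measurable_preim => //; exact: measurable_rVD.
- exact: measurable_upper.
have T (s : R) (u : 'rV[R]_n) : rV_diag (const_mx 1%R) (rV_cons (- \sum_j v ord0 j)%R v) (rV_cons s u)
     = rV_cons (s - \sum_j v ord0 j)%R (u + v)%R.
  rewrite rV_diag_cons rV_cons0 rV_consK mxE mul1r; congr (rV_cons _ _).
  by apply/rowP => i; rewrite !mxE mul1r.
rewrite l1sphereE; apply/seteqP; split => x.
  rewrite -(rV_eta x); move: (x ord0 ord0) (rV_tail x) => s u.
  rewrite /upper /= rV_consK rV_cons0 T rV_consK rV_cons0 !l1norm_cons.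
  move=> [[s0 Auv] su]; have uc := AvD _ Auv; have uvc := AD _ Auv.
  move: su; rewrite (l1norm_corner uc) (l1norm_corner uvc) ger0_norm ?ltW// => su.
  have suv : (\sum_j (u + v)%R ord0 j = \sum_j u ord0 j + \sum_j v ord0 j)%R.
    by rewrite -big_split; apply: eq_bigr => j _; rewrite mxE.
  have s1 : (0 < s - \sum_j v ord0 j)%R.
    by case: uvc; rewrite suv => _; lra.
  by split => //; rewrite ger0_norm ?ltW//; lra.
rewrite -(rV_eta x); move: (x ord0 ord0) (rV_tail x) => s u.
rewrite /upper /= T rV_consK rV_cons0 !l1norm_cons rV_consK rV_cons0.
move=> [[s0 Auv] su]; have uc := AvD _ Auv; have uvc := AD _ Auv.
move: su; rewrite (l1norm_corner uc) (l1norm_corner uvc) ger0_norm ?ltW// => su.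
have suv : (\sum_j (u + v)%R ord0 j = \sum_j u ord0 j + \sum_j v ord0 j)%R.
  by rewrite -big_split; apply: eq_bigr => j _; rewrite mxE.
have s1 : (0 < s)%R by case: uc => _; lra.
by split => //; rewrite ger0_norm ?ltW//; lra.
Qed.

Lemma corner_sub (e e' : R) : (0 <= e <= e')%R -> corner e' `<=` corner e.
Proof.
move=> /andP[e0 ee'] u [u0 u1]; split=> //; apply: lt_le_trans u1 _.
by rewrite lerB// ler_wpM2l.
Qed.

Lemma corner0_ball : corner 0 `<=` @l1ball R n.
Proof.
move=> u uc; rewrite l1ballE /= (l1norm_corner uc); case: uc => _.
by rewrite mulr0 subr0.
Qed.

(** [local_haar] with [K] the box of side [e], whose translates from [corner e] stay in
    [corner 0]. *)
Lemma upper_box_shift (e : R) : (0 < e)%R ->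
  exists kappa : \bar R, forall B, measurable B -> B `<=` corner e ->
    (e ^+ n)%:E * nu (upper B) = kappa * leb n B.
Proof.
move=> e0; have [m mE] := upper_measure.
have ee0 : corner e `<=` corner 0 by apply: corner_sub; rewrite lexx ltW.
pose K := @rV_box R n (- e)%R 0%R.
have mK : measurable K by exact: measurable_rV_box.
have lebK : leb n K = (e ^+ n)%:E by rewrite leb_box ?oppr_le0 ?ltW// sub0r opprK.
have shift a v : corner e a -> K v -> corner 0 (a - v)%R.
  move=> [a0 a1] Kv; split.
    move=> j; rewrite !mxE; have := a0 j; have /andP[_ v0] := Kv j; lra.
  rewrite mulr0 subr0; apply: le_lt_trans (_ : (\sum_j (a ord0 j + e) < 1)%R).
    by apply: ler_sum => j _; rewrite !mxE; have /andP[ev _] := Kv j; lra.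
  by rewrite big_split /= sumr_const card_ord -mulr_natl; lra.
have [a0|/set0P[a1 a1e]] := eqVneq (corner e) set0.
  exists 0 => B mB Be; have -> : B = set0 by rewrite -subset0 -a0.
  by rewrite measure0 mule0 -mE measure0 mule0.
exists (m ((fun x => a1 - x)%R @^-1` K)) => B mB Be.
rewrite -lebK -mE; apply: (local_haar (D := corner e)) => //.
- move=> v Kv; rewrite !mE; apply: upper_translate => //.
    exact: subset_trans ee0.
  by move=> x /= /Be /shift -/(_ _ Kv); rewrite addrK.
- move=> a ae; rewrite !mE.
  have mKa b : measurable ((fun x => b - x)%R @^-1` K).
    have := measurable_preim (measurable_rV_diag (const_mx (-1)%R) b) mK.
    congr measurable; apply/seteqP; split => x /=;
      by congr K; apply/rowP => i; rewrite !mxE mulN1r addrC.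
  have sub b : corner e b -> (fun x => b - x)%R @^-1` K `<=` corner 0.
    by move=> be x /= /(shift _ _ be); rewrite opprB addrC subrK.
  have aE x : (a1 - (x + (a1 - a)) = a - x)%R.
    by apply/rowP => i; rewrite !mxE; ring.
  have -> : (fun x => a - x)%R @^-1` K =
     (fun x => x + (a1 - a))%R @^-1` ((fun x => a1 - x)%R @^-1` K).
    by apply/seteqP; split => x /=; rewrite aE.
  apply: upper_translate => //; first exact: sub.
  by move=> x /=; rewrite aE; exact: sub.
Qed.

(** The factor given by [upper_box_shift] for [e] is determined by any set of positive
    volume in [corner e]. Comparing on one fixed corner [corner e0] shows that it does
    not depend on [e] in the interval from 0 to [e0], and the corners increase to
    [corner 0] when [e] tends to 0. *)
Lemma upper_corner : exists2 c : R, (0 <= c)%R &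
  forall A, measurable A -> A `<=` corner 0 -> nu (upper A) = c%:E * leb n A.
Proof.
have [m mE] := upper_measure.
have mfin A : measurable A -> nu (upper A) \is a fin_num.
  by move=> mA; apply: fin_num_measure; exact: measurable_upper.
(* Small enough for the box of side [e0] to be contained in [corner e0]. *)
pose e0 : R := ((2 * n.+1%:R)^-1)%R.
have e0_gt0 : (0 < e0)%R by rewrite invr_gt0 mulr_gt0.
pose D0 := corner e0.
have mD0 : measurable D0 by exact: measurable_corner.
have lebfin A : measurable A -> A `<=` corner 0 -> leb n A < +oo.
  move=> mA AD; apply: le_lt_trans (leb_l1ball_lty n).
  apply: le_measure; rewrite ?inE//; first exact: measurable_l1ball.
  exact: subset_trans AD corner0_ball.
have D0_0 : D0 `<=` corner 0 by apply: corner_sub; rewrite lexx ltW.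
have lD0_gt0 : 0 < leb n D0.
  apply: (@lt_le_trans _ _ (leb n (rV_box n 0%R e0))).
    by rewrite leb_box ?ltW// subr0 lte_fin exprn_gt0.
  apply: le_measure; rewrite ?inE//; first exact: measurable_rV_box.
  move=> u ub; split; first by move=> j; have /andP[/ltW] := ub j.
  have -> : (1 - n%:R * e0 = n.+2%:R * e0)%R.
    have y0 : (0 <= n%:R :> R)%R by [].
    rewrite /e0 -!natr1; move: n%:R y0 => y y0; field; lra.
  apply: (@le_lt_trans _ _ (\sum_(j < n) e0)%R).
    by apply: ler_sum => j _; have /andP[_ /ltW] := ub j.
  by rewrite sumr_const card_ord -[ltLHS]mulr_natl ltr_pM2r// ltr_nat.
have lD0_lty := lebfin _ mD0 D0_0.
pose l0 := fine (leb n D0); pose N0 := fine (nu (upper D0)).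
have l0E : leb n D0 = l0%:E by rewrite fineK// ge0_fin_numE// ltW.
have N0E : nu (upper D0) = N0%:E by rewrite fineK// mfin.
have l0_gt0 : (0 < l0)%R by rewrite -lte_fin -l0E.
have N0_ge0 : (0 <= N0)%R by rewrite fine_ge0.
exists (N0 / l0)%R; first by rewrite divr_ge0// ltW.
move=> A mA AD.
have step e B : (0 < e <= e0)%R -> measurable B -> B `<=` corner e ->
    nu (upper B) = (N0 / l0)%:E * leb n B.
  move=> /andP[e_gt0 ee0] mB Be; have [kappa kE] := upper_box_shift e_gt0.
  have D0e : D0 `<=` corner e by apply: corner_sub; rewrite ltW.
  have en0 : (0 < e ^+ n)%R by rewrite exprn_gt0.
  have kappaE : kappa = (e ^+ n * (N0 / l0))%:E.
    apply: (@mule_pcancel _ l0%:E); rewrite ?ltry ?lte_fin//.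
    rewrite muleC -l0E -kE// N0E l0E -!EFinM; congr (_%:E); field; lra.
  apply: (@mule_pcancel _ (e ^+ n)%:E); rewrite ?ltry ?lte_fin//.
  by rewrite kE// kappaE muleA -EFinM.
pose e (k : nat) : R := (e0 / k.+1%:R)%R.
have e_gt0 k : (0 < e k)%R by rewrite divr_gt0.
have e_le k : (e k <= e0)%R by rewrite ler_pdivrMr// ler_peMr ?ler1n// ltW.
pose F k := A `&` corner (e k).
have mF k : measurable (F k) by apply: measurableI => //; exact: measurable_corner.
have FE : \bigcup_k F k = A.
  apply/seteqP; split => [u [k _ []]//|u Au].
  have [u0 u1] := AD _ Au; rewrite mulr0 subr0 in u1.
  pose g := (1 - \sum_j u ord0 j)%R; have g0 : (0 < g)%R by rewrite subr_gt0.
  (* [u] is at distance [g] from the slanted face, so it belongs to every corner with [n * e k < g]. *)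
  exists (Num.truncn (n%:R * e0 / g)) => //; split=> //; split=> //.
  have := truncnS_gt (n%:R * e0 / g)%R; set k := Num.truncn _.
  rewrite ltr_pdivrMr// => ngk.
  by rewrite ltrBrDl -ltrBrDr /e mulrA ltr_pdivrMr// (mulrC _ k.+1%:R).
have ndF : {homo F : i j / (i <= j)%N >-> (i <= j)%O}.
  move=> i j ij; apply/subsetPset; apply: setIS; apply: corner_sub.
  by rewrite ltW//= ler_pM2l// lef_pV2 ?posrE// ler_nat ltnS.
have cm : (m \o F) x @[x --> \oo] --> m A.
  by rewrite -FE; apply: nondecreasing_cvg_mu => //; rewrite FE.
have cl : (leb n \o F) x @[x --> \oo] --> leb n A.
  by rewrite -FE; apply: nondecreasing_cvg_mu => //; rewrite FE.
have /(cvgeZl (isT : (N0 / l0)%:E \is a fin_num)) cl' := cl.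
rewrite -mE; apply: (cvg_unique _ cm) => //.
apply: cvg_trans cl'; apply: near_eq_cvg; apply: nearW => k /=.
by rewrite mE (@step (e k))//; [rewrite e_gt0 e_le|apply: subIsetr].
Qed.

End sphere_tail.

Section orthants.
Context {R : realType} {n : nat}.

Definition neg_pattern (u : 'rV[R]_n) : {ffun 'I_n -> bool} := [ffun j => u ord0 j < 0].

Definition sign_row (s : {ffun 'I_n -> bool}) : 'rV[R]_n := \row_j (-1) ^+ s j.

Lemma sign_row1 s j : `|sign_row s ord0 j| = 1.
Proof. by rewrite mxE normrX normrN1 expr1n. Qed.

Definition orthant (s : {ffun 'I_n -> bool}) : set 'rV[R]_n :=
  [set u | neg_pattern u = s].

Lemma measurable_orthant s : measurable (orthant s).
Proof.
have -> : orthant s = \bigcap_(j : 'I_n) ((fun x : 'rV[R]_n => x ord0 j) @^-1`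
   (if s j then `]-oo, 0[%classic else `[0, +oo[%classic)).
  apply/seteqP; split => u.
    by move=> <- j _ /=; rewrite ffunE; case: ltP => u0; rewrite /= in_itv/= ?u0.
  move=> us; apply/ffunP => j; rewrite ffunE; have := us j I => /=.
  by case: (s j) => /=; rewrite in_itv/= ?andbT// leNgt => /negbTE.
apply: fin_bigcap_measurable => // j _; apply: measurable_preim.
  exact: measurable_coord.
by case: (s j).
Qed.

Lemma l1norm_sign_row s u : l1norm (rV_diag (sign_row s) 0 u) = l1norm u.
Proof.
apply: eq_bigr => j _; have := sign_row1 s j.
by rewrite !mxE addr0 normrM => ->; rewrite mul1r.
Qed.

End orthants.

Section sphere_upper_law.
Context {R : realType} {n : nat} {disp : measure_display}
  {Omega : measurableType disp} {P : probability Omega R}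
  {zeta : {RV P >-> 'rV[R]_n.+1}}.
Hypothesis zeta_unif : forall A : set 'rV[R]_n.+1, measurable A ->
  distribution P zeta A = uniform_law (@surface_measure R n.+1) (@l1sphere R n.+1) A.
Local Notation nu := (distribution P zeta).
Local Notation S := (@l1sphere R n.+1).
Local Open Scope ereal_scope.

Lemma upper_reflect (s : {ffun 'I_n -> bool}) (A : set 'rV[R]_n) : measurable A ->
  nu (upper (rV_diag (sign_row s) 0 @^-1` A)) = nu (upper A).
Proof.
move=> mA; have mJA : measurable (rV_diag (sign_row s) 0 @^-1` A).
  by apply: measurable_preim => //; exact: measurable_rV_diag.
apply: (sphere_law_diag zeta_unif (a := rV_cons 1%R (sign_row s)) (v := rV_cons 0%R 0)).
- move=> i; case: (unliftP ord0 i) => [j|] ->.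
    by rewrite rV_consS sign_row1.
  by rewrite rV_cons0 normr1.
- exact: measurable_upper.
- exact: measurable_upper.
rewrite l1sphereE; apply/seteqP; split => x;
  rewrite -(rV_eta x); move: (x ord0 ord0) (rV_tail x) => t u;
  rewrite /upper /= rV_diag_cons !rV_cons0 !rV_consK mul1r addr0;
  by rewrite !l1norm_cons l1norm_sign_row.
Qed.

(** Cut the ball into orthants. A reflection of the last [n] coordinates maps each of them
    into [corner 0] and preserves both the sphere and Lebesgue measure. *)
Lemma sphere_upper_law : exists2 c : R, (0 <= c)%R &
  forall A, measurable A -> nu (upper A) = c%:E * leb n (A `&` @l1ball R n).
Proof.
have [c c0 cE] := upper_corner zeta_unif; exists c => // A mA.
have mB : measurable (A `&` @l1ball R n).
  by apply: measurableI => //; exact: measurable_l1ball.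
have -> : nu (upper A) = nu (upper (A `&` @l1ball R n)).
  rewrite -(sphere_law_setIS zeta_unif (measurable_upper mA)).
  rewrite -[RHS](sphere_law_setIS zeta_unif (measurable_upper mB)).
  congr (nu _); rewrite l1sphereE l1ballE; apply/seteqP; split=> x /=; last first.
    by move=> [[x0 [Ax _]] x1].
  move=> [[x0 Ax] x1]; split=> //; split=> //; split=> //=.
  by rewrite -x1 l1norm_recl ltrDr normr_gt0 gt_eqF.
have BB : A `&` @l1ball R n `<=` @l1ball R n by move=> x [].
move: (A `&` @l1ball R n) mB BB => B mB BB.
have [m mE] := @upper_measure R n _ _ P zeta.
have part : B = \bigcup_(s in [set: {ffun 'I_n -> bool}]) (B `&` orthant s).
  apply/seteqP; split => [u Bu|u [s _ []]//]; exists (neg_pattern u) => //.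
have fT : finite_set [set: {ffun 'I_n -> bool}] by exact: finite_finset.
have tB : trivIset [set: {ffun 'I_n -> bool}] (fun s => B `&` orthant s).
  by move=> s t _ _ [u [[_ us] [_ ut]]]; rewrite -us -ut.
have mBs s : measurable (B `&` orthant s).
  by apply: measurableI => //; exact: measurable_orthant.
rewrite -mE part !measure_fin_bigcup// ge0_mule_fsumr//.
apply: eq_fsbigr => s _; transitivity (nu (upper (B `&` orthant s))).
  exact: mE.
rewrite -(upper_reflect s)//.
have mJ : measurable (rV_diag (sign_row s) 0 @^-1` (B `&` orthant s)).
  by apply: measurable_preim => //; exact: measurable_rV_diag.
rewrite cE//.
  rewrite leb_diag//; last by move=> j; rewrite -normr_gt0 sign_row1.
  by rewrite big1 ?mul1e// => j _; rewrite sign_row1 invr1.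
move=> u [Bu /ffunP us].
have u0 j : (0 <= u ord0 j)%R.
  by have := us j; rewrite ffunE !mxE addr0; case: (s j) => /=; rewrite ?expr0 ?expr1; lra.
split=> //; rewrite mulr0 subr0.
have := BB _ Bu; rewrite l1ballE /= l1norm_sign_row.
by rewrite /l1norm (eq_bigr (fun j => u ord0 j))// => j _; rewrite ger0_norm.
Qed.

End sphere_upper_law.

(** * Integrals of bounded functions and of Lipschitz functions *)

Section bounded_integrals.
Context {R : realType}.

Lemma bounded_integrable d (T : measurableType d) (mu : {measure set T -> \bar R})
    (D : set T) (g : T -> R) (M : R) :
  measurable D -> (mu D < +oo)%E -> measurable_fun D g ->
  (forall x, D x -> `|g x| <= M) -> mu.-integrable D (EFin \o g).
Proof.
move=> mD Doo mg gM; apply: measurable_bounded_integrable => //.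
exists M; split; first exact: num_real.
move=> y My x Dx; by apply: le_trans (ltW My); exact: gM.
Qed.

Lemma le_Rintegral_bound d (T : measurableType d) (mu : {measure set T -> \bar R})
    (D : set T) (g : T -> R) (M : R) :
  measurable D -> (mu D < +oo)%E -> measurable_fun D g ->
  (forall x, D x -> `|g x| <= M) ->
  `|\int[mu]_(x in D) g x| <= M * fine (mu D).
Proof.
move=> mD Doo mg gM; have ig := bounded_integrable mD Doo mg gM.
rewrite -Rintegral_cst//; apply: le_trans (le_normr_Rintegral mD ig) _.
apply: le_Rintegral => //; first exact: integrable_norm.
by apply: (@bounded_integrable _ _ _ _ _ `|M|).
Qed.

(** Change of variables when [W] maps [P] to a multiple of [m], where this is known for the
    subsets of [D] only. *)
Lemma law_Rintegral d1 d2 (T1 : measurableType d1) (T2 : measurableType d2)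
    (P : {measure set T1 -> \bar R}) (m : {measure set T2 -> \bar R})
    (W : T1 -> T2) (D : set T2) (k : R) (g : T2 -> R) (M : R) :
  measurable_fun setT W -> measurable D -> 0 <= k -> (m D < +oo)%E ->
  (forall A, measurable A -> A `<=` D -> P (W @^-1` A) = (k%:E * m A)%E) ->
  measurable_fun setT g -> (forall x, D x -> `|g x| <= M) ->
  \int[P]_(w in W @^-1` D) g (W w) = k * \int[m]_(x in D) g x.
Proof.
move=> mW mD k0 mDoo PW mg gM.
have mEg : measurable_fun setT (EFin \o g) by exact/measurable_EFinP.
have mWD : measurable (W @^-1` D) by exact: measurable_preim.
have PD : (P (W @^-1` D) < +oo)%E.
  by rewrite PW//; apply: lte_mul_pinfty => //; rewrite lee_fin.
have ig := bounded_integrable mD mDoo (measurable_funTS mg) gM.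
have iP : P.-integrable (W @^-1` D) ((EFin \o g) \o W).
  apply: (bounded_integrable (g := g \o W) mWD PD _ (M := M)).
    by apply: measurable_funTS; exact: measurableT_comp.
  by move=> w; exact: gM.
rewrite /Rintegral -(integral_pushforward mW mEg iP mD).
have -> : (\int[pushforward P W]_(x in D) (EFin \o g) x =
           \int[mscale (NngNum k0) m]_(x in D) (EFin \o g) x)%E.
  by apply: eq_measure_integral => A mA AD; exact: PW.
have mp : measurable_fun D (EFin \o g)^\+%E by exact/measurable_funepos/measurable_funTS.
have mn : measurable_fun D (EFin \o g)^\-%E by exact/measurable_funeneg/measurable_funTS.
rewrite [X in fine X = _]integralE ge0_integral_mscale// ge0_integral_mscale//.
rewrite [in RHS]integralE /=.
have ip := integrable_fin_num mD (integrable_funepos mD ig).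
have im := integrable_fin_num mD (integrable_funeneg mD ig).
by rewrite -muleBr ?fineM// ?fin_num_adde_defr// fin_numB ip im.
Qed.

End bounded_integrals.

Section one_dimensional.
Context {R : realType}.
Local Notation mu := (@lebesgue_measure R).

Lemma Rintegral_shift (g : R -> R) (a b t M : R) :
  measurable_fun setT g -> (forall x, a + t < x <= b + t -> `|g x| <= M) ->
  \int[mu]_(s in `]a, b]) g (s + t) = \int[mu]_(s in `]a + t, b + t]) g s.
Proof.
move=> mg gM.
have mW : measurable_fun setT (fun s : measurableTypeR R => s + t : measurableTypeR R).
  exact: measurable_funD.
have oo : (mu `](a + t)%R, (b + t)%R] < +oo)%E.
  by rewrite lebesgue_measure_itv/=; case: ifP => _; rewrite ?ltry.
have := @law_Rintegral R _ _ _ _ mu mu _ `]a + t, b + t] 1 g M mW _ ler01.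
rewrite mul1r => <- //.
- congr Rintegral; apply/seteqP; split => s /=; rewrite !in_itv/=; lra.
- move=> A mA _; rewrite mul1e.
  have := @lebesgue_measure_affine R 1 t A (oner_neq0 _) mA.
  rewrite normr1 invr1 mul1e; apply: etrans.
  by congr (mu _); apply/seteqP; split => s /=; rewrite mul1r.
Qed.

(** The integrand differs from its value at either end by at most [L * t]. *)
Lemma lipschitz_integral_step (g : R -> R) (L y t : R) : 0 <= L -> 0 <= t ->
  measurable_fun setT g -> (forall x z, `|g x - g z| <= L * `|x - z|) ->
  (`|\int[mu]_(s in `]y, (y + t)]) g s - t * g y| <= L * t ^+ 2) /\
  (`|\int[mu]_(s in `]y, (y + t)]) g s - t * g (y + t)| <= L * t ^+ 2).
Proof.
move=> L0 t0 mg gL.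
have len : mu `]y, (y + t)] = t%:E.
  rewrite lebesgue_measure_itv/= lte_fin; case: ltP => yt; last by congr (_%:E); lra.
  by rewrite -EFinB; congr (_%:E); ring.
have oo : (mu `]y, (y + t)%R] < +oo)%E by rewrite len ltry.
have main z : y <= z <= y + t ->
    `|\int[mu]_(s in `]y, (y + t)]) g s - t * g z| <= L * t ^+ 2.
  move=> zyt.
  have gz x : `]y, (y + t)]%classic x -> `|g x - g z| <= L * t.
    rewrite /= in_itv/= => xyt; apply: le_trans (gL _ _) _.
    by apply: ler_wpM2l => //; rewrite ler_distl; lra.
  have mgz : measurable_fun setT (fun x => g x - g z) by exact: measurable_funB.
  have -> : \int[mu]_(s in `]y, (y + t)]) g s - t * g z =
            \int[mu]_(s in `]y, (y + t)]) (g s - g z).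
    rewrite RintegralB//.
    - by rewrite Rintegral_cst// [X in g z * X](congr1 fine len)/= mulrC.
    - apply: (@bounded_integrable _ _ _ _ _ _ (L * t + `|g z|)) => //.
        exact: measurable_funTS.
      move=> x /gz gx; have := ler_normD (g x - g z) (g z); rewrite subrK; lra.
    - by apply: (@bounded_integrable _ _ _ _ _ _ `|g z|).
  have mD : measurable (`]y, (y + t)%R] : set (measurableTypeR R)) by [].
  have bnd := @le_Rintegral_bound R _ _ mu _ _ (L * t) mD oo (measurable_funTS mgz) gz.
  apply: le_trans bnd _.
  by rewrite [X in _ * X](congr1 fine len)/= -mulrA -expr2.
by split; apply: main; lra.
Qed.

Lemma lipschitz_bounded (g : R -> R) (L a b : R) : 0 <= L ->
  (forall x z, `|g x - g z| <= L * `|x - z|) ->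
  forall s, a <= s <= b -> `|g s| <= `|g a| + L * (b - a).
Proof.
move=> L0 gL s sab; have := ler_normD (g s - g a) (g a); rewrite subrK => h.
apply: le_trans h _; rewrite addrC lerD2l; apply: le_trans (gL _ _) _.
by apply: ler_wpM2l => //; rewrite ger0_norm; lra.
Qed.

Lemma lipschitz_itv_integrable (g : R -> R) (L a b : R) : 0 <= L ->
  measurable_fun setT g -> (forall x z, `|g x - g z| <= L * `|x - z|) ->
  mu.-integrable `]a, b] (EFin \o g).
Proof.
move=> L0 mg gL.
have oo : (mu `]a, b] < +oo)%E.
  by rewrite lebesgue_measure_itv/=; case: ifP => _; rewrite ?ltry.
apply: (@bounded_integrable _ _ _ _ _ _ (`|g a| + L * (b - a))) => //.
  exact: measurable_funTS.
move=> s; rewrite /= in_itv/= => /andP[sa sb].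
by apply: lipschitz_bounded => //; rewrite ltW.
Qed.

(** By additivity the two integrals over the interval and over its translate differ by two
    short integrals, near [b] and near [a]. This is the fundamental theorem of
    calculus with an explicit error, and it is the only differentiation under an
    integral sign that is needed. *)
Lemma lipschitz_shift_integral (g : R -> R) (L a b t : R) : a <= b -> 0 <= L ->
  measurable_fun setT g -> (forall x z, `|g x - g z| <= L * `|x - z|) ->
  `|\int[mu]_(s in `]a, b]) (g (s + t) - g s) - t * (g b - g a)| <= 2 * L * t ^+ 2.
Proof.
move=> ab L0 mg gL.
have ig x y := @lipschitz_itv_integrable g L x y L0 mg gL.
have gLt x z : `|g (x + t) - g (z + t)| <= L * `|x - z|.
  by apply: le_trans (gL _ _) _; rewrite opprD addrACA subrr addr0.
have mgt : measurable_fun setT (fun s : R => g (s + t)).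
  by apply: (measurableT_comp mg); exact: measurable_funD.
have igt := @lipschitz_itv_integrable (fun s => g (s + t)) L a b L0 mgt gLt.
have chasles x y z : x <= y -> y <= z ->
   \int[mu]_(s in `]x, z]) g s = \int[mu]_(s in `]x, y]) g s + \int[mu]_(s in `]y, z]) g s.
  move=> xy yz; rewrite -(@Rintegral_itvB _ g (BRight x) (BRight z) y)//.
  by rewrite addrC subrK.
rewrite RintegralB// (@Rintegral_shift _ _ _ _ (`|g (a + t)| + L * (b + t - (a + t))))//; last first.
  by move=> x xab; apply: lipschitz_bounded => //; have := xab; lra.
have [t0|t0] := leP 0 t.
- have [ha _] := lipschitz_integral_step a L0 t0 mg gL.
  have [hb _] := lipschitz_integral_step b L0 t0 mg gL.
  have c1 := chasles a b (b + t) ab ltac:(lra).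
  have c2 := chasles a (a + t) (b + t) ltac:(lra) ltac:(lra).
  move: ha hb; rewrite !ler_norml; lra.
- have u0 : 0 <= - t by lra.
  have [_] := lipschitz_integral_step (a + t) L0 u0 mg gL; rewrite addrK sqrrN => ha.
  have [_] := lipschitz_integral_step (b + t) L0 u0 mg gL; rewrite addrK sqrrN => hb.
  have c1 := chasles (a + t) a b ltac:(lra) ab.
  have c2 := chasles (a + t) (b + t) b ltac:(lra) ltac:(lra).
  move: ha hb; rewrite !ler_norml; lra.
Qed.

End one_dimensional.

(** * Slices of the ball *)

Section ball_fubini.
Context {R : realType} {n : nat}.
Local Notation mu := (@lebesgue_measure R).

Lemma leb_push (A : set 'rV[R]_n.+1) :
  leb n.+1 A = (mu \x leb n)%E ((fun p => rV_cons p.1 p.2) @^-1` A).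
Proof. by rewrite -!lebE. Qed.

(** The l1 ball is fibred by intervals of radius [1 - |u|] above the ball of one dimension
    less. *)
Definition ball_slice (g : 'rV[R]_n.+1 -> R) (u : 'rV[R]_n) : R :=
  \int[mu]_(s in `](- (1 - l1norm u)), (1 - l1norm u)[) g (rV_cons s u).

Lemma cons_ball (s : R) (u : 'rV[R]_n) :
  @l1ball R n.+1 (rV_cons s u) <-> s \in `](- (1 - l1norm u)), (1 - l1norm u)[.
Proof. by rewrite l1ballE /= l1norm_cons in_itv/= -ltr_norml ltrBrDr. Qed.

Lemma ball_Fubini (g : 'rV[R]_n.+1 -> R) (M : R) :
  measurable_fun setT g -> (forall x, l1ball x -> `|g x| <= M) ->
  (leb n).-integrable (@l1ball R n) (EFin \o ball_slice g) /\
  \int[leb n.+1]_(x in @l1ball R n.+1) g x =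
  \int[leb n]_(u in @l1ball R n) ball_slice g u.
Proof.
move=> mg gM.
pose W (p : measurableTypeR R * 'rV[R]_n) := rV_cons p.1 p.2.
have mW : measurable_fun setT W by exact: measurable_rV_cons.
pose E := W @^-1` @l1ball R n.+1.
have mB := @measurable_l1ball R n.+1; have mBn := @measurable_l1ball R n.
have mE : measurable E by exact: measurable_preim.
have Boo := @leb_l1ball_lty R n.+1.
pose pr := (mu \x leb n)%E : {measure set (measurableTypeR R * 'rV[R]_n) -> \bar R}.
have Eoo : (pr E < +oo)%E by have := Boo; rewrite leb_push.
have -> : \int[leb n.+1]_(x in @l1ball R n.+1) g x = \int[pr]_(p in E) g (W p).
  have lp A : measurable A -> A `<=` @l1ball R n.+1 ->
      pr (W @^-1` A) = (1%:E * leb n.+1 A)%E.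
    by move=> mA _; rewrite mul1e; exact: esym (leb_push A).
  have := @law_Rintegral R _ _ _ _ pr (leb n.+1) W _ 1 g M mW mB ler01 Boo lp mg gM.
  by rewrite mul1r => /esym.
have iE : pr.-integrable E (EFin \o (g \o W)).
  apply: (@bounded_integrable _ _ _ _ _ _ M) => //; last by move=> p; exact: gM.
  by apply: measurable_funTS; exact: measurableT_comp.
pose phi := (EFin \o (g \o W)) \_ E.
have iphi := iE; rewrite (integrable_mkcond (EFin \o (g \o W)) mE) -/phi in iphi.
pose G := fubini_G mu phi.
have GE u : G u = ((EFin \o ball_slice g) \_ (@l1ball R n)) u.
  have phiE s : phi (s, u) =
    ((fun s => (g (rV_cons s u))%:E) \_ `](- (1 - l1norm u)), (1 - l1norm u)[) s.
    rewrite /phi !patchE; congr (if _ then _ else _).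
    by apply/idP/idP; rewrite !inE /E /W /= => /cons_ball.
  rewrite /G /fubini_G (eq_integral _ _ (fun s _ => phiE s)) -integral_mkcond.
  rewrite patchE; case: ifPn => [/set_mem uB|/negP uB].
    rewrite /ball_slice /= fineK//; apply: integrable_fin_num => //.
    have oo : (mu `](- (1 - l1norm u))%R, (1 - l1norm u)%R[ < +oo)%E.
      by rewrite lebesgue_measure_itv/=; case: ifP => _; rewrite ?ltry.
    have mgc : measurable_fun setT (fun s : measurableTypeR R => g (rV_cons s u)).
      by apply: (measurableT_comp mg); exact: measurable_rV_cons.
    apply: (@bounded_integrable R _ _ mu _ (fun s => g (rV_cons s u)) M _ oo (measurable_funTS mgc)) => //.
    by move=> s /= /cons_ball; exact: gM.
  rewrite set_itv_ge ?integral_set0// -leNgt bnd_simp.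
  have : ~ l1norm u < 1 by move=> u1; apply: uB; rewrite inE l1ballE.
  by move/negP; rewrite -leNgt; lra.
have mG : measurable_fun setT G.
  exact: (@measurable_fubini_G _ _ _ _ _ mu (leb n) phi).
split.
  apply: (@bounded_integrable R _ _ (leb n) _ (ball_slice g) (`|M| * 2)) => //.
  - exact: leb_l1ball_lty.
  - apply/measurable_EFinP; apply: eq_measurable_fun (measurable_funTS mG).
    by move=> u uB; rewrite GE patchE uB.
  - move=> u uB.
    have oo : (mu `](- (1 - l1norm u))%R, (1 - l1norm u)%R[ < +oo)%E.
      by rewrite lebesgue_measure_itv/=; case: ifP => _; rewrite ?ltry.
    have mgc : measurable_fun setT (fun s : measurableTypeR R => g (rV_cons s u)).
      by apply: (measurableT_comp mg); exact: measurable_rV_cons.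
    have mI : measurable (`](- (1 - l1norm u)), (1 - l1norm u)[ : set (measurableTypeR R)) by [].
    have gMs s : `](- (1 - l1norm u)), (1 - l1norm u)[%classic s -> `|g (rV_cons s u)| <= `|M|.
      by move=> /= /cons_ball sB; apply: le_trans (gM _ sB) (ler_norm _).
    have bnd := @le_Rintegral_bound R _ _ mu _ _ `|M| mI oo (measurable_funTS mgc) gMs.
    apply: le_trans bnd _; apply: ler_wpM2l => //.
    have u1 := l1norm_ge0 u.
    rewrite [X in fine X](lebesgue_measure_itv `](- (1 - l1norm u))%R, (1 - l1norm u)%R[)/=.
    by case: ifP => _ /=; lra.
rewrite /Rintegral integral_mkcond -/phi; congr fine.
rewrite -(@integral21_prod_meas1 _ _ _ _ _ mu (leb n) phi)// -/G.
rewrite [RHS]integral_mkcond; apply: eq_integral => u _; exact: GE.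
Qed.

End ball_fubini.

Section full_event.
Context {R : realType} {disp : measure_display} {Omega : measurableType disp}.

(** Integrability only has to be checked on an event of probability one, where the bound
    on the integrand is available. *)
Lemma Rintegral_full (P : probability Omega R) (D : set Omega) (G : Omega -> R) (M : R) :
  measurable D -> P (~` D) = 0%E -> measurable_fun setT G ->
  (forall w, D w -> `|G w| <= M) ->
  P.-integrable setT (EFin \o G) /\ \int[P]_w G w = \int[P]_(w in D) G w.
Proof.
move=> mD PD mG GM; have mCD := measurableC mD.
have DE : setT `\` ~` D = D by rewrite setDE setCK setTI.
have Doo : (P D < +oo)%E by apply: le_lt_trans (probability_le1 P mD) (ltry 1).
have iD := bounded_integrable mD Doo (measurable_funTS mG) GM.
have mEG : measurable_fun setT (EFin \o G) by exact/measurable_EFinP.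
have iT : P.-integrable setT (EFin \o G).
  by apply/(negligible_integrable mCD measurableT mEG PD); rewrite DE.
by split => //; rewrite /Rintegral (negligible_integral mCD measurableT iT PD) DE.
Qed.

End full_event.

(** * Integration over the sphere and volume of the ball *)

Section sphere_integral.
Context {R : realType} {n : nat} {disp : measure_display}
  {Omega : measurableType disp} {P : probability Omega R}
  {zeta : {RV P >-> 'rV[R]_n.+1}}.
Hypothesis n_gt0 : (0 < n)%N.
Hypothesis zeta_unif : forall A : set 'rV[R]_n.+1, measurable A ->
  distribution P zeta A = uniform_law (@surface_measure R n.+1) (@l1sphere R n.+1) A.
Local Notation nu := (distribution P zeta).
Local Notation S := (@l1sphere R n.+1).

Definition ball_volume (k : nat) : R := fine (leb k (@l1ball R k)).

Lemma ball_volume_gt0 k : 0 < ball_volume k.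
Proof.
by rewrite /ball_volume fine_gt0// leb_l1ball_gt0 leb_l1ball_lty.
Qed.

Lemma ball_volumeE k : leb k (@l1ball R k) = (ball_volume k)%:E.
Proof. by rewrite fineK// ge0_fin_numE// leb_l1ball_lty. Qed.

(** A sign parameter treats both sides of the hyperplane at once; [a = 1] gives [upper]. *)
Definition side (a : R) (A : set 'rV[R]_n) : set 'rV[R]_n.+1 :=
  [set x : 'rV[R]_n.+1 | 0 < a * x ord0 ord0 /\ A (rV_tail x)].

Lemma measurable_side a A : measurable A -> measurable (side a A).
Proof.
move=> mA; apply: measurableI; first exact: measurable_coord_gt.
exact: (measurable_preim measurable_rV_tail mA).
Qed.

Lemma side_upper (a : R) (A : set 'rV[R]_n) : `|a| = 1 -> measurable A ->
  nu (side a A) = nu (upper A).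
Proof.
move=> a1 mA; apply: (sphere_law_diag zeta_unif (a := rV_cons a (const_mx 1)) (v := 0)).
- move=> i; case: (unliftP ord0 i) => [j|] ->; first by rewrite rV_consS mxE normr1.
  by rewrite rV_cons0.
- exact: measurable_side.
- exact: measurable_upper.
have T x : rV_diag (rV_cons a (const_mx 1)) 0 x = rV_cons (a * x ord0 ord0) (rV_tail x).
  rewrite -[in LHS](rV_eta x) rV_diag_cons rV_cons0 rV_consK mxE addr0; congr rV_cons.
  by apply/rowP => i; rewrite !mxE mul1r addr0.
rewrite l1sphereE; apply/seteqP; split => x; rewrite /side /upper /=;
  by rewrite T rV_cons0 rV_consK l1norm_cons normrM a1 mul1r -l1norm_recl.
Qed.

(** The factor in [sphere_upper_law] follows from total mass 1: the hyperplane is null and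
    the two sides have equal mass by reflection. *)
Lemma sphere_side_law (a : R) (A : set 'rV[R]_n) : `|a| = 1 -> measurable A ->
  nu (side a A) = (((2 * ball_volume n)^-1)%:E * leb n (A `&` @l1ball R n))%E.
Proof.
move=> a1 mA; rewrite side_upper//.
have [c c0 cE] := sphere_upper_law zeta_unif.
rewrite cE//; congr (_%:E * _)%E.
have v0 := ball_volume_gt0 n.
have m1 : nu (side 1 setT) = (c * ball_volume n)%:E.
  by rewrite side_upper ?normr1// cE// setTI ball_volumeE.
have m2 : nu (side (-1) setT) = (c * ball_volume n)%:E.
  by rewrite side_upper ?normrN1// cE// setTI ball_volumeE.
have ms b : measurable (side b setT) by exact: measurable_side.
have m0 := @measurable_coord_eq R n ord0 0.
have T : nu setT = ((c * ball_volume n) + (c * ball_volume n))%:E.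
  rewrite EFinD -{1}m1 -{1}m2 -measureU//; last first.
    by apply/seteqP; split=> // x [[/= x1 _] [/= x2 _]]; lra.
  rewrite -[RHS]adde0 -(sphere_hyperplane_null zeta_unif ord0 n_gt0) -measureU//.
  - congr (nu _); apply/seteqP; split=> // x _; rewrite /side /=.
    have [x0|x0|x0] := ltgtP 0 (x ord0 ord0); [left; left|left; right|right]; try split => //; lra.
  - exact: measurableU.
  - apply/seteqP; split=> // x [[[/= x1 _]|[/= x1 _]] /= x0]; lra.
move: T; rewrite probability_setT => -[]; rewrite -mulr2n -mulr_natl => cv.
have {}cv : c * (2 * ball_volume n) = 1 by lra.
by rewrite -[LHS](mulfK (_ : 2 * ball_volume n != 0)) ?cv ?mul1r//; lra.
Qed.

(** For [a = 1] and [a = -1], the two points of the sphere above [u]. *)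
Definition lift_sphere (a : R) (u : 'rV[R]_n) : 'rV[R]_n.+1 :=
  rV_cons (a * (1 - l1norm u)) u.

Lemma measurable_lift_sphere a : measurable_fun setT (lift_sphere a).
Proof.
apply: measurable_rV_cons => //; apply: measurable_funM => //.
by apply: measurable_funB => //; exact: measurable_l1norm.
Qed.

Lemma l1norm_lift (a : R) u : `|a| = 1 -> @l1ball R n u -> l1norm (lift_sphere a u) = 1.
Proof.
rewrite l1ballE /= => a1 u1; rewrite l1norm_cons normrM a1 mul1r ger0_norm; lra.
Qed.

Let mzeta : measurable_fun setT zeta.
Proof. by []. Qed.

(** The part of the sample space on which [zeta] is the lift with sign [a] of its own
    tail. *)
Definition sphere_event (a : R) : set Omega :=
  [set w | 0 < a * zeta w ord0 ord0 /\ S (zeta w)].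
Local Notation event := sphere_event.

Lemma measurable_sphere_event a : measurable (event a).
Proof.
apply: measurableI; first exact: (measurable_preim mzeta (measurable_coord_gt ord0 a 0)).
exact: (measurable_preim mzeta measurable_l1sphere).
Qed.

Lemma sphere_side_integral (a : R) (g : 'rV[R]_n.+1 -> R) (M : R) : `|a| = 1 ->
  measurable_fun setT g -> (forall x, S x -> `|g x| <= M) ->
  \int[P]_(w in event a) g (zeta w) =
  (2 * ball_volume n)^-1 * \int[leb n]_(u in @l1ball R n) g (lift_sphere a u).
Proof.
move=> a1 mg gM.
have aa : a * a = 1 by rewrite -expr2 -real_normK ?num_real// a1 expr1n.
pose b w := (0 < a * zeta w ord0 ord0) && (l1norm (zeta w) == 1).
(* The default value lies outside the ball, so that preimages under [W] of subsets of the ball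
   only see the event. *)
pose W w := if b w then rV_tail (zeta w) else const_mx 2.
have bE w : b w <-> event a w.
  rewrite /b /sphere_event l1sphereE /=; split => [/andP[-> /eqP]//|[-> ->]].
  by rewrite eqxx.
have mW : measurable_fun setT W.
  apply: measurable_fun_ifT => //; last exact: (measurableT_comp measurable_rV_tail).
  apply: measurable_and; last first.
    by apply: measurable_fun_eqr => //; exact: (measurableT_comp measurable_l1norm).
  apply: measurable_fun_ltr => //; apply: measurable_funM => //.
  exact: (measurableT_comp (measurable_coord ord0)).
have Wout : ~ @l1ball R n (const_mx 2).
  rewrite l1ballE /= /l1norm; apply/negP; rewrite -leNgt.
  rewrite (eq_bigr (fun=> 2)) => [|i _]; last by rewrite mxE ger0_norm.
  rewrite sumr_const card_ord -[leRHS]mulr_natl.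
  by have : (1 : R) <= n%:R; [rewrite ler1n|lra].
have WE A : A `<=` @l1ball R n -> W @^-1` A = zeta @^-1` (side a A `&` S).
  move=> AB; apply/seteqP; split => w /=; rewrite /W.
    case: ifPn => [/bE [bw Sw] Aw|_ /AB/Wout//]; split => //; split => //.
  by move=> [[aw Aw] Sw]; rewrite ifT//; apply/bE.
have WB : W @^-1` @l1ball R n = event a.
  rewrite WE; last exact: subset_refl.
  apply/seteqP; split => w; first by case=> -[h _] Sw; exact: conj h Sw.
  case=> h Sw; apply: (conj (conj h _) Sw); rewrite l1ballE /=.
  move: Sw; rewrite l1sphereE /= l1norm_recl => <-; rewrite ltrDr normr_gt0.
  by apply: contraTneq h => ->; rewrite mulr0 ltxx.
have mB := @measurable_l1ball R n.
have k0 : 0 <= (2 * ball_volume n)^-1 by rewrite invr_ge0 mulr_ge0// ltW// ball_volume_gt0.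
have PW A : measurable A -> A `<=` @l1ball R n ->
    P (W @^-1` A) = ((2 * ball_volume n)^-1%:E * leb n A)%E.
  move=> mA AB; rewrite WE//.
  have E := sphere_law_setIS zeta_unif (measurable_side a mA).
  apply: (etrans E); rewrite sphere_side_law//; congr (_ * leb n _)%E.
  exact: setIidl.
have mgl : measurable_fun setT (fun u => g (lift_sphere a u)).
  by apply: (measurableT_comp mg); exact: measurable_lift_sphere.
rewrite -(@law_Rintegral R _ _ _ _ P (leb n) W _ _ _ M mW mB k0 (leb_l1ball_lty n) PW mgl).
  rewrite WB; apply: eq_Rintegral => w; rewrite inE => ew; congr g.
  have [e1] := ew; rewrite l1sphereE /= l1norm_recl => e2.
  rewrite /lift_sphere /W ifT; last exact/bE.
  rewrite -[LHS]rV_eta; congr rV_cons; rewrite -e2 addrK.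
  have -> : `|zeta w ord0 ord0| = `|a * zeta w ord0 ord0| by rewrite normrM a1 mul1r.
  by rewrite ger0_norm ?ltW// mulrA aa mul1r.
by move=> u uB; apply: gM; rewrite l1sphereE /=; exact: l1norm_lift.
Qed.

Lemma sphere_integral (g : 'rV[R]_n.+1 -> R) (M : R) :
  measurable_fun setT g -> (forall x, S x -> `|g x| <= M) ->
  P.-integrable setT (EFin \o (g \o zeta)) /\
  \int[P]_w g (zeta w) = (2 * ball_volume n)^-1 *
    \int[leb n]_(u in @l1ball R n) (g (lift_sphere 1 u) + g (lift_sphere (-1) u)).
Proof.
move=> mg gM.
pose D := event 1 `|` event (-1).
have mE := measurable_sphere_event.
have mD : measurable D by exact: measurableU.
have mS := @measurable_l1sphere R n.+1.
have mN : measurable ([set x : 'rV[R]_n.+1 | x ord0 ord0 = 0] `|` ~` S).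
  by apply: measurableU; [exact: measurable_coord_eq|exact: measurableC].
have nuN : nu ([set x : 'rV[R]_n.+1 | x ord0 ord0 = 0] `|` ~` S) = 0%E.
  have mSC := measurableC mS; have mH := @measurable_coord_eq R n ord0 0.
  apply: null_set_setU => //; first exact: sphere_hyperplane_null.
  by apply: etrans (esym (sphere_law_setIS zeta_unif mSC)) _; rewrite setICl measure0.
have PD : P (~` D) = 0%E.
  apply/eqP; rewrite eq_le measure_ge0 andbT -nuN; apply: le_measure.
  - by rewrite inE; exact: measurableC.
  - by rewrite inE; exact: (measurable_preim mzeta).
  - move=> w wD; rewrite /=; have [Sw|] := pselect (S (zeta w)); [left|by right].
    by have [x0|x0|//] := ltgtP 0 (zeta w ord0 ord0); exfalso; apply: wD; [left|right];
      apply: (conj _ Sw); clear -x0; lra.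
have gD w : D w -> `|g (zeta w)| <= M by move=> [[_ Sw]|[_ Sw]]; exact: gM.
have mgz : measurable_fun setT (g \o zeta) by exact: measurableT_comp.
have [ig ->] := Rintegral_full mD PD mgz gD.
split => //; rewrite Rintegral_setU//; last 2 first.
- exact: integrableS ig.
- by apply/disj_setPS => w [[/= w1 _] [/= w2 _]]; clear -w1 w2; exfalso; lra.
rewrite (@sphere_side_integral 1 g M) ?normr1//.
rewrite (@sphere_side_integral (-1) g M) ?normrN1//.
have mB := @measurable_l1ball R n.
have il a : `|a| = 1 -> (leb n).-integrable (@l1ball R n) (EFin \o (fun u => g (lift_sphere a u))).
  move=> a1; apply: (@bounded_integrable _ _ _ _ _ _ M) => //.
  - exact: leb_l1ball_lty.
  - by apply: measurable_funTS; apply: (measurableT_comp mg); exact: measurable_lift_sphere.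
  - by move=> u uB; apply: gM; rewrite l1sphereE /=; exact: l1norm_lift.
by rewrite -mulrDr RintegralD// il// ?normr1 ?normrN1.
Qed.

End sphere_integral.

Section ball_law.
Context {R : realType} {d : nat} {disp : measure_display}
  {Omega : measurableType disp} {P : probability Omega R}
  {U : {RV P >-> 'rV[R]_d}}.
Hypothesis U_unif : forall A : set 'rV[R]_d, measurable A ->
  distribution P U A = uniform_law (@lebesgue_rV R d) (@l1ball R d) A.

Lemma ball_law (A : set 'rV[R]_d) : measurable A ->
  P (U @^-1` A) = (((ball_volume d)^-1)%:E * leb d (A `&` @l1ball R d))%E.
Proof.
move=> mA; apply: etrans (U_unif mA) _; rewrite /uniform_law !lebE ball_volumeE inver.
by rewrite gt_eqF ?ball_volume_gt0// muleC.
Qed.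

Lemma ball_law_integral (g : 'rV[R]_d -> R) (M : R) :
  measurable_fun setT g -> (forall x, @l1ball R d x -> `|g x| <= M) ->
  P.-integrable setT (EFin \o (g \o U)) /\
  \int[P]_w g (U w) = (ball_volume d)^-1 * \int[leb d]_(x in @l1ball R d) g x.
Proof.
move=> mg gM; have mU : measurable_fun setT U by [].
have mB := @measurable_l1ball R d.
have mD : measurable (U @^-1` @l1ball R d) by exact: measurable_preim.
have mgU : measurable_fun setT (g \o U) by exact: measurableT_comp.
have V0 := @ball_volume_gt0 R d.
have PD : P (~` (U @^-1` @l1ball R d)) = 0%E.
  have := ball_law (measurableC mB); rewrite setICl measure0 mule0; exact.
have gD w : (U @^-1` @l1ball R d) w -> `|(g \o U) w| <= M by exact: gM.
have [ig ->] := Rintegral_full mD PD mgU gD; split => //.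
have k0 : 0 <= (ball_volume d)^-1 :> R by rewrite invr_ge0 ltW.
have PU A : measurable A -> A `<=` @l1ball R d ->
    P (U @^-1` A) = ((ball_volume d)^-1%:E * leb d A)%E.
  by move=> mA AB; rewrite ball_law//; congr (_ * leb d _)%E; exact: setIidl.
exact: (@law_Rintegral R _ _ _ _ P (leb d) U _ _ _ M mU mB k0 (@leb_l1ball_lty R d) PU mg).
Qed.

End ball_law.

Definition to_RV (R : realType) (d : nat) (disp : measure_display)
    (Omega : measurableType disp) (P : probability Omega R) (phi : Omega -> 'rV[R]_d)
    (mphi : measurable_fun setT phi) : {RV P >-> 'rV[R]_d} :=
  HB.pack phi (isMeasurableFun.Build _ _ _ _ _ mphi).

Section swap_laws.
Context {R : realType} {n : nat} {disp : measure_display}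
  {Omega : measurableType disp} {P : probability Omega R} (i : 'I_n.+1).

Lemma measurable_swap_RV (X : {RV P >-> 'rV[R]_n.+1}) :
  measurable_fun setT (rV_swap i \o X).
Proof. by apply: measurableT_comp => //; exact: measurable_rV_swap. Qed.

Definition swap_RV (X : {RV P >-> 'rV[R]_n.+1}) : {RV P >-> 'rV[R]_n.+1} :=
  to_RV P (measurable_swap_RV X).

Lemma swap_RVE X w : swap_RV X w = rV_swap i (X w).
Proof. by []. Qed.

Lemma swap_l1sphere : rV_swap i @^-1` @l1sphere R n.+1 = @l1sphere R n.+1.
Proof. by rewrite l1sphereE; apply/seteqP; split=> x /=; rewrite l1norm_swap. Qed.

Lemma swap_l1ball : rV_swap i @^-1` @l1ball R n.+1 = @l1ball R n.+1.
Proof. by rewrite l1ballE; apply/seteqP; split=> x /=; rewrite l1norm_swap. Qed.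

Lemma sphere_unif_swap (zeta : {RV P >-> 'rV[R]_n.+1}) :
  (forall A : set 'rV[R]_n.+1, measurable A ->
    distribution P zeta A = uniform_law (@surface_measure R n.+1) (@l1sphere R n.+1) A) ->
  forall A : set 'rV[R]_n.+1, measurable A ->
    distribution P (swap_RV zeta) A =
    uniform_law (@surface_measure R n.+1) (@l1sphere R n.+1) A.
Proof.
move=> zu A mA.
have mTA : measurable (rV_swap i @^-1` A).
  by apply: measurable_preim => //; exact: measurable_rV_swap.
have AS : rV_swap i @^-1` A `&` @l1sphere R n.+1 = rV_swap i @^-1` (A `&` @l1sphere R n.+1).
  by rewrite preimage_setI swap_l1sphere.
have E := sphere_law_isometry zu (@isometry_swap R n i) (rV_swapK i) (rV_swapK i) mTA mA AS.
exact: etrans E (zu A mA).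
Qed.

Lemma ball_unif_swap (U : {RV P >-> 'rV[R]_n.+1}) :
  (forall A : set 'rV[R]_n.+1, measurable A ->
    distribution P U A = uniform_law (@lebesgue_rV R n.+1) (@l1ball R n.+1) A) ->
  forall A : set 'rV[R]_n.+1, measurable A ->
    distribution P (swap_RV U) A =
    uniform_law (@lebesgue_rV R n.+1) (@l1ball R n.+1) A.
Proof.
move=> Uu A mA.
have mTA : measurable (rV_swap i @^-1` A).
  by apply: measurable_preim => //; exact: measurable_rV_swap.
have mB := @measurable_l1ball R n.+1.
apply: (etrans (Uu _ mTA)); apply: uniform_law_congr; rewrite lebE.
apply: etrans (leb_swap i (measurableI _ _ mA mB)).
by rewrite preimage_setI swap_l1ball.
Qed.

End swap_laws.

Section volume.
Context {R : realType} {n : nat} {disp : measure_display}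
  {Omega : measurableType disp} {P : probability Omega R}
  {zeta : {RV P >-> 'rV[R]_n.+1}}.
Hypothesis n_gt0 : (0 < n)%N.
Hypothesis zeta_unif : forall A : set 'rV[R]_n.+1, measurable A ->
  distribution P zeta A = uniform_law (@surface_measure R n.+1) (@l1sphere R n.+1) A.

Lemma measurable_norm_coord (i : 'I_n.+1) :
  measurable_fun setT (fun x : 'rV[R]_n.+1 => `|x ord0 i|).
Proof. by apply: measurableT_comp => //; exact: measurable_coord. Qed.

Lemma sphere_coord_le1 (x : 'rV[R]_n.+1) i : @l1sphere R n.+1 x -> `| `|x ord0 i| | <= 1.
Proof. by rewrite l1sphereE /= normr_id => <-; exact: ler_coord_l1norm. Qed.

(** Fubini's theorem for the constant 1. *)
Lemma ball_volume_slice : ball_volume n.+1 =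
  \int[leb n]_(u in @l1ball R n) (2 * (1 - l1norm u)).
Proof.
have [|_] := @ball_Fubini R n (cst 1) 1 (measurable_cst _); first by move=> x _; rewrite normr1.
rewrite Rintegral_cst; last exact: measurable_l1ball.
rewrite mul1r {1}/ball_volume => ->; apply: eq_Rintegral => u; rewrite inE l1ballE /= => u1.
rewrite /ball_slice Rintegral_cst// mul1r.
rewrite [X in fine X](lebesgue_measure_itv `](- (1 - l1norm u)), (1 - l1norm u)[)/=.
by rewrite lte_fin ifT /=; [ring|lra].
Qed.

(** For coordinate 0 this is the mean of [1 - |u|] over the ball, whose integral is half of
    the volume in dimension [n.+1]; exchanging coordinates preserves the law. *)
Lemma expectation_norm_coord (i : 'I_n.+1) :
  \int[P]_w `|zeta w ord0 i| = ball_volume n.+1 / (2 * ball_volume n).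
Proof.
have [_] := @sphere_integral _ _ _ _ _ _ n_gt0 (sphere_unif_swap i zeta_unif) _ 1
  (measurable_norm_coord ord0) (fun x => @sphere_coord_le1 x ord0).
under eq_Rintegral do rewrite swap_RVE mxE tpermL.
move=> ->; rewrite ball_volume_slice mulrC; congr (_ * _).
apply: eq_Rintegral => u; rewrite inE l1ballE /= => u1.
by rewrite !rV_cons0 mul1r mulN1r normrN ger0_norm; lra.
Qed.

(** The expectation of the l1 norm of [zeta] is 1 on the one hand, and the sum of the equal
    numbers given by [expectation_norm_coord] on the other hand. *)
Lemma ball_volume_rec : n.+1%:R * ball_volume n.+1 = 2 * ball_volume n :> R.
Proof.
have V0 := @ball_volume_gt0 R n.
have l1 x : @l1sphere R n.+1 x -> `|l1norm x| <= 1.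
  by rewrite l1sphereE /= => ->; rewrite normr1.
have [_ E1] := @sphere_integral _ _ _ _ _ _ n_gt0 zeta_unif (@l1norm R n.+1) 1
  measurable_l1norm l1.
have : \int[P]_w l1norm (zeta w) = 1.
  rewrite E1 (@eq_Rintegral _ _ _ _ _ (cst 2)).
    rewrite Rintegral_cst; last exact: measurable_l1ball.
    by rewrite -/(ball_volume n); field; lra.
  by move=> u; rewrite inE => uB; rewrite !l1norm_lift ?normrN1 ?normr1//; lra.
have -> : \int[P]_w l1norm (zeta w) = \sum_(i < n.+1) \int[P]_w `|zeta w ord0 i|.
  have iw i : P.-integrable setT (fun w => (`|zeta w ord0 i|)%:E).
    exact: (@sphere_integral _ _ _ _ _ _ n_gt0 zeta_unif _ 1
      (measurable_norm_coord i) (fun x => @sphere_coord_le1 x i)).1.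
  rewrite /Rintegral; under eq_integral do rewrite /l1norm -sumEFin.
  rewrite integral_sum// -sum_fine// => i _; exact: integrable_fin_num.
pose r : R := ball_volume n.+1 / (2 * ball_volume n).
rewrite (eq_bigr (fun=> r)) => [|i _]; last exact: expectation_norm_coord.
rewrite sumr_const card_ord -[X in X = 1 -> _]mulr_natl => h.
have -> : ball_volume n.+1 = r * (2 * ball_volume n) by rewrite /r; field; lra.
by rewrite mulrA h mul1r.
Qed.

End volume.

(** * The mean over a ball and its gradient *)

Section lipschitz.
Context {R : realType} {d : nat}.

Definition l1_lipschitz (L : R) (f : 'rV[R]_d -> R) :=
  forall x y, `|f x - f y| <= L * l1norm (x - y).

Lemma l1_lipschitz_affine (L : R) f (x : 'rV[R]_d) (h : R) : l1_lipschitz L f ->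
  l1_lipschitz (L * `|h|) (fun u => f (x + h *: u)).
Proof.
move=> fL u v; apply: le_trans (fL _ _) _.
by rewrite opprD addrACA subrr add0r -scalerBr l1normZ mulrA.
Qed.

Lemma l1_lipschitz_bound (L : R) f (x u : 'rV[R]_d) (h : R) : 0 <= L -> l1_lipschitz L f ->
  l1norm u <= 1 -> `|f (x + h *: u)| <= `|f x| + L * `|h|.
Proof.
move=> L0 fL u1; have := ler_normD (f (x + h *: u) - f x) (f x); rewrite subrK => H.
apply: le_trans H _; rewrite addrC lerD2l; apply: le_trans (fL _ _) _.
rewrite addrC addKr l1normZ; apply: ler_wpM2l => //.
by rewrite -[leRHS]mulr1; exact: ler_wpM2l.
Qed.

End lipschitz.

Lemma measurable_rV_opp (R : realType) n : measurable_fun setT (fun u : 'rV[R]_n => - u).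
Proof.
apply: measurable_rVP => i; under eq_fun do rewrite mxE.
by apply: measurableT_comp => //; exact: measurable_coord.
Qed.

Lemma rV_delta0 (R : realType) n :
  delta_mx ord0 ord0 = rV_cons 1 0 :> 'rV[R]_n.+1.
Proof.
apply/rowP => i; case: (unliftP ord0 i) => [j|] ->.
  by rewrite rV_consS !mxE.
by rewrite rV_cons0 !mxE.
Qed.

Section directional_step.
Context {R : realType} {n : nat} {disp : measure_display}
  {Omega : measurableType disp} {P : probability Omega R}
  {U zeta : {RV P >-> 'rV[R]_n.+1}}.
Hypothesis n_gt0 : (0 < n)%N.
Hypothesis U_unif : forall A : set 'rV[R]_n.+1, measurable A ->
  distribution P U A = uniform_law (@lebesgue_rV R n.+1) (@l1ball R n.+1) A.
Hypothesis zeta_unif : forall A : set 'rV[R]_n.+1, measurable A ->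
  distribution P zeta A = uniform_law (@surface_measure R n.+1) (@l1sphere R n.+1) A.
Context {h L : R} (h0 : 0 < h) (L0 : 0 <= L).
Context {f : 'rV[R]_n.+1 -> R} (fL : l1_lipschitz L f).
Local Notation mu := (@lebesgue_measure R).
Local Notation d := n.+1.

Definition grad_sample (x z : 'rV[R]_n.+1) (i : 'I_n.+1) : R :=
  (f (x + h *: z) - f (x - h *: z)) * sign1 (z ord0 i).

Lemma measurable_f_affine (x : 'rV[R]_d) (a : R) :
  measurable_fun setT (fun u : 'rV[R]_d => f (x + a *: u)).
Proof. exact: measurable_lipschitz (l1_lipschitz_affine x a fL). Qed.

Lemma measurable_grad_sample x i : measurable_fun setT (fun z : 'rV[R]_d => grad_sample x z i).
Proof.
apply: measurable_funM.
  apply: measurable_funB; first exact: measurable_f_affine.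
  have -> : (fun z => f (x - h *: z)) = (fun z => f (x + (- h) *: z)).
    by apply/funext => z; rewrite scaleNr.
  exact: measurable_f_affine.
have -> : (fun z : 'rV[R]_d => sign1 (z ord0 i)) = (fun z => if 0 <= z ord0 i then 1 else -1).
  by [].
apply: measurable_fun_ifT => //; apply: measurable_fun_ler => //.
exact: measurable_coord.
Qed.

Lemma grad_sample_bound x z i : l1norm z = 1 -> `|grad_sample x z i| <= L * (2 * h).
Proof.
move=> z1; rewrite normrM [X in _ * X](_ : _ = 1) ?mulr1; last first.
  by rewrite /sign1; case: ifP; rewrite ?normrN normr1.
apply: le_trans (fL _ _) _.
have -> : x + h *: z - (x - h *: z) = (2 * h) *: z.
  by apply/rowP => j; rewrite !mxE; ring.
by rewrite l1normZ z1 mulr1 gtr0_norm// mulr_gt0.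
Qed.

Let D (x : 'rV[R]_d) (u : 'rV[R]_n) : R :=
  f (x + h *: lift_sphere 1 u) - f (x + h *: lift_sphere (-1) u).

Let measurable_D x : measurable_fun setT (D x).
Proof.
have ml := @measurable_lift_sphere R n.
apply: measurable_funB.
  exact: (measurableT_comp (measurable_f_affine x h) (ml 1)).
exact: (measurableT_comp (measurable_f_affine x h) (ml (-1))).
Qed.

Let D_bound x u : @l1ball R n u -> `|D x u| <= L * (2 * h).
Proof.
move=> uB; apply: le_trans (fL _ _) _; apply: ler_wpM2l => //.
rewrite opprD addrACA subrr add0r -scalerBr l1normZ gtr0_norm// mulrC.
apply: ler_wpM2r; first exact: ltW.
by apply: le_trans (l1normD _ _) _; rewrite l1normN !l1norm_lift ?normrN1 ?normr1.
Qed.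

Lemma ball_reflect_integral (g : 'rV[R]_n -> R) (M : R) : measurable_fun setT g ->
  (forall u, @l1ball R n u -> `|g u| <= M) ->
  \int[leb n]_(u in @l1ball R n) g (- u) = \int[leb n]_(u in @l1ball R n) g u.
Proof.
move=> mg gM.
have mN := @measurable_rV_opp R n.
have mB := @measurable_l1ball R n.
have Nleb A : measurable A -> A `<=` @l1ball R n ->
    leb n ((fun u => - u) @^-1` A) = (1%:E * leb n A)%E.
  move=> mA _; rewrite mul1e -(leb_opp 0 mA); congr (leb n _).
  by apply/seteqP; split => u /=; rewrite sub0r.
have BN : (fun u : 'rV[R]_n => - u) @^-1` @l1ball R n = @l1ball R n.
  by rewrite l1ballE; apply/seteqP; split => u /=; rewrite l1normN.
have E := @law_Rintegral R _ _ _ _ (leb n) (leb n) _ _ 1 g M mN mB ler01 (@leb_l1ball_lty R n) Nleb mg gM.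
by move: E; rewrite BN mul1r.
Qed.

(** The two lifts contribute [D u] and [D (- u)], where [D] is the difference of [f] between
    the upper and the lower lift, because the antipode of the upper lift of [u] is the
    lower lift of [- u]. Since the ball is symmetric, both have the same integral. *)
Lemma expectation_grad_sample0 x :
  \int[P]_w grad_sample x (zeta w) ord0 =
  (ball_volume n)^-1 * \int[leb n]_(u in @l1ball R n) D x u.
Proof.
have V0 := @ball_volume_gt0 R n.
have gb z : @l1sphere R d z -> `|grad_sample x z ord0| <= L * (2 * h).
  by rewrite l1sphereE /=; exact: grad_sample_bound.
have [_ ->] := @sphere_integral _ _ _ _ _ _ n_gt0 zeta_unif _ _ (measurable_grad_sample x ord0) gb.
have mN := @measurable_rV_opp R n.
have mB := @measurable_l1ball R n.
have mDN : measurable_fun setT (fun u : 'rV[R]_n => D x (- u)).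
  exact: (measurableT_comp (measurable_D x) mN).
have DNb u : @l1ball R n u -> `|D x (- u)| <= L * (2 * h).
  by move=> uB; apply: D_bound; move: uB; rewrite l1ballE /= l1normN.
rewrite (@eq_Rintegral _ _ _ _ _ (fun u => D x u + D x (- u))); last first.
  move=> u; rewrite inE l1ballE /= => u1; rewrite /grad_sample /D /lift_sphere.
  rewrite !rV_cons0 /sign1 mul1r mulN1r ifT ?ifF; [|lra|lra].
  rewrite !l1normN !rV_consZ.
  set b := 1 - l1norm u.
  have -> : x - rV_cons (h * b) (h *: u) = x + rV_cons (h * - b) (h *: - u).
    by rewrite rV_consN mulrN scalerN.
  have -> : x - rV_cons (h * - b) (h *: u) = x + rV_cons (h * b) (h *: - u).
    by rewrite rV_consN mulrN opprK scalerN.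
  by rewrite mul1r mulN1r; ring.
have iD := bounded_integrable mB (@leb_l1ball_lty R n) (measurable_funTS (measurable_D x)) (@D_bound x).
have iDN := bounded_integrable mB (@leb_l1ball_lty R n) (measurable_funTS mDN) DNb.
rewrite RintegralD// (ball_reflect_integral (measurable_D x) (@D_bound x)).
by field; lra.
Qed.

Definition ball_mean (x : 'rV[R]_d) : R := \int[P]_w f (x + h *: U w).

Lemma ball_mean_integral (x : 'rV[R]_d) :
  P.-integrable setT (EFin \o (fun w => f (x + h *: U w))) /\
  ball_mean x = (ball_volume d)^-1 * \int[leb d]_(u in @l1ball R d) f (x + h *: u).
Proof.
apply: (@ball_law_integral _ _ _ _ _ _ U_unif (fun u => f (x + h *: u)) (`|f x| + L * `|h|)).
  exact: measurable_f_affine.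
by move=> u; rewrite l1ballE /= => u1; apply: l1_lipschitz_bound => //; exact: ltW.
Qed.

(** [lipschitz_shift_integral] on each slice of the ball with step [t / h], then integration
    over [u]. The main term is [t / (h * V_d)] times the integral of [D], which matches
    the expectation because [V_n / V_d = d / 2]. *)
Lemma directional_step0 (x : 'rV[R]_d) (t : R) :
  `|ball_mean (x + t *: delta_mx ord0 ord0) - ball_mean x -
    t * (d%:R / (2 * h) * \int[P]_w grad_sample x (zeta w) ord0)| <=
  L * d%:R / h * t ^+ 2.
Proof.
have V0 := @ball_volume_gt0 R n; have W0 := @ball_volume_gt0 R d.
have VW := ball_volume_rec n_gt0 zeta_unif.
have Vn : ball_volume n = d%:R * ball_volume d / 2 :> R.
  by apply: (@mulfI _ (2 : R)) => //; rewrite -VW; field.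
set x' := x + t *: delta_mx ord0 ord0.
rewrite !(ball_mean_integral _).2 expectation_grad_sample0.
have fb (y u : 'rV[R]_d) : @l1ball R d u -> `|f (y + h *: u)| <= `|f y| + L * `|h|.
  by rewrite l1ballE /= => u1; apply: l1_lipschitz_bound => //; exact: ltW.
have [i1 ->] := ball_Fubini (measurable_f_affine x' h) (fb x').
have [i2 ->] := ball_Fubini (measurable_f_affine x h) (fb x).
set g1 := ball_slice _ in i1 *; set g2 := ball_slice _ in i2 *.
have mB := @measurable_l1ball R n; have Boo := @leb_l1ball_lty R n.
have iD := bounded_integrable mB Boo (measurable_funTS (measurable_D x)) (@D_bound x).
(* A step [t] of the base point shifts by [tau] the parameter of the slice in the unit ball. *)
pose tau := t / h.
have slice u : @l1ball R n u -> `|g1 u - g2 u - tau * D x u| <= 2 * (L * h) * tau ^+ 2.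
  rewrite l1ballE /= => u1.
  pose b := 1 - l1norm u; have b0 : 0 < b by rewrite /b; lra.
  pose phi s := f (x + h *: rV_cons s u).
  have phiL s1 s2 : `|phi s1 - phi s2| <= L * h * `|s1 - s2|.
    apply: le_trans (fL _ _) _; rewrite opprD addrACA subrr add0r -scalerBr l1normZ.
    rewrite gtr0_norm// -mulrA; do 2 apply: ler_wpM2l => //; first exact: ltW.
    rewrite rV_consN rV_consD l1norm_cons subrr.
    by rewrite /l1norm big1 ?addr0// => i _; rewrite mxE normr0.
  have mphi : measurable_fun setT phi.
    by apply: (measurableT_comp (measurable_f_affine x h)); exact: measurable_rV_cons.
  have phit s : f (x' + h *: rV_cons s u) = phi (s + tau).
    rewrite /phi /x'; congr f; rewrite -addrA; congr (_ + _).
    rewrite rV_delta0 !rV_consZ rV_consD mulr1 scaler0 add0r; congr rV_cons.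
    by rewrite /tau; field; rewrite gt_eqF.
  have Lh0 : 0 <= L * h by rewrite mulr_ge0// ltW.
  have bb : - b <= b by apply: (@le_trans _ _ 0); rewrite ?oppr_le0 ltW.
  have key := lipschitz_shift_integral tau bb Lh0 mphi phiL.
  have DE : D x u = phi b - phi (- b) by rewrite /D /lift_sphere mul1r mulN1r.
  rewrite DE; apply: le_trans key; rewrite le_eqVlt; apply/orP; left; apply/eqP; congr (`| _ - _ |).
  have iphi (y : R -> R) (Ly : forall s1 s2, `|y s1 - y s2| <= L * h * `|s1 - s2|) (my : measurable_fun setT y) :
      mu.-integrable `]- b, b] (EFin \o y) /\
      \int[mu]_(s in `]- b, b[) y s = \int[mu]_(s in `]- b, b]) y s.
    have iy := lipschitz_itv_integrable (- b) b Lh0 my Ly; split => //.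
    apply: Rintegral_itv_bndo_bndc; apply: integrableS iy => //.
    by move=> s; rewrite /= !in_itv/= => /andP[-> /ltW].
  have phiLt s1 s2 : `|phi (s1 + tau) - phi (s2 + tau)| <= L * h * `|s1 - s2|.
    by apply: le_trans (phiL _ _) _; rewrite opprD addrACA subrr addr0.
  have mphit : measurable_fun setT (fun s : R => phi (s + tau)).
    by apply: (measurableT_comp mphi); exact: measurable_funD.
  have [ip ep] := iphi _ phiL mphi; have [ipt ept] := iphi _ phiLt mphit.
  rewrite RintegralB// -ep -ept /g1 /g2 /ball_slice; congr (_ - _).
  by apply: eq_Rintegral => s _; rewrite phit.
have ig : (leb n).-integrable (@l1ball R n) (EFin \o (fun u => g1 u - g2 u)).
  exact: (integrableB mB i1 i2).
have mtD : measurable_fun setT (fun u => tau * D x u) by exact: measurable_funM.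
have itD : (leb n).-integrable (@l1ball R n) (EFin \o (fun u => tau * D x u)).
  have := integrableZl mB tau iD; by apply: eq_integrable.
have mall : measurable_fun (@l1ball R n) (fun u => g1 u - g2 u - tau * D x u).
  apply: measurable_funB; last exact: measurable_funTS.
  by apply/measurable_EFinP; exact: (measurable_int (leb n)).
have bnd := le_Rintegral_bound mB Boo mall slice.
have int : \int[leb n]_(u in @l1ball R n) (g1 u - g2 u - tau * D x u) =
   \int[leb n]_(u in @l1ball R n) g1 u - \int[leb n]_(u in @l1ball R n) g2 u -
   tau * \int[leb n]_(u in @l1ball R n) D x u.
  by rewrite RintegralB// RintegralB// RintegralZl.
rewrite int -/(ball_volume n) in bnd.
move: bnd; set I1 := \int[leb n]_(u in _) g1 u; set I2 := \int[leb n]_(u in _) g2 u.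
set I3 := \int[leb n]_(u in _) D x u => bnd.
have -> : (ball_volume d)^-1 * I1 - (ball_volume d)^-1 * I2 -
    t * (d%:R / (2 * h) * ((ball_volume n)^-1 * I3)) =
    (ball_volume d)^-1 * (I1 - I2 - tau * I3).
  rewrite Vn.
  by rewrite /tau; field; rewrite !gt_eqF// ltr_wpDr.
rewrite normrM gtr0_norm ?invr_gt0// ler_pdivrMl//.
apply: le_trans bnd _; rewrite le_eqVlt; apply/orP; left; apply/eqP.
by rewrite Vn /tau; field; rewrite gt_eqF.
Qed.

End directional_step.

Section quadratic_approximation.
Context {R : realType} {d : nat}.

Lemma l1norm_le_norm (v : 'rV[R]_d) : l1norm v <= d%:R * `|v|.
Proof.
apply: (@le_trans _ _ (\sum_(i < d) `|v|)).
  apply: ler_sum => i _; rewrite [leRHS]mx_normrE.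
  exact: (le_bigmax _ (fun j : 'I_1 * 'I_d => `|v j.1 j.2|) (ord0, i)).
by rewrite sumr_const card_ord mulr_natl.
Qed.

(** An affine approximation with quadratic error gives the Frechet derivative and hence
    the partial derivatives. *)
Lemma differentiable_quadratic (F : 'rV[R]_d -> R) (x g : 'rV[R]_d) (K : R) : 0 <= K ->
  (forall v, `|F (x + v) - F x - \sum_i v ord0 i * g ord0 i| <= K * l1norm v ^+ 2) ->
  differentiable F x /\ forall i, 'D_(delta_mx ord0 i) F x = g ord0 i.
Proof.
move=> K0 FK.
pose df (v : 'rV[R]_d) : R^o := \sum_i v ord0 i * g ord0 i.
have dflin : linear df.
  move=> a u v; rewrite /df scaler_sumr -big_split; apply: eq_bigr => i _ /=.
  by rewrite !mxE mulrDl -mulrA.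
pose dfL : {linear 'rV[R]_d -> R^o} := HB.pack df (GRing.isLinear.Build _ _ _ _ _ dflin).
have dfc : continuous dfL.
  apply: (@continuous_big R^o _ +%R 0 predT) => [|i _ v]; first exact: add_continuous.
  apply: (@continuousM R _ (fun x0 : 'rV[R]_d => x0 ord0 i) (cst (g ord0 i))); [exact: coord_continuous|exact: cst_continuous].
pose FO : 'rV[R]_d -> R^o := F.
have step : FO \o shift x = cst (FO x) + dfL +o_ (0 : 'rV[R]_d) id.
  apply/eqaddoP => e e0.
  pose c := K * d%:R ^+ 2.
  have c0 : 0 <= c by rewrite mulr_ge0// exprn_ge0.
  (* [c + 1] instead of [c], which may vanish. *)
  have q0 : 0 < e / (c + 1) by rewrite divr_gt0// ltr_wpDl.
  near=> v.
  rewrite /= !fctE /= opprD addrA [v + x]addrC.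
  apply: le_trans (FK v) _; apply: (@le_trans _ _ (c * `|v| ^+ 2)).
    rewrite /c -mulrA -exprMn; apply: ler_wpM2l => //.
    by rewrite ler_sqr ?nnegrE ?mulr_ge0 ?l1norm_ge0// l1norm_le_norm.
  rewrite expr2 mulrA; apply: ler_wpM2r => //.
  have v1 : `|v| <= e / (c + 1).
    by near: v; exact: (@nbhs0_le R 'rV[R]_d _ q0).
  apply: (@le_trans _ _ (c * (e / (c + 1)))); first exact: ler_wpM2l.
  rewrite mulrCA; apply: ler_piMr; first exact: ltW.
  by rewrite ler_pdivrMr ?mul1r ?lerDl// ltr_wpDl.
have dF : 'd FO x = dfL :> ('rV[R]_d -> R^o) by exact: diff_unique dfc step.
have DF : differentiable FO x by apply/diff_locallyP; rewrite dF.
split => // i; rewrite -[LHS]/('D_(delta_mx ord0 i) FO x) deriveE// dF /= /df (bigD1 i)//= big1 ?addr0.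
  by rewrite mxE !eqxx mul1r.
by move=> j ji; rewrite mxE (negbTE ji) andbF mul0r.
Unshelve. all: by end_near. Qed.

(** Go from [x] to [x + v] one coordinate at a time. Each step has quadratic error, and the
    candidate derivative at its starting point differs from the one at [x] by a
    multiple of the norm of [v]. *)
Lemma coordinate_steps (F : 'rV[R]_d -> R) (G : 'rV[R]_d -> 'rV[R]_d) (K : R) : 0 <= K ->
  (forall x t i, `|F (x + t *: delta_mx ord0 i) - F x - t * G x ord0 i| <= K * t ^+ 2) ->
  (forall x y i, `|G x ord0 i - G y ord0 i| <= K * l1norm (x - y)) ->
  forall x v, `|F (x + v) - F x - \sum_i v ord0 i * G x ord0 i| <= 2 * K * l1norm v ^+ 2.
Proof.
move=> K0 FG GL x v.
(* The path follows the axes in increasing order. *)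
pose w (k : nat) : 'rV[R]_d := \row_j (if (j < k)%N then v ord0 j else 0).
have w0 : w 0%N = 0 by apply/rowP => j; rewrite !mxE.
have wd : w d = v by apply/rowP => j; rewrite !mxE ltn_ord.
have wS (i : 'I_d) : w i.+1 = w i + v ord0 i *: delta_mx ord0 i.
  apply/rowP => j; rewrite !mxE eqxx /= ltnS leq_eqVlt.
  have [->|ji] := eqVneq j i; first by rewrite eqxx ltnn mulr1 add0r.
  by rewrite (_ : (j == i :> nat) = false) ?mulr0 ?addr0//; apply/negbTE.
have wv k : l1norm (w k) <= l1norm v.
  by apply: ler_sum => j _; rewrite mxE; case: ifP; rewrite ?normr0.
have tel : F (x + v) - F x = \sum_(i < d) (F (x + w i.+1) - F (x + w i)).
  have := telescope_sumr (fun k => F (x + w k)) (leq0n d).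
  by rewrite w0 wd addr0 big_mkord => <-.
rewrite tel -sumrB; apply: le_trans (ler_norm_sum _ _ _) _.
have -> : 2 * K * l1norm v ^+ 2 = \sum_(i < d) 2 * K * l1norm v * `|v ord0 i|.
  by rewrite -mulr_sumr expr2 mulrA.
apply: ler_sum => i _; rewrite wS addrA.
set y := x + w i; set t := v ord0 i.
have h1 := FG y t i; have h2 := GL y x i.
have h3 : l1norm (y - x) <= l1norm v by rewrite /y addrAC subrr add0r.
have ht : `|t| <= l1norm v := ler_coord_l1norm v i.
have -> : F (y + t *: delta_mx ord0 i) - F y - t * G x ord0 i =
  (F (y + t *: delta_mx ord0 i) - F y - t * G y ord0 i) + t * (G y ord0 i - G x ord0 i) by ring.
apply: le_trans (ler_normD _ _) _; rewrite normrM.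
have h4 : K * t ^+ 2 <= K * (l1norm v * `|t|).
  by apply: ler_wpM2l => //; rewrite -real_normK ?num_real// expr2; apply: ler_wpM2r.
have h5 : `|t| * `|G y ord0 i - G x ord0 i| <= `|t| * (K * l1norm v).
  apply: ler_wpM2l => //; apply: le_trans h2 _; exact: ler_wpM2l.
lra.
Qed.

End quadratic_approximation.

Section gradient.
Context {R : realType} {n : nat} {disp : measure_display}
  {Omega : measurableType disp} {P : probability Omega R}
  {U zeta : {RV P >-> 'rV[R]_n.+1}}.
Hypothesis n_gt0 : (0 < n)%N.
Hypothesis U_unif : forall A : set 'rV[R]_n.+1, measurable A ->
  distribution P U A = uniform_law (@lebesgue_rV R n.+1) (@l1ball R n.+1) A.
Hypothesis zeta_unif : forall A : set 'rV[R]_n.+1, measurable A ->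
  distribution P zeta A = uniform_law (@surface_measure R n.+1) (@l1sphere R n.+1) A.
Context {h L : R} (h0 : 0 < h) (L0 : 0 <= L).
Context {f : 'rV[R]_n.+1 -> R} (fL : l1_lipschitz L f).
Local Notation d := n.+1.
Local Notation S := (@l1sphere R n.+1).
Local Notation fh := (@ball_mean R n disp Omega P U h f).
Local Notation gs := (@grad_sample R n h f).

Lemma rV_swap_delta i : rV_swap i (delta_mx ord0 ord0) = delta_mx ord0 i :> 'rV[R]_d.
Proof.
apply/rowP => j; rewrite !mxE eqxx /=; congr (_%:R).
by rewrite -(inj_eq (@perm_inj _ (tperm ord0 i))) tpermK tpermL.
Qed.

(** Exchange coordinates 0 and [i] in [f], in both random variables and in the base point. *)
Lemma directional_step x t i :
  `|fh (x + t *: delta_mx ord0 i) - fh x -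
    t * (d%:R / (2 * h) * \int[P]_w gs x (zeta w) i)| <= L * d%:R / h * t ^+ 2.
Proof.
pose f' z := f (rV_swap i z).
have f'L : l1_lipschitz L f'.
  by move=> y z; apply: le_trans (fL _ _) _; rewrite -rV_swapN -rV_swapD l1norm_swap.
have := directional_step0 n_gt0 (ball_unif_swap i U_unif) (sphere_unif_swap i zeta_unif)
  h0 L0 f'L (rV_swap i x) t.
have bm y : @ball_mean R n disp Omega P (swap_RV i U) h f' (rV_swap i y) = fh y.
  apply: eq_Rintegral => w _.
  by rewrite /f' swap_RVE rV_swapD rV_swapZ !rV_swapK.
have -> : rV_swap i x + t *: delta_mx ord0 ord0 = rV_swap i (x + t *: delta_mx ord0 i).
  by rewrite rV_swapD rV_swapZ -(rV_swap_delta i) rV_swapK.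
rewrite !bm.
rewrite (@eq_Rintegral _ _ _ _ setT (fun w => gs x (zeta w) i))//.
move=> w _; rewrite /grad_sample /f' swap_RVE -rV_swapZ -!rV_swapN -!rV_swapD !rV_swapK.
by rewrite mxE tpermL.
Qed.

Lemma grad_sample_integrable x i :
  P.-integrable setT (EFin \o (fun w => gs x (zeta w) i)).
Proof.
have gb z : S z -> `|gs x z i| <= L * (2 * h).
  by rewrite l1sphereE /=; exact: (grad_sample_bound h0 fL).
exact: (sphere_integral n_gt0 zeta_unif (measurable_grad_sample fL x i) gb).1.
Qed.

Definition mean_grad (x : 'rV[R]_d) : 'rV[R]_d :=
  \row_i (d%:R / (2 * h) * \int[P]_w gs x (zeta w) i).

(** The difference quotients of [f] are Lipschitz in the base point. *)
Lemma mean_grad_lipschitz x y i :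
  `|mean_grad x ord0 i - mean_grad y ord0 i| <= L * d%:R / h * l1norm (x - y).
Proof.
have mz : measurable_fun setT (zeta : Omega -> 'rV[R]_d) by [].
rewrite !mxE -mulrBr -RintegralB//; try exact: grad_sample_integrable.
have db w : setT w -> `|gs x (zeta w) i - gs y (zeta w) i| <= 2 * L * l1norm (x - y).
  move=> _; rewrite /grad_sample -mulrBl normrM [X in _ * X](_ : _ = 1) ?mulr1; last first.
    by rewrite /sign1; case: ifP; rewrite ?normrN normr1.
  set z := zeta w.
  have -> : f (x + h *: z) - f (x - h *: z) - (f (y + h *: z) - f (y - h *: z)) =
    (f (x + h *: z) - f (y + h *: z)) - (f (x - h *: z) - f (y - h *: z)) by ring.
  apply: le_trans (ler_normB _ _) _.
  have e1 := fL (x + h *: z) (y + h *: z); have e2 := fL (x - h *: z) (y - h *: z).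
  have q1 : x + h *: z - (y + h *: z) = x - y by rewrite opprD addrACA subrr addr0.
  have q2 : x - h *: z - (y - h *: z) = x - y by rewrite opprD addrACA subrr addr0.
  by rewrite q1 in e1; rewrite q2 in e2; lra.
have Poo : (P setT < +oo)%E by rewrite probability_setT ltry.
have mg : measurable_fun setT (fun w => gs x (zeta w) i - gs y (zeta w) i).
  by apply: measurable_funB; apply: (measurableT_comp (measurable_grad_sample fL _ i)).
have bnd := le_Rintegral_bound measurableT Poo mg db.
have P1 : fine (P setT) = 1 by rewrite probability_setT.
have {}bnd := le_trans bnd (_ : _ <= 2 * L * l1norm (x - y)).
have {}bnd := bnd ltac:(rewrite [X in _ * X]P1 mulr1; exact: lexx).
have c0 : 0 < d%:R / (2 * h) by rewrite divr_gt0// mulr_gt0.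
rewrite normrM gtr0_norm//.
apply: (@le_trans _ _ (d%:R / (2 * h) * (2 * L * l1norm (x - y)))).
  by apply: ler_wpM2l => //; exact: ltW.
rewrite le_eqVlt; apply/orP; left; apply/eqP; field; rewrite gt_eqF//.
Qed.

Lemma ball_mean_gradient x : differentiable fh x /\
  forall i, d%:R / (2 * h) * \int[P]_w gs x (zeta w) i = grad fh x ord0 i.
Proof.
have K0 : 0 <= L * d%:R / h by rewrite divr_ge0 ?mulr_ge0// ltW.
have st y t i : `|fh (y + t *: delta_mx ord0 i) - fh y - t * mean_grad y ord0 i| <=
    L * d%:R / h * t ^+ 2.
  by rewrite mxE; exact: directional_step.
have K20 : 0 <= 2 * (L * d%:R / h) by rewrite mulr_ge0.
have [df Df] := differentiable_quadratic K20 (coordinate_steps K0 st mean_grad_lipschitz x).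
by split => // i; rewrite mxE Df mxE.
Qed.

End gradient.

(** * Moments of the coordinates *)

Section beta_moment.
Context {R : realType}.
Local Notation mu := (@lebesgue_measure R).

(** The bracket, multiplied by (1 - s)^(D - 1), is the derivative of -s^r (1 - s)^D, so it
    has integral 0 over the unit interval and the moment of order [r] is bounded
    without computing any Beta function. With [k = r / (r + D)] the
    inequality is Young's inequality for [k] and s^(r - 1), with equality at [s = k]. *)
Lemma moment_pointwise (r D s : R) : 1 <= r -> 1 <= D -> 0 <= s ->
  s `^ r <= (r / (r + D)) `^ r +
    r / (r + D) * ((r + D) * s `^ r - r * s `^ (r - 1)).
Proof.
move=> r1 D1 s0; set k := r / (r + D).
have k0 : 0 < k by rewrite divr_gt0; lra.
have kr : 0 < k `^ r by rewrite powR_gt0.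
have young : r * (k * s `^ (r - 1)) <= (r - 1) * s `^ r + k `^ r.
  have [->|rn1] := eqVneq r 1.
    by rewrite subrr powRr0 mul0r add0r mul1r mulr1 powRr1// ltW.
  have r1' : 0 < r - 1 by rewrite subr_gt0 lt_neqAle eq_sym rn1.
  have rr : 0 < r / (r - 1) by rewrite divr_gt0; lra.
  have conj : r^-1 + (r / (r - 1))^-1 = 1 by field; rewrite !gt_eqF; lra.
  have := conjugate_powR (ltW k0) (powR_ge0 s (r - 1)) (_ : 0 < r) rr conj.
  have e : (s `^ (r - 1)) `^ (r / (r - 1)) = s `^ r.
    by rewrite -powRrM; congr (_ `^ _); field; rewrite gt_eqF.
  rewrite e => /(_ ltac:(lra)) H.
  have r0 : 0 < r by lra.
  have : r * (k * s `^ (r - 1)) <= r * (k `^ r / r + s `^ r / (r / (r - 1))).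
    by apply: ler_wpM2l => //; exact: ltW.
  have -> // : r * (k `^ r / r + s `^ r / (r / (r - 1))) = (r - 1) * s `^ r + k `^ r.
    by field; rewrite !gt_eqF.
have kE : k * (r + D) = r by rewrite /k; field; lra.
have -> : k * ((r + D) * s `^ r - r * s `^ (r - 1)) =
   (k * (r + D)) * s `^ r - r * (k * s `^ (r - 1)) by ring.
rewrite kE; lra.
Qed.

Lemma beta_derive (r : R) (n : nat) (s : R) : 0 < s ->
  is_derive s 1 (fun t => - (t `^ r * (1 - t) ^+ n.+1))
    (((r + n.+1%:R) * s `^ r - r * s `^ (r - 1)) * (1 - s) ^+ n).
Proof.
move=> s0.
have d1 : is_derive s 1 (fun t => t `^ r) (r * s `^ (r - 1)) by exact: is_derive1_powR.
have d2 := is_deriveX n.+1 (is_deriveB (is_derive_cst (1 : R) s 1) (is_derive_id s 1)).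
have d3 := is_deriveN (is_deriveM d1 d2).
have -> : (fun t => - (t `^ r * (1 - t) ^+ n.+1)) =
    - ((fun t => t `^ r) * (cst 1 - id) ^+ n.+1) by rewrite !fctE.
have sr : s `^ r = s `^ (r - 1) * s.
  by rewrite -{3}[s](@powRr1 R s (ltW s0)) -powRD ?subrK//; apply/implyP => _; rewrite gt_eqF.
have E : ((r + n.+1%:R) * s `^ r - r * s `^ (r - 1)) * (1 - s) ^+ n =
  - (s `^ r *: ((n.+1%:R * (cst 1 - id) s ^+ n.+1.-1) *: (0 - 1)) +
     ((cst 1 - id) ^+ n.+1) s *: (r * s `^ (r - 1))).
  rewrite !fctE /GRing.scale /= exprS sr; ring.
by rewrite E.
Qed.

Lemma powR_right0 (a : R) : 0 <= a -> s `^ a @[s --> 0^'+] --> 0 `^ a.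
Proof.
move=> a0; have [->|an0] := eqVneq a 0.
  by under eq_cvg do rewrite powRr0; rewrite powRr0; exact: cvg_cst.
by rewrite powR0//; apply: powR_cvg0; rewrite lt_neqAle eq_sym an0.
Qed.

Lemma powR_continuous_at (a s : R) : 0 < s -> {for s, continuous (fun t => t `^ a)}.
Proof.
move=> s0; apply: differentiable_continuous; apply/derivable1_diffP.
by have [] := @is_derive1_powR R a s s0.
Qed.

Lemma onemX_continuous (n : nat) : continuous (fun s : R => (1 - s) ^+ n).
Proof.
move=> s; apply: (@continuous_comp _ _ _ (fun s : R => 1 - s) (fun t : R => t ^+ n)).
  by apply: continuousB; [exact: cst_continuous|exact: cvg_id].
exact: exprn_continuous.
Qed.

Lemma at_right_continuous (g : R -> R) (a : R) : {for a, continuous g} -> g s @[s --> a^'+] --> g a.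
Proof. by move=> ga; apply: cvg_at_right_filter. Qed.

Lemma at_left_continuous (g : R -> R) (a : R) : {for a, continuous g} -> g s @[s --> a^'-] --> g a.
Proof. by move=> ga; apply: cvg_at_left_filter. Qed.

Lemma powR_onemX_at (a s : R) (n : nat) : 0 < s ->
  {for s, continuous (fun t : R => t `^ a * (1 - t) ^+ n)}.
Proof.
move=> s0; apply: (@continuousM R _ (fun t : R => t `^ a) (fun t : R => (1 - t) ^+ n)).
  exact: powR_continuous_at.
exact: onemX_continuous.
Qed.

Lemma powR_onemX_within (a : R) (n : nat) : 0 <= a ->
  {within `[0, 1], continuous (fun s => s `^ a * (1 - s) ^+ n)}.
Proof.
move=> a0; apply/continuous_within_itvP => //; split.
- by move=> s; rewrite in_itv/= => /andP[s0 _]; exact: powR_onemX_at.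
- apply: cvgM; first exact: powR_right0.
  by apply: (at_right_continuous (g := fun s => (1 - s) ^+ n)); exact: onemX_continuous.
- by apply: at_left_continuous; exact: powR_onemX_at.
Qed.

(** The primitive vanishes at both ends of the interval. *)
Lemma beta_integral0 (r : R) (n : nat) : 1 <= r ->
  (\int[mu]_(s in `[0%R, 1%R])
    (((r + n.+1%:R) * s `^ r - r * s `^ (r - 1)) * (1 - s) ^+ n)%:E = 0)%E.
Proof.
move=> r1; have r0 : 0 <= r by lra.
have r10 : 0 <= r - 1 by lra.
rewrite (@continuous_FTC2 R _ (fun t => - (t `^ r * (1 - t) ^+ n.+1)) 0 1)//.
- by rewrite powR0 ?gt_eqF//; [rewrite subrr expr0n mulr0 mul0r subee|lra].
- have -> : (fun s => ((r + n.+1%:R) * s `^ r - r * s `^ (r - 1)) * (1 - s) ^+ n) =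
    (fun s => (r + n.+1%:R) * (s `^ r * (1 - s) ^+ n) - r * (s `^ (r - 1) * (1 - s) ^+ n)).
    by apply/funext => s; ring.
  move=> s; apply: cvgB.
    by apply: cvgM; [exact: cvg_cst|exact: powR_onemX_within].
  by apply: cvgM; [exact: cvg_cst|exact: powR_onemX_within].
- have /continuous_within_itvP[//|_ c0 c1] := @powR_onemX_within r n.+1 r0.
  split.
  + by move=> s; rewrite in_itv/= => /andP[s0 _]; have [] := @beta_derive r n s s0.
  + exact: cvgN.
  + exact: cvgN.
- move=> s; rewrite in_itv/= => /andP[s0 _]; rewrite derive1E.
  by have [_ ->] := @beta_derive r n s s0.
Qed.

End beta_moment.

Section coordinate_moment.
Context {R : realType}.
Local Notation mu := (@lebesgue_measure R).

Lemma powR_onemX_integrable (a : R) (n : nat) : 0 <= a ->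
  mu.-integrable `[0, 1] (EFin \o (fun s => s `^ a * (1 - s) ^+ n)).
Proof.
move=> a0; apply: continuous_compact_integrable; first exact: segment_compact.
exact: powR_onemX_within.
Qed.

Lemma onemX_integrable (n : nat) : mu.-integrable `[0, 1] (EFin \o (fun s : R => (1 - s) ^+ n)).
Proof.
apply: continuous_compact_integrable; first exact: segment_compact.
by apply: continuous_subspaceT; exact: onemX_continuous.
Qed.

Lemma beta_moment_le (r : R) (n : nat) : 1 <= r ->
  \int[mu]_(s in `[0, 1]) (s `^ r * (1 - s) ^+ n) <=
  (r / (r + n.+1%:R)) `^ r * \int[mu]_(s in `[0, 1]) (1 - s) ^+ n.
Proof.
move=> r1; have r0 : 0 <= r by lra.
have r10 : 0 <= r - 1 by lra.
(* [psi] is the exact derivative integrated in [beta_integral0]; adding [k * psi] to the constant [k `^ r]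
   leaves the integral unchanged and dominates the integrand. *)
pose k := r / (r + n.+1%:R).
pose psi s := ((r + n.+1%:R) * s `^ r - r * s `^ (r - 1)) * (1 - s) ^+ n.
have mI : measurable (`[0, 1] : set (measurableTypeR R)) by [].
have ipsi : mu.-integrable `[0, 1] (EFin \o psi).
  have i1 := integrableZl mI (r + n.+1%:R) (powR_onemX_integrable n r0).
  have i2 := integrableZl mI r (powR_onemX_integrable n r10).
  apply: eq_integrable (integrableB mI i1 i2) => // s _.
  by rewrite /psi /= -!EFinM -EFinB; congr (_%:E); ring.
have psi0 : \int[mu]_(s in `[0, 1]) psi s = 0.
  by rewrite /Rintegral; have := beta_integral0 n r1; rewrite /psi => ->.
have i3 := integrableZl mI (k `^ r) (onemX_integrable n).
have i4 := integrableZl mI k ipsi.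
have : \int[mu]_(s in `[0, 1]) (s `^ r * (1 - s) ^+ n) <=
    \int[mu]_(s in `[0, 1]) (k `^ r * (1 - s) ^+ n + k * psi s).
  apply: le_Rintegral => //.
  - exact: powR_onemX_integrable.
  - exact: (integrableD mI i3 i4).
  - move=> s; rewrite /= in_itv/= => /andP[s0 s1].
    have -> : k `^ r * (1 - s) ^+ n + k * psi s =
       (k `^ r + k * ((r + n.+1%:R) * s `^ r - r * s `^ (r - 1))) * (1 - s) ^+ n.
      by rewrite /psi; ring.
    apply: ler_wpM2r; first by rewrite exprn_ge0// subr_ge0.
    by apply: moment_pointwise => //; rewrite ler1n.
move/le_trans; apply.
rewrite RintegralD// RintegralZl// ?RintegralZl//; last exact: onemX_integrable.
by rewrite psi0 mulr0 addr0.
Qed.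

Lemma leb_scaled_ball n (rho : R) : 0 < rho ->
  leb n [set u | l1norm u < rho] = (rho ^+ n * ball_volume n)%:E.
Proof.
move=> rho0.
have mB := @measurable_l1ball R n.
have a0 i : (const_mx rho^-1 : 'rV[R]_n) ord0 i != 0 by rewrite mxE invr_eq0 gt_eqF.
have E := leb_diag 0 a0 mB.
have pE : \prod_i `|(const_mx rho^-1 : 'rV[R]_n) ord0 i|^-1 = rho ^+ n.
  rewrite (eq_bigr (fun=> rho)) => [|i _]; last first.
    by rewrite mxE gtr0_norm ?invr_gt0// invrK.
  by rewrite prodr_const card_ord.
have <- : rV_diag (const_mx rho^-1) 0 @^-1` @l1ball R n = [set u | l1norm u < rho].
  rewrite l1ballE; apply/seteqP; split => u /=;
  have -> : rV_diag (const_mx rho^-1) 0 u = rho^-1 *: u by apply/rowP => i; rewrite !mxE addr0.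
    by rewrite l1normZ gtr0_norm ?invr_gt0// mulrC ltr_pdivrMr// mul1r.
  by rewrite l1normZ gtr0_norm ?invr_gt0// mulrC ltr_pdivrMr// mul1r.
apply: (etrans E); rewrite pE EFinM; congr (_ * _)%E; exact: ball_volumeE.
Qed.

(** The slices of the ball orthogonal to axis 0 are balls of radius [1 - |s|], whose volume
    scales with the power [n]. *)
Lemma ball_coord0_integral n (G : R -> R) : measurable_fun setT G -> (forall s, 0 <= G s) ->
  (\int[leb n.+1]_(x in @l1ball R n.+1) (G (x ord0 ord0))%:E =
   (ball_volume n)%:E * \int[mu]_(s in `](-1)%R, 1%R[) (G s * (1 - `|s|) ^+ n)%:E)%E.
Proof.
move=> mG G0.
pose W (p : measurableTypeR R * 'rV[R]_n) := rV_cons p.1 p.2.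
have mW : measurable_fun setT W by exact: measurable_rV_cons.
have mB := @measurable_l1ball R n.+1.
have mE : measurable (W @^-1` @l1ball R n.+1) by exact: measurable_preim.
pose pr := (mu \x leb n)%E : {measure set (measurableTypeR R * 'rV[R]_n) -> \bar R}.
pose GE (x : 'rV[R]_n.+1) := (G (x ord0 ord0))%:E.
have mGE : measurable_fun setT GE.
  by apply/measurable_EFinP; apply: (measurableT_comp mG); exact: measurable_coord.
have -> : (\int[leb n.+1]_(x in @l1ball R n.+1) GE x = \int[pushforward pr W]_(x in @l1ball R n.+1) GE x)%E.
  by apply: eq_measure_integral => A mA _; exact: leb_push.
have GE0 : {in @l1ball R n.+1, forall x, 0 <= GE x}%E by move=> x _; rewrite lee_fin.
apply: (etrans (ge0_integral_pushforward mW pr mB (measurable_funTS mGE) GE0)).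
rewrite integral_mkcond.
rewrite (@fubini_tonelli1 _ _ _ _ _ mu (leb n)) /fubini_F; last 2 first.
- by apply/(measurable_restrictT _ mE)/measurable_funTS; exact: measurableT_comp.
- by move=> p; apply: erestrict_ge0 => q _; rewrite lee_fin.
rewrite -ge0_integralZl//; last 3 first.
- apply/measurable_EFinP; apply: measurable_funTS; apply: measurable_funM => //.
  apply: measurable_funX; apply: measurable_funB => //.
- move=> s; rewrite /= in_itv/= -ltr_norml => s1.
  by rewrite lee_fin mulr_ge0// exprn_ge0// subr_ge0 ltW.
- by rewrite lee_fin ltW// ball_volume_gt0.
rewrite [RHS]integral_mkcond; apply: eq_integral => s _.
have phiE u : ((GE \o W) \_ (W @^-1` @l1ball R n.+1)) (s, u) =
    ((cst (G s)%:E) \_ [set u | l1norm u < 1 - `|s|]) u.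
  rewrite !patchE /= /GE /W /= rV_cons0; congr (if _ then _ else _).
  by apply/idP/idP; rewrite !inE l1ballE /= l1norm_cons ltrBrDl.
rewrite (eq_integral _ _ (fun u _ => phiE u)) -integral_mkcond patchE.
case: ifPn => [|/negP]; rewrite inE /= in_itv/= -ltr_norml => s1.
  have s0 : 0 < 1 - `|s| by rewrite subr_gt0.
  rewrite integral_cst; last first.
    have -> : [set u : 'rV[R]_n | l1norm u < 1 - `|s|] = (@l1norm R n) @^-1` `]-oo, (1 - `|s|)[.
      by apply/seteqP; split=> u; rewrite /= in_itv.
    by apply: measurable_preim => //; exact: measurable_l1norm.
  by rewrite [X in (_ * X)%E](leb_scaled_ball n s0) -!EFinM; congr (_%:E); ring.
rewrite (_ : [set u | _] = set0) ?integral_set0//; apply/seteqP; split => u //=.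
have := l1norm_ge0 u; move/negP: s1; rewrite -leNgt; lra.
Qed.

Lemma even_integral (g : R -> R) : measurable_fun setT g -> (forall s, 0 <= g s) ->
  (forall s, g (- s) = g s) ->
  (\int[mu]_(s in `](-1)%R, 1%R[) (g s)%:E = 2%:E * \int[mu]_(s in `[0%R, 1%R]) (g s)%:E)%E.
Proof.
move=> mg g0 geven.
have mEg : measurable_fun setT (EFin \o g) by exact/measurable_EFinP.
have half : (\int[mu]_(s in `](-1)%R, 0%R]) (g s)%:E = \int[mu]_(s in `[0%R, 1%R[) (g s)%:E)%E.
  rewrite integral_mkcond [RHS]integral_mkcond.
  have := @ge0_integral_affine R (-1) 0 ((EFin \o g) \_ `[0%R, 1%R[).
  rewrite oppr_eq0 oner_neq0 normrN1 invr1 mul1e => <-//; last 2 first.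
  - have mI : measurable (`[0%R, 1%R[ : set R) by [].
    by apply/(measurable_restrictT (EFin \o g) mI)/measurable_funTS.
  - by move=> s; apply: erestrict_ge0 => q _; rewrite lee_fin.
  apply: eq_integral => s _; rewrite !patchE /= mulN1r addr0 geven.
  by congr (if _ then _ else _); apply/idP/idP; rewrite !inE /= !in_itv/=; lra.
rewrite (@itv_bndbnd_setU _ _ _ (BRight 0))//; last 2 first.
- by rewrite bnd_simp; lra.
- by rewrite bnd_simp; lra.
rewrite ge0_integral_setU//; last 3 first.
- exact: measurable_funTS.
- by move=> s _; rewrite lee_fin.
- apply/disj_setPS => s [] /=; rewrite !in_itv/= => /andP[_ s0] /andP[s1 _].
  by move: (lt_le_trans s1 s0); rewrite ltxx.
rewrite half integral_itv_obnd_cbnd; last exact: measurable_funTS.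
rewrite integral_itv_bndo_bndc; last exact: measurable_funTS.
by rewrite -mule2n mule_natl.
Qed.

End coordinate_moment.

(** * The lq norm and its mean over the ball *)

Section lqnorm.
Context {R : realType} {d : nat}.
Implicit Types (x u : 'rV[R]_d) (r : R).

Definition power_sum r x : R := \sum_(i < d) `|x ord0 i| `^ r.

Lemma power_sum_ge0 r x : 0 <= power_sum r x.
Proof. by apply: sumr_ge0 => i _; exact: powR_ge0. Qed.

Lemma lqnormE r x : lqnorm r%:E x = power_sum r x `^ r^-1.
Proof. by []. Qed.

Lemma lqnorm_power r x : 0 < r -> lqnorm r%:E x `^ r = power_sum r x.
Proof.
move=> r0; rewrite lqnormE -powRrM mulVf ?gt_eqF// powRr1//; exact: power_sum_ge0.
Qed.

Lemma lqnorm_ge0 r x : 0 <= lqnorm r%:E x.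
Proof. exact: powR_ge0. Qed.

Lemma coord_le_lqnorm r x i : 0 < r -> `|x ord0 i| <= lqnorm r%:E x.
Proof.
move=> r0; have -> : `|x ord0 i| = (`|x ord0 i| `^ r) `^ r^-1.
  by rewrite -powRrM mulfV ?gt_eqF// powRr1.
rewrite lqnormE; apply: ge0_ler_powR; rewrite ?nnegrE ?powR_ge0 ?power_sum_ge0//.
  by rewrite invr_ge0 ltW.
by rewrite /power_sum (bigD1 i)//= lerDl; apply: sumr_ge0 => j _; exact: powR_ge0.
Qed.

Lemma powR_le_split (a N r s : R) : 0 <= a -> a <= N -> 0 < r -> r <= s ->
  a `^ s <= N `^ (s - r) * a `^ r.
Proof.
move=> a0 aN r0 rs; have [->|an0] := eqVneq a 0.
  by rewrite powR0 ?mulr_ge0 ?powR_ge0// gt_eqF//; exact: lt_le_trans rs.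
have -> : a `^ s = a `^ (s - r) * a `^ r.
  by rewrite -powRD ?subrK// an0 implybT.
apply: ler_wpM2r; first exact: powR_ge0.
apply: ge0_ler_powR; rewrite ?nnegrE ?subr_ge0//; exact: le_trans aN.
Qed.

(** Every coordinate is at most the norm [N] of exponent [r], so for [s >= r] the sum of
    s-th powers is at most N^(s - r) times the sum of r-th powers, that is N^s. *)
Lemma lqnorm_antimono r (q : \bar R) x : 0 < r -> (r%:E <= q)%E ->
  lqnorm q x <= lqnorm r%:E x.
Proof.
move=> r0; case: q => [s||] rq.
- move: rq; rewrite lee_fin => rs; have s0 : 0 < s by exact: lt_le_trans rs.
  set N := lqnorm r%:E x; have N0 : 0 <= N by exact: lqnorm_ge0.
  have NE : N = (N `^ s) `^ s^-1 by rewrite -powRrM mulfV ?gt_eqF// powRr1.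
  rewrite lqnormE NE; apply: ge0_ler_powR; rewrite ?nnegrE ?powR_ge0 ?power_sum_ge0//.
    by rewrite invr_ge0 ltW.
  apply: (@le_trans _ _ (\sum_(i < d) N `^ (s - r) * `|x ord0 i| `^ r)).
    by apply: ler_sum => i _; apply: powR_le_split => //; exact: coord_le_lqnorm.
  rewrite -mulr_sumr -/(power_sum r x) -lqnorm_power// -/N.
  have [->|Nn0] := eqVneq N 0.
    by rewrite (powR0 (_ : r != 0)) ?gt_eqF// mulr0 powR_ge0.
  by rewrite -powRD ?subrK// Nn0 implybT.
- apply: bigmax_le; first exact: lqnorm_ge0.
  by move=> i _; exact: coord_le_lqnorm.
- by move: rq; rewrite leeNy_eq.
Qed.

Lemma lqnormZ r (a : R) x : 0 < r -> 0 <= a -> lqnorm r%:E (a *: x) = a * lqnorm r%:E x.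
Proof.
move=> r0 a0; rewrite !lqnormE.
have -> : power_sum r (a *: x) = a `^ r * power_sum r x.
  rewrite /power_sum mulr_sumr; apply: eq_bigr => i _.
  by rewrite mxE normrM (ger0_norm a0) powRM.
by rewrite powRM ?powR_ge0 ?power_sum_ge0// -powRrM mulfV ?gt_eqF// powRr1.
Qed.

(** Tangent line at b^r of the concave function t^(1/r): it replaces Jensen's
    inequality, and integrating it only requires the moments of the coordinates. *)
Lemma lqnorm_young r (b : R) x : 1 <= r -> 0 < b ->
  lqnorm r%:E x <= (r * b `^ (r - 1))^-1 * power_sum r x + (r - 1) / r * b.
Proof.
move=> r1 b0; have r0 : 0 < r by exact: lt_le_trans r1.
set N := lqnorm r%:E x; have N0 : 0 <= N by exact: lqnorm_ge0.
rewrite -lqnorm_power// -/N.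
(* For [r = 1] there is no conjugate exponent, and both sides are equal. *)
have [->|rn1] := eqVneq r 1.
  by rewrite subrr powRr0 powRr1// !mul1r !mul0r addr0 invr1 mul1r.
have r1' : 0 < r - 1 by rewrite subr_gt0 lt_neqAle eq_sym rn1.
have bp : 0 < b `^ (r - 1) by rewrite powR_gt0.
have rr : 0 < r / (r - 1) by rewrite divr_gt0.
(* Young's inequality for [N] and b^(r - 1), divided by b^(r - 1). *)
have conj : r^-1 + (r / (r - 1))^-1 = 1 by field; rewrite !gt_eqF.
have := conjugate_powR N0 (ltW bp) r0 rr conj.
have -> : (b `^ (r - 1)) `^ (r / (r - 1)) = b `^ (r - 1) * b.
  rewrite -powRrM (_ : (r - 1) * (r / (r - 1)) = (r - 1) + 1); last by field; rewrite gt_eqF.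
  by rewrite powRD ?powRr1 ?ltW// (gt_eqF b0) implybT.
rewrite -ler_pdivlMr// => H; apply: le_trans H _.
rewrite le_eqVlt; apply/orP; left; apply/eqP; field; rewrite !gt_eqF//.
Qed.

End lqnorm.

Section expectation_bound.
Context {R : realType} {n : nat} {disp : measure_display}
  {Omega : measurableType disp} {P : probability Omega R}
  {U : {RV P >-> 'rV[R]_n.+1}}.
Hypothesis U_unif : forall A : set 'rV[R]_n.+1, measurable A ->
  distribution P U A = uniform_law (@lebesgue_rV R n.+1) (@l1ball R n.+1) A.
Local Notation mu := (@lebesgue_measure R).
Local Notation d := n.+1.

Lemma measurable_coord_power (i : 'I_d) (r : R) :
  measurable_fun setT (fun x : 'rV[R]_d => `|x ord0 i| `^ r).
Proof.
apply: (@measurableT_comp _ _ _ _ _ _ (@powR R ^~ r)); first exact: measurable_powR.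
by apply: measurableT_comp => //; exact: measurable_coord.
Qed.

Lemma coord_power_le1 (i : 'I_d) (r : R) (x : 'rV[R]_d) : 0 <= r ->
  @l1ball R d x -> `| `|x ord0 i| `^ r | <= 1.
Proof.
move=> r0; rewrite l1ballE /= => x1; rewrite ger0_norm ?powR_ge0//.
have -> : 1 = 1 `^ r :> R by rewrite powR1.
apply: ge0_ler_powR => //; rewrite ?nnegrE//.
by apply: le_trans (ler_coord_l1norm x i) _; exact: ltW.
Qed.

Lemma coord_power_integrable (X : {RV P >-> 'rV[R]_d}) (i : 'I_d) (r : R) : 0 <= r ->
  (forall A : set 'rV[R]_d, measurable A ->
    distribution P X A = uniform_law (@lebesgue_rV R d) (@l1ball R d) A) ->
  P.-integrable setT (EFin \o (fun w => `|X w ord0 i| `^ r)).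
Proof.
move=> r0 Xu.
exact: (ball_law_integral Xu (measurable_coord_power i r) (fun x => @coord_power_le1 i r x r0)).1.
Qed.

Lemma ball_coord0_Rintegral (G : R -> R) : measurable_fun setT G ->
    (forall s, 0 <= G s) -> (forall s, G (- s) = G s) ->
    mu.-integrable `[0, 1] (EFin \o (fun s => G s * (1 - s) ^+ n)) ->
  \int[leb d]_(x in @l1ball R d) G (x ord0 ord0) =
  ball_volume n * (2 * \int[mu]_(s in `[0, 1]) (G s * (1 - s) ^+ n)).
Proof.
move=> mG G0 Geven iG.
(* The outer absolute value makes the integrand nonnegative on the whole line. *)
pose g (s : R) := G s * `|1 - `|s| | ^+ n.
have mg : measurable_fun setT g.
  apply: measurable_funM => //; apply: measurable_funX; apply: measurableT_comp => //.
  exact: measurable_funB.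
have g0 s : 0 <= g s by rewrite mulr_ge0// exprn_ge0.
have geven s : g (- s) = g s by rewrite /g normrN Geven.
rewrite /Rintegral (ball_coord0_integral n mG G0).
have -> : (\int[mu]_(s in `](-1)%R, 1%R[) (G s * (1 - `|s|) ^+ n)%:E =
           \int[mu]_(s in `](-1)%R, 1%R[) (g s)%:E)%E.
  apply: eq_integral => s; rewrite inE /= in_itv/= -ltr_norml => s1.
  by rewrite /g [`|1 - _|]ger0_norm// subr_ge0 ltW.
rewrite (even_integral mg g0 geven).
have -> : (\int[mu]_(s in `[0%R, 1%R]) (g s)%:E =
           \int[mu]_(s in `[0%R, 1%R]) (G s * (1 - s) ^+ n)%:E)%E.
  apply: eq_integral => s; rewrite inE /= in_itv/= => /andP[s0 s1].
  by rewrite /g (ger0_norm s0) [`|1 - _|]ger0_norm// subr_ge0.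
have mI : measurable (`[0%R, 1%R]%classic : set (measurableTypeR R)) by [].
have fG := integrable_fin_num mI iG.
by rewrite -[X in (_ * (_ * X))%E](fineK fG) -!EFinM.
Qed.

Lemma ball_volume_slices :
  ball_volume d = ball_volume n * (2 * \int[mu]_(s in `[0, 1]) ((1 - s) ^+ n)) :> R.
Proof.
have E : (fun s : R => cst 1 s * (1 - s) ^+ n) = (fun s => (1 - s) ^+ n).
  by apply/funext => s; rewrite /cst mul1r.
have i1 := @onemX_integrable R n; rewrite -E in i1.
have := @ball_coord0_Rintegral (cst 1) (measurable_cst _) (fun=> ler01) (fun=> erefl) i1.
rewrite E => <-; rewrite -[LHS]mul1r; apply: esym.
exact: (Rintegral_cst (leb d) (@measurable_l1ball R d) 1).
Qed.

(** Ratio of the integrals of s^r (1 - s)^n and of (1 - s)^n over the unit interval. *)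
Lemma coord_moment (i : 'I_d) (r : R) : 1 <= r ->
  \int[P]_w (`|U w ord0 i| `^ r) <= (r / (r + d%:R)) `^ r.
Proof.
move=> r1; have r0 : 0 <= r by lra.
have Uu := ball_unif_swap i U_unif.
have [_] := ball_law_integral Uu (measurable_coord_power ord0 r) (fun x => @coord_power_le1 ord0 r x r0).
under eq_Rintegral do rewrite swap_RVE mxE tpermL.
have mp : measurable_fun setT (fun s : R => `|s| `^ r).
  by apply: (@measurableT_comp _ _ _ _ _ _ (@powR R ^~ r)) => //; exact: measurable_powR.
have pE : {in `[0%R, 1%R]%classic, forall s : R, `|s| `^ r * (1 - s) ^+ n = s `^ r * (1 - s) ^+ n}.
  by move=> s; rewrite inE /= in_itv/= => /andP[s0 _]; rewrite ger0_norm.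
have ip : mu.-integrable `[0, 1] (EFin \o (fun s => `|s| `^ r * (1 - s) ^+ n)).
  apply: eq_integrable (powR_onemX_integrable n r0) => // s s01.
  by rewrite /= (pE s s01).
move=> ->; rewrite (ball_coord0_Rintegral mp (fun s => powR_ge0 _ _) _ ip); last first.
  by move=> s; rewrite normrN.
have -> : \int[mu]_(s in `[0, 1]) (`|s| `^ r * (1 - s) ^+ n) =
          \int[mu]_(s in `[0, 1]) (s `^ r * (1 - s) ^+ n).
  by apply: eq_Rintegral => s s01; exact: pE.
have V0 := @ball_volume_gt0 R n.
have W0 := @ball_volume_gt0 R d.
rewrite -(@ler_pM2l _ (ball_volume d))// mulrA mulfV ?gt_eqF// mul1r.
rewrite ball_volume_slices; have := beta_moment_le n r1.
move=> h; have : ball_volume n * 2 * \int[mu]_(s in `[0, 1]) (s `^ r * (1 - s) ^+ n) <=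
   ball_volume n * 2 * ((r / (r + d%:R)) `^ r * \int[mu]_(s in `[0, 1]) ((1 - s) ^+ n)).
  by apply: ler_wpM2l => //; rewrite mulr_ge0// ltW.
lra.
Qed.

End expectation_bound.

Section mean_deviation.
Context {R : realType} {n : nat} {disp : measure_display}
  {Omega : measurableType disp} {P : probability Omega R}
  {U : {RV P >-> 'rV[R]_n.+1}}.
Hypothesis U_unif : forall A : set 'rV[R]_n.+1, measurable A ->
  distribution P U A = uniform_law (@lebesgue_rV R n.+1) (@l1ball R n.+1) A.
Local Notation d := n.+1.

Lemma expectation_power_sum (r : R) : 1 <= r ->
  P.-integrable setT (EFin \o (fun w => power_sum r (U w))) /\
  \int[P]_w power_sum r (U w) <= d%:R * (r / (r + d%:R)) `^ r.
Proof.
move=> r1; have r0 : 0 <= r by lra.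
have iw i : P.-integrable setT (EFin \o (fun w => `|U w ord0 i| `^ r)).
  exact: (coord_power_integrable i r0 U_unif).
have E : (EFin \o (fun w => power_sum r (U w))) =
   (fun w => \sum_(i < d) ((`|U w ord0 i| `^ r)%R)%:E)%E.
  by apply/funext => w; rewrite /= /power_sum sumEFin.
split; first by rewrite E; apply: integrable_sum => // i _; exact: iw.
have -> : \int[P]_w power_sum r (U w) = \sum_(i < d) \int[P]_w (`|U w ord0 i| `^ r).
  rewrite /Rintegral [X in fine (integral _ _ X)]E.
  rewrite integral_sum//.
  by rewrite -sum_fine// => i _; have := integrable_fin_num measurableT (iw i).
apply: (@le_trans _ _ (\sum_(i < d) (r / (r + d%:R)) `^ r)).
  by apply: ler_sum => i _; exact: coord_moment.
by rewrite sumr_const card_ord mulr_natl.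
Qed.

Context {h L : R} (h0 : 0 < h) (L0 : 0 <= L).
Context {f : 'rV[R]_n.+1 -> R} (fL : l1_lipschitz L f).

(** The expected [power_sum] is at most [b `^ r] for [b = d `^ r^-1 * (r / (r + d))], and
    with this [b] the right-hand side of [lqnorm_young] has expectation at most [b].
    Finally [r + d >= 1 + d]. *)
Lemma ball_mean_deviation (r : R) (x : 'rV[R]_d) : 1 <= r ->
  (forall y z, `|f y - f z| <= L * lqnorm r%:E (y - z)) ->
  `|@ball_mean R n disp Omega P U h f x - f x| <=
  d.+1%:R^-1 * r * d%:R `^ r^-1 * L * h.
Proof.
move=> r1 fr; have r0 : 0 < r by lra.
have [ifU _] := ball_mean_integral (h := h) U_unif L0 fL x.
have dp : 0 < d%:R :> R by [].
pose k := r / (r + d%:R); have k0 : 0 < k by rewrite divr_gt0 ?addr_gt0.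
pose b := d%:R `^ r^-1 * k; have b0 : 0 < b by rewrite mulr_gt0 ?powR_gt0.
have bE : b `^ r = d%:R * k `^ r.
  by rewrite /b powRM ?powR_ge0 ?ltW// -powRrM mulVf ?gt_eqF// powRr1 ?ltW.
pose c := (r * b `^ (r - 1))^-1.
have br0 : 0 < b `^ (r - 1) by rewrite powR_gt0.
have c0 : 0 < c by rewrite invr_gt0 mulr_gt0.
pose e := (r - 1) / r * b.
have [ips psle] := expectation_power_sum r1.
have mT := @measurableT _ Omega.
have PT : fine (P setT) = 1 by rewrite probability_setT.
have iC (a : R) : P.-integrable setT (EFin \o (cst a : Omega -> R)).
  by apply: finite_measure_integrable_cst.
have -> : @ball_mean R n disp Omega P U h f x - f x = \int[P]_w (f (x + h *: U w) - f x).
  rewrite (RintegralB mT ifU (iC (f x))).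
  by have -> : \int[P]_(w in setT) f x = f x by rewrite Rintegral_cst// PT mulr1.
have iB := integrableB mT ifU (iC (f x)).
apply: le_trans (le_normr_Rintegral mT iB) _.
have i1 := integrableZl mT (L * h * c) ips.
apply: (@le_trans _ _ (\int[P]_w (L * h * c * power_sum r (U w) + L * h * e))).
  apply: le_Rintegral => //.
  - exact: integrable_norm.
  - exact: (integrableD mT i1 (iC (L * h * e))).
  move=> w _; apply: le_trans (fr _ _) _.
  rewrite addrC addKr (lqnormZ _ r0 (ltW h0)).
  have := lqnorm_young (U w) r1 b0; rewrite -/c -/e => Y.
  have Lh : 0 <= L * h by rewrite mulr_ge0// ltW.
  have := ler_wpM2l Lh Y; rewrite mulrDr !mulrA; exact.
rewrite (RintegralD mT i1 (iC _)) Rintegral_cst// PT mulr1.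
rewrite (RintegralZl _ mT ips).
have K : L * h * c * \int[P]_w power_sum r (U w) + L * h * e <= L * h * b.
  have -> : L * h * b = L * h * c * (d%:R * k `^ r) + L * h * e.
    have -> : d%:R * k `^ r = b `^ (r - 1) * b.
      by rewrite -bE -{3}(powRr1 (ltW b0)) -powRD ?subrK// (gt_eqF b0) implybT.
    by rewrite /c /e; field; rewrite !gt_eqF.
  rewrite lerD2r; apply: ler_wpM2l => //.
  by rewrite !mulr_ge0// ltW.
apply: le_trans K _.
have bb : b <= d.+1%:R^-1 * r * d%:R `^ r^-1.
  rewrite /b /k mulrC; apply: ler_wpM2r; first exact: powR_ge0.
  rewrite mulrC; apply: ler_wpM2r; first exact: ltW.
  rewrite lef_pV2 ?posrE ?addr_gt0//.
  by rewrite -addn1 natrD addrC lerD2r.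
have := ler_wpM2l (mulr_ge0 L0 (ltW h0)) bb.
by set v := _ * r * _; rewrite [v * _ * _](_ : _ = L * h * v)//; ring.
Qed.

End mean_deviation.

Section bq.
Context {R : realType}.

(** Take the sixth power of e^(1/6) <= 6/5, which is e^(-1/6) >= 1 - 1/6; (6/5)^6 < 3. *)
Lemma expR1_lt3 : expR 1 < 3 :> R.
Proof.
have := @expR_ge1Dx R (- 6^-1).
have -> : 1 + - 6^-1 = 5 / 6 :> R by field.
rewrite expRN => H.
have e0 := @expR_gt0 R 6^-1.
have {}H : expR 6^-1 <= 6 / 5 :> R.
  by rewrite -[leLHS]invrK -[leRHS]invrK lef_pV2 ?posrE ?invr_gt0//; lra.
have -> : 1 = 6%:R * 6^-1 :> R by rewrite mulfV.
rewrite expRM_natl; apply: (@le_lt_trans _ _ ((6 / 5) ^+ 6)); last lra.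
by apply: lerXn2r => //; rewrite nnegrE; lra.
Qed.

Lemma ln_gt1 (d : nat) : (3 <= d)%N -> 1 < ln d%:R :> R.
Proof.
move=> d3; have d0 : 0 < d%:R :> R by rewrite ltr0n; case: d d3.
rewrite -ltr_expR lnK ?posrE//; apply: lt_le_trans expR1_lt3 _.
by rewrite ler_nat.
Qed.

(** For [q >= ln d] the exponent [ln d], which minimises [r * d `^ r^-1], is allowed since it
    exceeds 1 when [d >= 3]; there d^(1 / ln d) = e. *)
Lemma bq_exponent (d : nat) (q : \bar R) : (3 <= d)%N -> (1 <= q)%E ->
  exists2 r : R, 1 <= r /\ (r%:E <= q)%E &
    d.+1%:R^-1 * r * d%:R `^ r^-1 = bq q d.
Proof.
move=> d3 q1; have l1 := ln_gt1 d3; rewrite /bq; case: ltP => ql.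
  case: q q1 ql => [r||]; [|by []|by []].
  by move=> r1 _; exists r.
exists (ln d%:R); first by split => //; exact: ltW.
have d0 : d%:R != 0 :> R by rewrite pnatr_eq0; case: d d3 {l1 ql}.
have -> : d%:R `^ (ln d%:R)^-1 = expR 1 :> R.
  by rewrite /powR (negPf d0) mulVf// gt_eqF//; lra.
by rewrite mulrAC.
Qed.

End bq.

(** * Convexity *)

Section convexity.
Context {R : realType} {n : nat} {disp : measure_display}
  {Omega : measurableType disp} {P : probability Omega R}
  {U : {RV P >-> 'rV[R]_n.+1}}.
Hypothesis U_unif : forall A : set 'rV[R]_n.+1, measurable A ->
  distribution P U A = uniform_law (@lebesgue_rV R n.+1) (@l1ball R n.+1) A.
Local Notation d := n.+1.
Context {h L : R} (L0 : 0 <= L).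
Context {f : 'rV[R]_n.+1 -> R} (fL : l1_lipschitz L f).
Local Notation fh := (@ball_mean R n disp Omega P U h f).

Lemma ball_mean_integrable (a : R) (x : 'rV[R]_d) :
  (leb d).-integrable (@l1ball R d) (EFin \o (fun u => f (x + a *: u))).
Proof.
apply: (bounded_integrable (M := `|f x| + L * `|a|)).
- exact: measurable_l1ball.
- exact: leb_l1ball_lty.
- apply: measurable_funTS; exact: (measurable_f_affine fL).
- by move=> u; rewrite l1ballE /= => u1; apply: l1_lipschitz_bound => //; exact: ltW.
Qed.

Variable Theta : set 'rV[R]_d.
Hypothesis f_convex : convex_function (dilated_sum Theta h (@l1ball R d)) f.

(** [convex_function] on the dilated set, in terms of the base points and of the points of
    the ball. *)
Lemma dilated_sum_convex (t : {i01 R}) (x y u v : 'rV[R]_d) :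
  Theta x -> Theta y -> @l1ball R d u -> @l1ball R d v ->
  f (t%:num *: (x + h *: u) + (1 - t%:num) *: (y + h *: v)) <=
  t%:num * f (x + h *: u) + (1 - t%:num) * f (y + h *: v).
Proof.
move=> xT yT uB vB; apply: (@f_convex t).
- by rewrite inE; exists x => //; exists u.
- by rewrite inE; exists y => //; exists v.
Qed.

(** The convex combination of [x + h u] and [y + h u] is the corresponding combination of
    [x] and [y], moved by the same [h u]. *)
Lemma ball_mean_convex : convex_function Theta fh.
Proof.
move=> t x y; rewrite !inE => xT yT.
set a := t%:num; set b : R := 1 - a.
change (fh (a *: x + b *: y) <= a * fh x + b * fh y).
rewrite !(ball_mean_integral U_unif L0 fL _).2.
have V0 := @ball_volume_gt0 R d.
rewrite !(mulrCA _ _^-1) -mulrDr; apply: ler_wpM2l; first by rewrite invr_ge0 ltW.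
have mB := @measurable_l1ball R d.
have iZ (c : R) z : (leb d).-integrable (@l1ball R d) (EFin \o (fun u => c * f (z + h *: u))).
  have := integrableZl mB c (ball_mean_integrable h z); by apply: eq_integrable.
rewrite -!(RintegralZl _ mB (ball_mean_integrable h _)).
rewrite -(RintegralD mB (iZ a x) (iZ b y)).
apply: le_Rintegral => //; first exact: ball_mean_integrable.
  exact: (integrableD mB (iZ a x) (iZ b y)).
move=> u uB; have := dilated_sum_convex t xT yT uB uB.
rewrite -/a -/b; congr (f _ <= _).
apply/rowP => i; rewrite !mxE /b; ring.
Qed.

(** [f x] is at most the half sum of [f (x + h u)] and [f (x - h u)], which have the same
    mean over the ball. *)
Lemma ball_mean_ge (x : 'rV[R]_d) : Theta x -> f x <= fh x.
Proof.
move=> xT; rewrite (ball_mean_integral U_unif L0 fL x).2.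
have V0 := @ball_volume_gt0 R d.
have mB := @measurable_l1ball R d; have Boo := @leb_l1ball_lty R d.
rewrite -(@ler_pM2l _ (ball_volume d))// mulrA mulfV ?gt_eqF// mul1r mulrC.
have -> : f x * ball_volume d = \int[leb d]_(u in @l1ball R d) f x.
  exact: (esym (Rintegral_cst (leb d) mB (f x))).
have mf := measurable_f_affine fL x h.
have fb (u : 'rV[R]_d) : @l1ball R d u -> `|f (x + h *: u)| <= `|f x| + L * `|h|.
  by rewrite l1ballE /= => u1; apply: l1_lipschitz_bound => //; exact: ltW.
have E := ball_reflect_integral mf fb.
have i1 := ball_mean_integrable h x.
have i2 : (leb d).-integrable (@l1ball R d) (EFin \o (fun u => f (x + h *: - u))).
  apply: eq_integrable (ball_mean_integrable (- h) x) => // u _.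
  by rewrite /= scalerN scaleNr.
have -> : \int[leb d]_(u in @l1ball R d) f (x + h *: u) =
    2^-1 * (\int[leb d]_(u in @l1ball R d) f (x + h *: u) +
            \int[leb d]_(u in @l1ball R d) f (x + h *: - u)).
  by rewrite E; field.
have i12 := integrableD mB i1 i2.
rewrite -(RintegralD mB i1 i2) -(RintegralZl _ mB i12).
have half01 : Itv.spec (@Itv.num_sem R) (Itv.Real `[0%Z, 1%Z]) (2^-1 : R).
  rewrite /= /Itv.num_sem/= num_real/= in_itv/=; lra.
apply: le_Rintegral => //.
- exact: (bounded_integrable mB Boo (measurable_cst _) (M := `|f x|)).
- exact: (integrableZl mB 2^-1 i12).
move=> u uB; have uB' : @l1ball R d (- u) by move: uB; rewrite l1ballE /= l1normN.
have := dilated_sum_convex (Itv.mk half01) xT xT uB uB'.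
rewrite /=; have -> : 1 - 2^-1 = 2^-1 :> R by field.
rewrite -mulrDr; congr (f _ <= _).
by apply/rowP => i; rewrite !mxE; field.
Qed.

End convexity.

(** * Properties of the smoothed function *)

Section expectations.
Context {R : realType} {n : nat} {disp : measure_display}
  {Omega : measurableType disp} {P : probability Omega R}
  {U zeta : {RV P >-> 'rV[R]_n.+1}}.
Local Notation d := n.+1.
Context {h L : R} {f : 'rV[R]_n.+1 -> R}.

Lemma smoothingE : smoothing P U h f = @ball_mean R n disp Omega P U h f.
Proof. by apply/funext => x; rewrite /smoothing unlock. Qed.

Hypothesis n_gt0 : (0 < n)%N.
Hypothesis zeta_unif : forall A : set 'rV[R]_n.+1, measurable A ->
  distribution P zeta A = uniform_law (@surface_measure R n.+1) (@l1sphere R n.+1) A.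
Hypotheses (h0 : 0 < h) (fL : l1_lipschitz L f).

Lemma expectation_grad_sample (x : 'rV[R]_d) (i : 'I_d) :
  ('E_P[(fun w => d%:R / (2 * h) *
          (f (x + h *: zeta w) - f (x - h *: zeta w)) * sign1 (zeta w ord0 i))%R] =
  (d%:R / (2 * h) * \int[P]_w @grad_sample R n h f x (zeta w) i)%R%:E)%E.
Proof.
have ig := grad_sample_integrable n_gt0 zeta_unif h0 fL x i.
rewrite unlock -RintegralZl//.
have igZ := integrableZl measurableT (d%:R / (2 * h)) ig.
rewrite /Rintegral fineK; last exact: (integrable_fin_num measurableT igZ).
by apply: eq_integral => w _; rewrite /= -mulrA.
Qed.

End expectations.

Theorem lemma1 (R : realType) (d : nat) (hd : (3 <= d)%N)
  (h : R) (h0 : 0 < h) (q : \bar R) (q1 : (1 <= q)%E) (L : R) (L0 : 0 < L)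
  (f : 'rV[R]_d -> R)
  (fL : forall x y : 'rV[R]_d, `|f x - f y| <= L * lqnorm q (x - y))
  (disp : measure_display) (Omega : measurableType disp)
  (P : probability Omega R)
  (U zeta : {RV P >-> 'rV[R]_d})
  (U_unif : forall A : set 'rV[R]_d, measurable A ->
     distribution P U A = uniform_law (@lebesgue_rV R d) (@l1ball R d) A)
  (zeta_unif : forall A : set 'rV[R]_d, measurable A ->
     distribution P zeta A =
     uniform_law (@surface_measure R d) (@l1sphere R d) A) :
  let fh := smoothing P U h f in
  [/\ forall x : 'rV[R]_d, differentiable fh x /\
        forall i : 'I_d,
          ('E_P[(fun w => d%:R / (2 * h) *
                   (f (x + h *: zeta w) - f (x - h *: zeta w)) *
                   sign1 (zeta w ord0 i))%R] = (grad fh x ord0 i)%:E)%E,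
      forall x : 'rV[R]_d, `|fh x - f x| <= bq q d * L * h &
      forall Theta : set 'rV[R]_d,
        convex_set Theta ->
        convex_function (dilated_sum Theta h (@l1ball R d)) f ->
        convex_function Theta fh /\
        forall x : 'rV[R]_d, Theta x -> f x <= fh x].
Proof.
case: d hd f fL U zeta U_unif zeta_unif => // n hd f fL U zeta U_unif zeta_unif fh.
have n_gt0 : (0 < n)%N by case: n hd {f fL U zeta U_unif zeta_unif fh}.
have L0' := ltW L0.
(* [f] is also Lipschitz for the smaller exponents, in particular for the l1 norm. *)
have fr (r : R) : 1 <= r -> (r%:E <= q)%E ->
    forall y z, `|f y - f z| <= L * lqnorm r%:E (y - z).
  move=> r1 rq y z; apply: le_trans (fL y z) _; apply: ler_wpM2l => //.
  by apply: lqnorm_antimono => //; exact: lt_le_trans r1.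
have f1 : l1_lipschitz L f by move=> y z; rewrite -lqnorm1; exact: fr.
rewrite /fh smoothingE; split.
- move=> x.
  have [df gf] := ball_mean_gradient n_gt0 U_unif zeta_unif h0 L0' f1 x.
  by split => // i; rewrite -gf (expectation_grad_sample n_gt0 zeta_unif h0 f1).
- move=> x; have [r [r1 rq] <-] := bq_exponent hd q1.
  exact: (ball_mean_deviation U_unif h0 L0' f1 x r1 (fr r r1 rq)).
- move=> Theta _ fT; split; first exact: (ball_mean_convex U_unif L0' f1 fT).
  exact: (ball_mean_ge U_unif L0' f1 fT).
Qed.
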